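(* Let $\theta>0$, let $N$ be a Poisson process with intensity $\lambda>0$ under $\mathsf{P}_0$, and suppose the state-price density is $\psi_t=\exp\{\theta N_t-(r+\lambda(e^\theta-1))t\}$, with constant interest rate $r$, and that the level of satisfaction is $Y^C_t=\eta e^{-\beta t}+\int_0^t\beta e^{-\beta(t-s)}\,dC_s$ with constants $\beta>0$, $\eta\ge0$. Suppose that the aggregator $f$ (satisfying the conditions (A1)–(A4) in the context, with the partial derivatives below existing) is such that for any $(t,y,u)\in[0,T]\times\mathbb{R}_+\times\mathbb{R}$, $$\mathfrak{L}f(t,y,u):=(r+\lambda(e^\theta-1))\,\partial_y f-\beta y\,\partial_y^2 f+\partial_t\partial_y f+\partial_u f\,\partial_y f-f\,\partial_u\partial_y f\ \le\ 0,$$ where $f$ and its derivatives are evaluated at $(t,y,u)$. Then, for initial wealth $w>0$, the optimal consumption plan for $\sup_{C\in\mathcal{A}(w)}U_0^C$ is given by $C_t=w$, $t\in[0,T]$ (all wealth is consumed at time $0$).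
   Context: Fix $T>0$. Let $(\Omega,\mathcal{F},\mathsf{P}_0)$ be a probability space carrying a standard Brownian motion $B=\{B_t\}_{t\in[0,T]}$ and a Poisson random measure $v$, which here is $v(dt,dx)=dN_t\,\delta_1(dx)$ with $N$ a Poisson process of intensity $\lambda$ (so its intensity measure is $\lambda\delta_1$). $(\mathcal{F}_t)_{t\in[0,T]}$ is the filtration generated by $B$, $v$ and the $\mathsf{P}_0$-negligible sets. $\mathsf{E}$ is expectation under $\mathsf{P}_0$, and $\mathsf{E}_t[\cdot]=\mathsf{E}[\cdot\mid\mathcal{F}_t]$. The market is complete with the single pricing measure $\mathsf{P}^*$ on $(\Omega,\mathcal{F}_T)$ given by $\frac{d\mathsf{P}^*}{d\mathsf{P}_0}=\exp(\theta N_T-\lambda(e^\theta-1)T)$, and $\psi_t=e^{-rt}\frac{d\mathsf{P}^*}{d\mathsf{P}_0}|_{\mathcal{F}_t}$. $\mathcal{X}$ is the set of consumption plans: distribution functions $C=\{C_t\}_{t\in[0,T]}$ of nonnegative optional random measures on $[0,T]$, i.e. nondecreasing, right-continuous, adapted, nonnegative processes, with $C_{0-}=0$; integrals $\int_0^t\cdots dC_s$ include the possible atoms at $0$ and $t$. Thus $C_t=w$ for all $t\in[0,T]$ means a single jump of size $w$ at time $0$. For $w>0$, $\mathcal{A}(w)=\{C\in\mathcal{X}:\ \mathsf{E}[\int_0^T\psi_t\,dC_t]\le w\}$ (equivalently $\mathsf{E}^*[\int_0^T e^{-rt}dC_t]\le w$, with $\mathsf{E}^*$ expectation under $\mathsf{P}^*$).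 The recursive utility $U^C$ is the unique adapted càdlàg process with $\mathsf{E}[\sup_{t}|U^C_t|^2]<\infty$ satisfying $U^C_t=\mathsf{E}_t[\int_t^T f(s,Y^C_s,U^C_s)\,ds]$, $t\in[0,T]$. Conditions on the Borel measurable aggregator $f:[0,T]\times\mathbb{R}_+\times\mathbb{R}\to\mathbb{R}$, $(s,y,u)\mapsto f(s,y,u)$, and on $\mathsf{P}^*$: (A1) for every $s\in[0,T]$, $f(s,\cdot,\cdot)$ is strictly concave and continuously differentiable, and for every $s\in[0,T]$, $u\in\mathbb{R}$, $f(s,\cdot,u)$ is strictly increasing; (A2) there is a constant $K$ with $|f(s,y,u)-f(s,y,u')|\le K|u-u'|$ for all $(s,y)\in[0,T]\times\mathbb{R}_+$, $u,u'\in\mathbb{R}$; (A3) there are constants $\alpha\in(0,\frac12)$ and $K$ with $|f(s,y,0)|\le K(1+|y|^\alpha)$ for all $s\in[0,T]$, $y\in\mathbb{R}_+$; (A4) there exists $p>1$ with $2\alpha p<1$ such that $\frac{d\mathsf{P}_0}{d\mathsf{P}^*}\in L^q(\mathsf{P}^* )$ for $q=\frac{1}{1-2\alpha p}$. In addition $\partial_y f$ is assumed to be continuously differentiable in $(t,y,u)$, so that $\mathfrak{L}f$ is well defined and continuous differentiation along paths is allowed. *)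

(* Defs.v *)
From HB Require Import structures.
From mathcomp Require Import all_boot all_order all_algebra.
From mathcomp Require Import all_classical all_reals all_analysis.

Set Implicit Arguments.
Unset Strict Implicit.
Unset Printing Implicit Defensive.

Import Order.TTheory GRing.Theory Num.Theory.
Import numFieldNormedType.Exports.

Local Open Scope classical_set_scope.
Local Open Scope ring_scope.

(* Processes are functions [X : R -> Omega -> R]; only the values at times in
   [0, T] are meaningful.  Sub-sigma-algebras are sets of sets. *)

Section sigma_algebras.
Context {d : measure_display} {Omega : measurableType d} {R : realType}.

Definition measurable_wrt (G : set (set Omega)) (X : Omega -> R) :=
  forall A : set R, measurable A -> G (X @^-1` A).

Definition sigma_process d' (S : measurableType d') (X : R -> Omega -> S)
    (I : set R) : set (set Omega) :=
  <<s \bigcup_(s in I) preimage_set_system setT (X s) measurable >>.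

Definition independent (P : probability Omega R) (G H : set (set Omega)) :=
  forall A B, G A -> H B -> (P (A `&` B) = P A * P B)%E.

(* [Z] is a version of E[X | G]. *)
Definition cond_expectation (P : probability Omega R) (G : set (set Omega))
    (X Z : Omega -> R) :=
  [/\ P.-integrable setT (EFin \o X), P.-integrable setT (EFin \o Z),
      measurable_wrt G Z &
      forall A, G A ->
        (\int[P]_(x in A) (Z x)%:E = \int[P]_(x in A) (X x)%:E)%E].

(* [D] is a version of the density d(nu|G) / d(mu|G). *)
Definition density_on (G : set (set Omega)) (nu mu : probability Omega R)
    (D : Omega -> R) :=
  [/\ measurable_wrt G D, forall x, 0 <= D x &
      forall A, G A -> (nu A = \int[mu]_(x in A) (D x)%:E)%E].

End sigma_algebras.

Definition cadlag {R : realType} (T : R) (g : R -> R) :=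
  (forall t : R, 0 <= t < T -> g @ t^'+ --> g t) /\
  (forall t : R, 0 < t <= T -> cvg (g @ t^'-)).

Section driving_processes.
Context {d : measure_display} {Omega : measurableType d} {R : realType}.
Variables (P : probability Omega R) (T : R).

Record brownian_motion (B : R -> Omega -> R) : Prop := BrownianMotion {
  brownian_measurable : forall t : R, 0 <= t <= T -> measurable_fun setT (B t) ;
  brownian0 : {ae P, forall w, B 0 w = 0} ;
  brownian_continuous : {ae P, forall w,
    {within `[0, T], continuous (fun t => B t w)}} ;
  brownian_normal : forall s t : R, 0 <= s -> s < t -> t <= T ->
    forall A : set R, measurable A ->
      P ((fun w => B t w - B s w) @^-1` A)
      = normal_prob 0 (Num.sqrt (t - s)) A ;
  brownian_indep : forall s t : R, 0 <= s -> s < t -> t <= T ->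
    independent P (sigma_process B `[0, s])
      (preimage_set_system setT (fun w => B t w - B s w) measurable) }.

Record poisson_process (lambda : R) (N : R -> Omega -> nat) : Prop :=
  PoissonProcess {
  poisson_measurable : forall t : R, 0 <= t <= T -> measurable_fun setT (N t) ;
  poisson0 : forall w, N 0 w = 0%N ;
  poisson_nondecreasing : forall w (s t : R), 0 <= s -> s <= t -> t <= T ->
    (N s w <= N t w)%N ;
  poisson_cadlag : forall w, cadlag T (fun t => (N t w)%:R) ;
  poisson_distribution : forall s t : R, 0 <= s -> s < t -> t <= T -> forall k,
    P [set w | N t w = (N s w + k)%N]
    = (poisson_pmf (lambda * (t - s)) k)%:E ;
  poisson_indep : forall s t : R, 0 <= s -> s < t -> t <= T ->
    independent P (sigma_process N `[0, s])
      (preimage_set_system setT (fun w => (N t w - N s w)%N) measurable) }.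

(* The random measure is dN_t delta_1(dx), so it generates the same
   sigma-algebras as N.  Negligible sets are taken inside the sigma-algebra of
   Omega, so that no completeness assumption is needed. *)
Definition filtration (B : R -> Omega -> R) (N : R -> Omega -> nat) (t : R) :
    set (set Omega) :=
  <<s sigma_process B `[0, t] `|` sigma_process N `[0, t]
      `|` [set A | measurable A /\ P A = 0%E] >>.

End driving_processes.

(* A consumption plan is the distribution function of a random measure carried
   by [0, T], viewed as a process on the whole line: zero before 0 (this is
   C_{0-} = 0) and constant after T.  Nonnegativity follows. *)
Record plan {d : measure_display} {Omega : measurableType d} {R : realType}
    (T : R) (F : R -> set (set Omega)) := Plan {
  plan_process :> R -> Omega -> R ;
  plan_nondecreasing : forall w, nondecreasing (fun t => plan_process t w) ;
  plan_right_continuous :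
    forall w, right_continuous (fun t => plan_process t w) ;
  plan_before : forall (t : R) w, t < 0 -> plan_process t w = 0 ;
  plan_after : forall (t : R) w, T < t -> plan_process t w = plan_process T w ;
  plan_adapted : forall t : R, 0 <= t <= T ->
    measurable_wrt (F t) (plan_process t) }.

Section plans.
Context {d : measure_display} {Omega : measurableType d} {R : realType}.
Variables (T : R) (F : R -> set (set Omega)).

Definition plan_path (C : plan T F) (w : Omega) : R -> R := fun t => C t w.

HB.instance Definition _ (C : plan T F) (w : Omega) :=
  isCumulative.Build R _ R (plan_path C w)
    (@plan_nondecreasing _ _ _ _ _ C w) (@plan_right_continuous _ _ _ _ _ C w).

(* The measure dC(w); as C vanishes before 0, its atom at 0 is C_0(w). *)
Definition plan_measure (C : plan T F) (w : Omega) :=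
  lebesgue_stieltjes_measure (plan_path C w).

Definition satisfaction (eta beta : R) (C : plan T F) (t : R) (w : Omega) : R :=
  eta * expR (- (beta * t)) +
  \int[plan_measure C w]_(s in `[0, t]) (beta * expR (- (beta * (t - s)))).

Definition admissible (P : probability Omega R) (psi : R -> Omega -> R)
    (wealth : R) (C : plan T F) :=
  (\int[P]_w \int[plan_measure C w]_(t in `[0%R, T]) (psi t w)%:E
    <= wealth%:E)%E.

(* [U] is a recursive utility process for the level of satisfaction [Y]. *)
Definition recursive_utility (P : probability Omega R)
    (f : R -> R -> R -> R) (Y U : R -> Omega -> R) :=
  [/\ forall t : R, 0 <= t <= T -> measurable_wrt (F t) (U t),
      forall w, cadlag T (fun t => U t w),
      (\int[P]_w (ereal_sup [set `|U t w|%:E | t in `[0%R, T]] ^+ 2)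
        < +oo)%E &
      forall t : R, 0 <= t <= T ->
        cond_expectation P (F t)
          (fun w => \int[lebesgue_measure]_(s in `[t, T]) f s (Y s w) (U s w))
          (U t)].

(* [C] attains the supremum of U_0 over admissible plans.  U_0 is only
   determined almost surely. *)
Definition optimal (P : probability Omega R) (psi : R -> Omega -> R)
    (eta beta : R) (f : R -> R -> R -> R) (wealth : R) (C : plan T F) :=
  admissible P psi wealth C /\
  exists2 U : R -> Omega -> R,
    recursive_utility P f (satisfaction eta beta C) U &
    forall (C' : plan T F) (U' : R -> Omega -> R),
      admissible P psi wealth C' ->
      recursive_utility P f (satisfaction eta beta C') U' ->
      {ae P, forall w, U' 0 w <= U 0 w}.

End plans.

Section derivatives.
Context {R : realType}.

(* Derivatives relative to a set, one-sided at the ends of an interval. *)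
Definition quotient_within (A : set R) (g : R -> R) (x : R) :=
  (fun z => (g z - g x) / (z - x)) @ within A x^'.
Definition derivable_within (A : set R) (g : R -> R) (x : R) :=
  cvg (quotient_within A g x).
Definition derive_within (A : set R) (g : R -> R) (x : R) : R :=
  lim (quotient_within A g x).

Variable T : R.
Implicit Types g f : R -> R -> R -> R.

Definition Dt g t y u := derive_within `[0, T] (fun s => g s y u) t.
Definition Dy g t y u := derive_within `[0, +oo[ (fun z => g t z u) y.
Definition Du g t y u := derive1 (g t y) u.

Definition domain : set (R * R * R) :=
  [set z | 0 <= z.1.1 <= T /\ 0 <= z.1.2].

(* C^1 on [0, oo[ x R *)
Definition C1_yu (g : R -> R -> R) :=
  [/\ forall y u : R, 0 <= y ->
        derivable_within `[0, +oo[ (g^~ u) y /\ derivable (g y) u 1,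
      {within [set z : R * R | 0 <= z.1],
        continuous (fun z => derive_within `[0, +oo[ (g^~ z.2) z.1)} &
      {within [set z : R * R | 0 <= z.1],
        continuous (fun z => derive1 (g z.1) z.2)}].

(* C^1 on [0, T] x [0, oo[ x R *)
Definition C1_tyu g :=
  [/\ forall t y u : R, 0 <= t <= T -> 0 <= y ->
        [/\ derivable_within `[0, T] (fun s => g s y u) t,
            derivable_within `[0, +oo[ (fun z => g t z u) y &
            derivable (g t y) u 1],
      {within domain, continuous (fun z => Dt g z.1.1 z.1.2 z.2)},
      {within domain, continuous (fun z => Dy g z.1.1 z.1.2 z.2)} &
      {within domain, continuous (fun z => Du g z.1.1 z.1.2 z.2)}].

Definition strictly_concave_yu (g : R -> R -> R) :=
  forall y u y' u' a : R, 0 <= y -> 0 <= y' -> (y, u) <> (y', u') -> 0 < a < 1 ->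
    a * g y u + (1 - a) * g y' u'
    < g (a * y + (1 - a) * y') (a * u + (1 - a) * u').

Definition borel_aggregator f :=
  measurable_fun domain (fun z : R * R * R => f z.1.1 z.1.2 z.2).

Definition A1 f :=
  forall t : R, 0 <= t <= T ->
    [/\ strictly_concave_yu (f t), C1_yu (f t) &
        forall u y y' : R, 0 <= y -> y < y' -> f t y u < f t y' u].

Definition A2 f :=
  exists K : R, forall t y u u' : R, 0 <= t <= T -> 0 <= y ->
    `|f t y u - f t y u'| <= K * `|u - u'|.

Definition A3 (alpha : R) f :=
  exists K : R, forall t y : R, 0 <= t <= T -> 0 <= y ->
    `|f t y 0| <= K * (1 + `|y| `^ alpha).

Definition Lop (r lambda theta beta : R) f t y u : R :=
  (r + lambda * (expR theta - 1)) * Dy f t y u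
  - beta * y * Dy (Dy f) t y u + Dt (Dy f) t y u
  + Du f t y u * Dy f t y u - f t y u * Du (Dy f) t y u.

End derivatives.

Definition A4 {d : measure_display} {Omega : measurableType d} {R : realType}
    (FT : set (set Omega)) (P0 Pstar : probability Omega R) (alpha : R) :=
  exists p : R, [/\ 1 < p, 2 * alpha * p < 1 &
    exists2 D : Omega -> R, density_on FT P0 Pstar D &
      D \in Lfun Pstar (1 / (1 - 2 * alpha * p))%:E].

Definition pricing_density {Omega : Type} {R : realType} (T lambda theta : R)
    (N : R -> Omega -> nat) (w : Omega) : R :=
  expR (theta * (N T w)%:R - lambda * (expR theta - 1) * T).

Definition state_price {Omega : Type} {R : realType} (r lambda theta : R)
    (N : R -> Omega -> nat) (t : R) (w : Omega) : R :=
  expR (theta * (N t w)%:R - (r + lambda * (expR theta - 1)) * t).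

(* Main.v *)
(* Let rho = r + lambda (e^theta - 1) and let u solve u(t) = \int_t^T f(s, Y_s, u_s) ds
   along the satisfaction Y_s = (eta + beta w) e^(-beta s) of the plan consuming w at
   time 0; this u is its (deterministic) utility.  Put G_s = exp \int_0^s d_u f(v, Y_v, u_v) dv.
   For an admissible C' with satisfaction Y' and utility U', concavity of f and
   integration by parts give
     E U'_0 - u(0) <= E \int_0^T G_s d_y f(s, Y_s, u_s) (Y'_s - Y_s) ds
                    = E \int_0^T Phi_t dC'_t - w Phi_0,
   where Phi_t = \int_t^T G_s d_y f(s, Y_s, u_s) beta e^(-beta (s - t)) ds.
   As Y' = - beta Y and u' = - f along the path, e^(rho s) G_s d_y f(s, Y_s, u_s) has
   derivative e^(rho s) G_s Lf <= 0, so it is nonincreasing; hence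
   Phi_t <= e^(- rho t) Phi_0 <= psi_t Phi_0 and the budget constraint bounds the
   right-hand side by 0.  Finally F_0 is trivial, so that U'_0 is a.s. constant. *)
Require Import Defs.
From HB Require Import structures.
From mathcomp Require Import all_boot all_order all_algebra.
From mathcomp Require Import all_classical all_reals all_analysis.
From mathcomp Require Import measurable_realfun ring lra.

Set Implicit Arguments.
Unset Strict Implicit.
Unset Printing Implicit Defensive.

Import Order.TTheory GRing.Theory Num.Theory.
Import numFieldNormedType.Exports.
Local Open Scope classical_set_scope.
Local Open Scope ring_scope.

(** * Calculus on the line *)

Section integrals.
Context {R : realType}.
Notation mu := lebesgue_measure.
Implicit Types (a b c L M : R) (f g h : R -> R).

(** The aggregator is only Borel in time, so [u] is merely Lipschitz and [u' = - f] holds only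
    almost everywhere; monotonicity of the weight thus rests on the fact that a Lipschitz function
    with an a.e. nonpositive derivative is nonincreasing. Derivatives of [d_y f] in time are
    two-sided only inside []0, T[], which suffices because end points do not affect integrals, and
    [eta + beta w > 0] keeps [Y] away from the boundary [y = 0]. No stochastic calculus enters. With
    [X_s = \int_s^T f(v, Y'_v, U'_v) dv], the recursion is used only through [E (X_s - U'_s) = 0]
    for every [s]. Integration by parts is applied path by path to [X], which is Lipschitz in time
    whereas [U'] is only cadlag; passing from [X] to [U'] leaves the term
    [\int_0^T G_s d_u f (X_s - U'_s) ds], whose mean vanishes by Fubini because [G_s d_u f] is
    deterministic and bounded. Tonelli for [dC'] is likewise applied to each path separately.
    Measurability in the state of [\int psi dC'] is never established: such integrals are suprema
    over simple functions and are compared by monotonicity only. *)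

Lemma le_integral_ge0_nomeas {d} {S : measurableType d}
    (nu : {measure set S -> \bar R}) (D : set S) (f1 f2 : S -> \bar R) :
  (forall x, D x -> 0 <= f1 x <= f2 x)%E ->
  (\int[nu]_(x in D) f1 x <= \int[nu]_(x in D) f2 x)%E.
Proof.
move=> f12.
have f1p x : D x -> (0 <= f1 x)%E by move=> /f12/andP[].
have f2p x : D x -> (0 <= f2 x)%E by move=> /f12/andP[/le_trans]; exact.
(* The integral of a nonnegative function is the supremum over the simple functions below it, so it
   grows with the function, measurable or not. *)
rewrite !ge0_integralE//; apply: ereal_sup_le => _ [h hf <-] /=.
exists h => // x; apply: le_trans (hf x) _.
by rewrite !patchE; case: ifPn => // /set_mem /f12 /andP[].
Qed.

(** Lebesgue measure is its own image under a translation: by uniqueness it suffices to compare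
    masses of half-open intervals. *)
Lemma ge0_integral_shift (D : set R) (f : R -> \bar R) c :
  measurable D -> measurable_fun D f -> (forall x, D x -> 0 <= f x)%E ->
  (\int[mu]_(x in [set x | D (x + c)%R]) f (x + c)%R = \int[mu]_(x in D) f x)%E.
Proof.
move=> mD mf f0.
have mphi : measurable_fun setT ((fun x => x + c) : measurableTypeR R -> measurableTypeR R).
  exact: measurable_funD.
have f0' : {in D, forall x, (0 <= f x)%E} by move=> x /set_mem; exact: f0.
have := @ge0_integral_pushforward _ _ (measurableTypeR R) (measurableTypeR R) R
  _ mphi mu D f mD mf f0'.
move=> /esym H; apply: (eq_trans H) => {H}.
apply: eq_measure_integral => A mA _.
apply/esym/lebesgue_measure_unique => //= _ [[a b]] _ <-.
rewrite /pushforward (_ : _ @^-1` _ = `]a - c, b - c]%classic); last first.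
  by apply/seteqP; split => x /=; rewrite !in_itv/= ltrBlDr lerBrDr.
rewrite !lebesgue_measure_itv/= !lte_fin ltrD2r.
by case: ifP => // _; rewrite -!EFinD; congr EFin; lra.
Qed.

Lemma bounded_integrable_itv a b g M : measurable_fun `[a, b] g ->
  (forall x, a <= x <= b -> `|g x| <= M) -> mu.-integrable `[a, b] (EFin \o g).
Proof.
move=> mg gM; apply: measurable_bounded_integrable => //.
  by rewrite /= lebesgue_measure_itv/=; case: ifP; rewrite -?EFinB ltry.
exists M; split; first exact: num_real.
by move=> N MN x /=; rewrite in_itv/= => /gM/le_trans; apply; exact/ltW.
Qed.

Lemma lipschitz_continuous L h : (forall x y, `|h x - h y| <= L * `|x - y|) ->
  continuous h.
Proof.
move=> hL x; apply/cvgrPdist_le => /= e e0.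
have L0 : 0 <= L.
  by have := le_trans (normr_ge0 _) (hL 1 0); rewrite subr0 normr1 mulr1.
have L1 : 0 < L + 1 by lra.
have /cvgrPdist_le idx : id y @[y --> x] --> x by exact: cvg_id.
near=> y.
apply: le_trans (hL x y) _.
have : `|x - y| <= e / (L + 1) by near: y; apply: idx; exact: divr_gt0.
rewrite ler_pdivlMr// => H; apply: le_trans H.
by rewrite mulrC ler_wpM2l//; lra.
Unshelve. all: by end_near. Qed.

End integrals.

(** * Derivatives as sequential limits, and monotonicity of Lipschitz functions *)

Section derivatives.
Context {R : realType}.
Notation mu := lebesgue_measure.
Implicit Types (a b c L M : R) (f g h : R -> R).

Lemma is_derive_derive1 f (x l : R) :
  derivable f x 1 /\ derive1 f x = l -> is_derive x (1 : R) f l.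
Proof. by move=> [df <-]; rewrite derive1E; exact: DeriveDef. Qed.

(** Along the increments [1 / (n + 1)] countable tools become available for derivatives: dominated
    convergence, limits of measurable functions, passage of bounds to the limit. *)
Lemma is_derive_cvg_harmonic f (x l : R) : is_derive x (1 : R) f l ->
  n.+1%:R * (f (x + n.+1%:R^-1) - f x) @[n --> \oo] --> l.
Proof.
move=> [df <-].
have h0 : harmonic n @[n --> \oo] --> (0 : R)^'.
  move=> A nA; have H : \forall n \near \oo, harmonic n != 0 -> A (harmonic n) :=
    @cvg_harmonic R _ nA.
  by case: H => m _ H; exists m => // n /H; apply; exact: lt0r_neq0 (harmonic_gt0 _).
have /(cvg_comp _ _ h0) : (fun h : R => h^-1 *: (f (h *: 1 + x) - f x)) @ 0^' -->
  'D_1 f x by exact: df.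
apply: cvg_trans; apply: near_eq_cvg; near=> n => /=.
by rewrite invrK [_%:A]mulr1 (addrC _ x).
Unshelve. all: by end_near. Qed.

(** The difference quotients [D n] of [h] are bounded by [L], so dominated convergence sends their
    integrals to the integral of the derivative. The same integrals are increments of [G n], the
    difference quotients of a primitive of [h], and tend to [h b - h a]. Hence [h b - h a] is the
    integral of a nonpositive function. *)
Lemma lipschitz_ae_nonincreasing a b L h : a < b ->
  (forall x y, a <= x <= b -> a <= y <= b -> `|h x - h y| <= L * `|x - y|) ->
  {ae mu, forall x, a < x < b -> derivable h x 1 /\ derive1 h x <= 0} ->
  h b <= h a.
Proof.
move=> ab hL [N [mN N0 NP]].
(* Clamping extends [h] to the whole line with the same Lipschitz constant, so that the quotients
   near [b] make sense. *)
pose cl x := Num.min b (Num.max a x).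
have cl_itv x : a <= cl x <= b.
  by rewrite /cl ge_min lexx le_min le_max lexx (ltW ab).
have cl_id x : a <= x <= b -> cl x = x.
  by move=> /andP[ax xb]; rewrite /cl (max_idPr ax) (min_idPr xb).
have L0 : 0 <= L.
  have := hL a b; rewrite !lexx (ltW ab) => /(_ erefl erefl) /(le_trans (normr_ge0 _)).
  by rewrite pmulr_lge0// normr_gt0 subr_eq0 lt_eqF.
have clL x y : `|cl x - cl y| <= `|x - y|.
  have := ler_norm (x - y); have := ler_norm (y - x).
  rewrite (distrC y) ler_norml /cl /Order.min /Order.max.
  by move: ab => ?; do !case: ifPn; rewrite -?leNgt; lra.
pose H x := h (cl x).
have HL x y : `|H x - H y| <= L * `|x - y|.
  by apply: le_trans (hL _ _ (cl_itv x) (cl_itv y)) _; rewrite ler_wpM2l.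
have cH : continuous H by exact: lipschitz_continuous HL.
have Ha : H a = h a by rewrite /H cl_id// lexx ltW.
have Hb : H b = h b by rewrite /H cl_id// lexx ltW.
(* Starting at [a - 1] makes [a] an interior point, so that [P] is differentiable there as well. *)
pose P x := (\int[mu]_(t in `[a - 1, x]) H t).
have dP x : a - 1 < x -> derivable P x 1 /\ derive1 P x = H x.
  move=> ax; apply: (@continuous_FTC1_closed _ H (a-1) x (x + 1)) => //.
    by rewrite ltrDl.
    apply: continuous_compact_integrable; first exact: segment_compact.
    exact: continuous_subspaceT.
  exact: cH.
pose e n : R := n.+1%:R^-1.
have e0 n : 0 < e n by rewrite invr_gt0.
pose D n x := n.+1%:R * (H (x + e n) - H x).
pose G n x := n.+1%:R * (P (x + e n) - P x).
have dG : forall n x, a - 1 < x -> is_derive x 1 (G n) (D n x).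
  move=> n x ax; have id1 := is_derive_derive1 (dP x ax).
  have id2 : is_derive (x + e n) (1 : R) P (H (x + e n)).
    by apply: is_derive_derive1; apply: dP; rewrite ltr_wpDr// ltW.
  have id3 : is_derive x 1 (fun y => P (y + e n)) (H (x + e n)).
    have := @is_derive1_comp _ P (fun y => y + e n) x (H (x + e n)) 1 id2.
    rewrite mulr1; apply. 
    by rewrite -[X in is_derive _ _ _ X]addr0; exact: is_deriveD.
  rewrite /G /D; apply: is_deriveZ.
have cD n : continuous (D n).
  move=> x; apply: cvgM; first exact: cvg_cst.
  apply: cvgB; last exact: cH.
  by apply: continuous_comp; [apply: cvgD; [exact: cvg_id|exact: cvg_cst]|exact: cH].
have cvgG x : a - 1 < x -> (G n x) @[n --> \oo] --> H x.
  by move=> ax; apply: is_derive_cvg_harmonic; apply: is_derive_derive1; exact: dP.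
have intD n : (\int[mu]_(x in `[a, b]) (D n x)%:E = (G n b - G n a)%:E)%E.
  rewrite (@continuous_FTC2 _ (D n) (G n))//.
  - by apply: continuous_subspaceT.
  - have cG x : a <= x -> G n y @[y --> x] --> G n x.
      move=> ax; have [|dG1 _] := dG n x; first by lra.
      exact/differentiable_continuous/derivable1_diffP.
    split.
    + by move=> x; rewrite in_itv/= => /andP[ax _]; have [|] := dG n x; first by lra.
    + by apply: cvg_at_right_filter; exact: cG.
    + by apply: cvg_at_left_filter; apply: cG; exact: ltW.
  - move=> x; rewrite in_itv/= => /andP[ax _]; have [|_] := dG n x; first by lra.
    by rewrite derive1E.
pose E : set R := `]a, b[ `\` N.
have mE : measurable E by exact: measurableD.
have mD n A : measurable A -> measurable_fun A (D n).
  move=> mA; apply: measurable_funTS; apply: continuous_measurable_fun.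
  exact: cD.
have mDE n A : measurable A -> measurable_fun A (fun x => (D n x)%:E).
  by move=> mA; apply/measurable_EFinP; exact: mD.
have intDE n : (\int[mu]_(x in E) (D n x)%:E = (G n b - G n a)%:E)%E.
  have iD : mu.-integrable `[a, b] (EFin \o D n).
    apply: continuous_compact_integrable; first exact: segment_compact.
    exact: continuous_subspaceT.
  rewrite -intD -(@integral_itv_obnd_cbnd _ a) -?(@integral_itv_bndo_bndc _ _ b).
  - rewrite (@negligible_integral _ _ _ mu `]a, b[ N)//.
    by apply: integrableS iD; [| |exact: subset_itv_oo_cc].
  - by apply: mDE.
  - by apply: mDE.
have DL n x : `|D n x| <= L.
  rewrite /D normrM ger0_norm// mulrC -ler_pdivlMr ?ltr0n//.
  by apply: le_trans (HL _ _) _; rewrite addrAC subrr add0r ger0_norm// ltW.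
have EN x : E x -> is_derive x (1 : R) H (derive1 h x) /\ derive1 h x <= 0.
  move=> [/=]; rewrite in_itv/= => xab nN.
  have [dh h0] : derivable h x 1 /\ derive1 h x <= 0.
    by move: xab; apply: contrapT => hx; apply: nN; apply: NP => /=.
  split => //; have : is_derive x (1 : R) h (derive1 h x) by exact: is_derive_derive1.
  apply: near_eq_is_derive.
  have : \forall y \near x, y \in `]a, b[ by apply: near_in_itvoo; rewrite in_itv.
  by apply: filterS => y; rewrite in_itv/= /H => /andP[ay yb]; rewrite cl_id// !ltW.
have cvgD x : E x -> (D n x)%:E @[n --> \oo] --> (derive1 h x)%:E.
  move=> /EN[dH _]; apply/cvg_EFin; first by near=> n.
  exact: is_derive_cvg_harmonic dH.
have lim1 : (\int[mu]_(x in E) (D n x)%:E @[n --> \oo] -->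
             \int[mu]_(x in E) (derive1 h x)%:E)%E.
  apply: (@dominated_cvg _ _ _ mu E mE (fun n => EFin \o D n) _ (cst L%:E)) => //.
  - by move=> n; exact: mDE.
  - apply: (@integrableS _ _ _ mu `[a, b]) => //.
      by move=> x [xab _]; exact: (subset_itv_oo_cc xab).
    apply: continuous_compact_integrable; first exact: segment_compact.
    by apply: continuous_subspaceT => x; exact: cvg_cst.
  - by move=> n x _; rewrite /= lee_fin.
have lim2 : (\int[mu]_(x in E) (D n x)%:E @[n --> \oo] --> (H b - H a)%:E)%E.
  under eq_fun do rewrite intDE.
  apply/cvg_EFin; first by near=> n.
  by apply: cvgB; apply: cvgG; lra.
have Eq := cvg_unique (@ereal_hausdorff R) lim1 lim2.
have : (\int[mu]_(x in E) (derive1 h x)%:E <= 0)%E.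
  under eq_integral do rewrite -[derive1 h _]opprK EFinN.
  rewrite integral_ge0N ?oppe_le0 => [|x /EN[_ h0]]; last by rewrite lee_fin oppr_ge0.
  by apply: integral_ge0 => x /EN[_ h0]; rewrite lee_fin oppr_ge0.
by rewrite Eq Ha Hb lee_fin subr_le0.
Unshelve. all: by end_near. Qed.

End derivatives.

(** * Lipschitz bounds and almost everywhere derivatives of primitives *)

Section primitives.
Context {R : realType}.
Notation mu := lebesgue_measure.
Implicit Types (a b c L M e : R) (f g h : R -> R).

Section primitive.
Variables (a b M : R) (g : R -> R).
Hypotheses (ab : a < b) (mg : measurable_fun `[a, b] g)
  (gM : forall x, a <= x <= b -> `|g x| <= M).

Lemma sub_bounded_integrable x y : a <= x -> y <= b ->
  mu.-integrable `[x, y] (EFin \o g).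
Proof.
move=> ax yb; apply: (@integrableS _ _ _ mu `[a, b]) => //.
  by apply: subset_itv; rewrite bnd_simp.
exact: bounded_integrable_itv gM.
Qed.

Lemma Rintegral_itv_split x y z : a <= x -> x <= y -> y <= z -> z <= b ->
  \int[mu]_(t in `[x, z]) g t =
  \int[mu]_(t in `[x, y]) g t + \int[mu]_(t in `[y, z]) g t.
Proof.
move=> ax xy yz zb; apply/eqP; rewrite addrC -subr_eq.
rewrite Rintegral_itvB ?bnd_simp//; last exact: sub_bounded_integrable.
rewrite Rintegral_itv_obnd_cbnd//.
apply: (@integrableS _ _ _ mu `[a, b]) => //.
  by apply: subset_itv; rewrite bnd_simp// (le_trans ax).
exact: bounded_integrable_itv gM.
Qed.

Lemma Rintegral_itv_bound x y : a <= x -> x <= y -> y <= b ->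
  `|\int[mu]_(t in `[x, y]) g t| <= M * (y - x).
Proof.
move=> ax xy yb; have ig := sub_bounded_integrable ax yb.
apply: le_trans (le_normr_Rintegral _ ig) _ => //.
have -> : M * (y - x) = \int[mu]_(t in `[x, y]) M.
  rewrite Rintegral_cst//= lebesgue_measure_itv/= lte_fin.
  by case: ltP => //= yx; have -> : y = x; lra.
apply: le_Rintegral => //.
- by apply: integrable_norm.
- apply: (@bounded_integrable_itv _ _ _ _ `|M|) => //; exact: measurable_cst.
- by move=> t; rewrite /= in_itv/= => ?; apply: gM; lra.
Qed.

Lemma primitive_lipschitz x y : a <= x <= b -> a <= y <= b ->
  `|\int[mu]_(t in `[a, x]) g t - \int[mu]_(t in `[a, y]) g t| <= M * `|x - y|.
Proof.
wlog xy : x y / x <= y.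
  move=> H; have [/H//|/ltW/H{}H xab yab] := leP x y.
  by rewrite distrC (distrC x); exact: H.
move=> /andP[ax xb] /andP[ay yb].
rewrite (@Rintegral_itv_split a x y)// opprD addNKr normrN.
by rewrite distrC (ger0_norm (_ : 0 <= y - x)) ?subr_ge0// Rintegral_itv_bound.
Qed.

(** Lebesgue's differentiation theorem for [g] extended by 0, which is integrable on the line; the
    extension does not change the primitive inside []a, b[]. *)
Lemma ae_derive_primitive : {ae mu, forall x, a < x < b ->
  is_derive x (1 : R) (fun t => \int[mu]_(s in `[a, t]) g s) (g x)}.
Proof.
pose G := g \_ `[a, b].
have iG : mu.-integrable setT (EFin \o G).
  have := bounded_integrable_itv mg gM.
  by rewrite integrable_mkcond//= (restrict_EFin g).
have : locally_integrable setT G.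
  apply: open_integrable_locally => //; exact: openT.
move/lebesgue_differentiation.
apply: filterS; first exact: (ae_filter_ringOfSetsType mu).
move=> x Gx /andP[ax xb].
have [dF FE] : derivable (fun t => \int[mu]_(s in `[a, t]) G s) x 1 /\
    derive1 (fun t => \int[mu]_(s in `[a, t]) G s) x = G x.
  apply: (@FTC1_lebesgue_pt _ G (BLeft a) x b) => //.
  exact: integrableS iG.
have GE t : t <= b -> \int[mu]_(s in `[a, t]) G s = \int[mu]_(s in `[a, t]) g s.
  move=> tb; apply: eq_Rintegral => s; rewrite inE/= in_itv/= => /andP[as_ st].
  by rewrite /G patchE mem_set//= in_itv/= as_ (le_trans st).
have Gx' : G x = g x by rewrite /G patchE mem_set//= in_itv/= !ltW.
rewrite -Gx'.
have := is_derive_derive1 (conj dF FE).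
apply: near_eq_is_derive.
have : \forall t \near x, t \in `]a, b[ by apply: near_in_itvoo; rewrite in_itv/= ax.
by apply: filterS => t; rewrite in_itv/= => /andP[_ /ltW /GE].
Qed.

End primitive.
End primitives.

(** * Chain rule and concavity in several variables *)

Section several_variables.
Context {R : realType}.
Implicit Types (a b c L M e : R) (f g h : R -> R).

(** Mean value theorem for a derivative that stays within [e] of [A]. With [A = 0] it turns a bound
    on the derivative into a Lipschitz constant. *)
Lemma mvt_increment_bound g dg a b A e x y :
  (forall z, a <= z <= b -> is_derive z (1 : R) g (dg z) /\ `|dg z - A| <= e) ->
  a <= x <= b -> a <= y <= b ->
  `|g y - g x - A * (y - x)| <= e * `|y - x|.
Proof.
move=> H; wlog xy : x y / x <= y.
  move=> W; have [/W//|/ltW/W{}W xab yab] := leP x y.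
  rewrite (_ : g y - g x - A * (y - x) = - (g x - g y - A * (x - y))); last ring.
  by rewrite normrN (distrC y); exact: W.
move=> /andP[ax xb] /andP[ay yb].
have [||c cxy ->] := @MVT_segment _ g dg x y xy.
- by move=> z; rewrite in_itv/= => /andP[xz zy]; have [|] := H z; first by lra.
- apply: derivable_within_continuous => z; rewrite in_itv/= => /andP[xz zy].
  by have [|[]] := H z; first by lra.
- rewrite -mulrBl normrM ler_wpM2r//.
  by move: cxy; rewrite in_itv/= => cxy; have [|] := H c; first by lra.
Qed.

Definition has_partials (F Ft Fy Fu : R -> R -> R -> R) t y u :=
  [/\ is_derive t (1 : R) (fun s => F s y u) (Ft t y u),
      is_derive y (1 : R) (fun z => F t z u) (Fy t y u) &
      is_derive u (1 : R) (F t y) (Fu t y u)].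

(** The increment is split into three moves along the axes, each governed by the mean value theorem;
    a box contains all intermediate corners. *)
Lemma box_increment_bound (F Ft Fy Fu : R -> R -> R -> R)
    (a1 b1 a2 b2 a3 b3 A B C e t y u t' y' u' : R) :
  (forall s z v, a1 <= s <= b1 -> a2 <= z <= b2 -> a3 <= v <= b3 ->
    has_partials F Ft Fy Fu s z v /\
    [/\ `|Ft s z v - A| <= e, `|Fy s z v - B| <= e & `|Fu s z v - C| <= e]) ->
  a1 <= t <= b1 -> a2 <= y <= b2 -> a3 <= u <= b3 ->
  a1 <= t' <= b1 -> a2 <= y' <= b2 -> a3 <= u' <= b3 ->
  `|F t' y' u' - F t y u - (A * (t' - t) + B * (y' - y) + C * (u' - u))|
    <= e * (`|t' - t| + `|y' - y| + `|u' - u|).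
Proof.
move=> H ht hy hu ht' hy' hu'.
have H1 : `|F t' y' u' - F t y' u' - A * (t' - t)| <= e * `|t' - t|.
  apply: (@mvt_increment_bound (fun s => F s y' u') (fun s => Ft s y' u') a1 b1) => //.
  by move=> s hs; have [[? _ _] [? _ _]] := H s y' u' hs hy' hu'.
have H2 : `|F t y' u' - F t y u' - B * (y' - y)| <= e * `|y' - y|.
  apply: (@mvt_increment_bound (fun s => F t s u') (fun s => Fy t s u') a2 b2) => //.
  by move=> s hs; have [[_ ? _] [_ ? _]] := H t s u' ht hs hu'.
have H3 : `|F t y u' - F t y u - C * (u' - u)| <= e * `|u' - u|.
  apply: (@mvt_increment_bound (fun s => F t y s) (fun s => Fu t y s) a3 b3) => //.
  by move=> s hs; have [[_ _ ?] [_ _ ?]] := H t y s ht hy hs.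
move: H1 H2 H3; set X1 := F t' y' u' - _ - _; set X2 := F t y' u' - _ - _.
set X3 := F t y u' - _ - _ => H1 H2 H3.
have -> : F t' y' u' - F t y u - (A * (t' - t) + B * (y' - y) + C * (u' - u)) =
  X1 + X2 + X3 by rewrite /X1 /X2 /X3; ring.
rewrite !mulrDr; apply: le_trans (ler_normD _ _) _; rewrite lerD//.
by apply: le_trans (ler_normD _ _) _; rewrite lerD.
Qed.

(** Continuous differentiability at a point, phrased with closed boxes on which the partial
    derivatives exist and move by at most [e]: the form in which the coordinatewise mean value
    theorem uses it. *)
Definition C1_at (F Ft Fy Fu : R -> R -> R -> R) t y u :=
  forall e, 0 < e -> exists2 d : R, 0 < d & forall s z v,
    t - d <= s <= t + d -> y - d <= z <= y + d -> u - d <= v <= u + d ->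
    has_partials F Ft Fy Fu s z v /\
    [/\ `|Ft s z v - Ft t y u| <= e, `|Fy s z v - Fy t y u| <= e &
        `|Fu s z v - Fu t y u| <= e].

Lemma C1_at_increment F Ft Fy Fu t y u e : C1_at F Ft Fy Fu t y u -> 0 < e ->
  exists2 d : R, 0 < d & forall s z v,
    t - d <= s <= t + d -> y - d <= z <= y + d -> u - d <= v <= u + d ->
    `|F s z v - F t y u -
      (Ft t y u * (s - t) + Fy t y u * (z - y) + Fu t y u * (v - u))|
      <= e * (`|s - t| + `|z - y| + `|v - u|).
Proof.
move=> H /H[d d0 {}H]; exists d => // s z v hs hz hv.
by apply: (box_increment_bound H) => //; lra.
Qed.

(** The curves are differentiable at the single time [t] only, since [u] will be differentiable
    merely almost everywhere. The linear part converges by hypothesis and the remainder is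
    controlled by [C1_at_increment]. *)
Lemma C1_at_chain F Ft Fy Fu (y u : R -> R) (t dy du : R) :
  C1_at F Ft Fy Fu t (y t) (u t) ->
  is_derive t (1 : R) y dy -> is_derive t (1 : R) u du ->
  is_derive t (1 : R) (fun s => F s (y s) (u s))
    (Ft t (y t) (u t) + Fy t (y t) (u t) * dy + Fu t (y t) (u t) * du).
Proof.
move=> C1 Dy Du.
set A := Ft _ _ _; set B := Fy _ _ _; set C := Fu _ _ _.
have cvgq (g : R -> R) dg : is_derive t (1 : R) g dg ->
    h^-1 * (g (h + t) - g t) @[h --> (0:R)^'] --> dg.
  move=> [+ <-] => dgt; have : (fun h : R => h^-1 *: (g (h *: 1 + t) - g t)) @ 0^' -->
    'D_1 g t by exact: dgt.
  by apply: cvg_trans; apply: near_eq_cvg; apply: nearW => h; rewrite [_%:A]mulr1.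
have cvgc (g : R -> R) dg : is_derive t (1 : R) g dg -> g (h + t) @[h --> (0:R)] --> g t.
  move=> [dgt _]; have /differentiable_continuous : differentiable g t.
    exact/derivable1_diffP.
  move=> cg; have : (fun h : R => h + t) @ (0:R) --> t.
    rewrite -[X in _ --> X]add0r; apply: cvgD; [exact: cvg_id|exact: cvg_cst].
  by move=> H; exact: (cvg_comp _ _ H cg).
pose q (h : R) := h^-1 * (F (h + t) (y (h + t)) (u (h + t)) - F t (y t) (u t)).
suff Hq : q h @[h --> (0:R)^'] --> A + B * dy + C * du.
  apply: is_derive_derive1; rewrite derive1E.
  have Hq' : (fun h : R => h^-1 *: (F (h *: 1 + t) (y (h *: 1 + t)) (u (h *: 1 + t))
     - F t (y t) (u t))) @ 0^' --> A + B * dy + C * du.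
    apply: cvg_trans Hq; apply: near_eq_cvg; apply: nearW => h.
    by rewrite [_%:A]mulr1.
  by split; [apply/cvg_ex; eexists; exact: Hq'|exact: cvg_lim Hq'].
apply/cvgrPdist_le => e e0.
(* For small [h] the increments of time, [y] and [u] add up to at most [k] times the absolute value
   of [h]: one unit for time, and one unit of slack on each of the two slopes. *)
pose k := 3 + `|dy| + `|du|.
have k0 : 0 < k by rewrite /k; have := normr_ge0 dy; have := normr_ge0 du; lra.
have [|d d0 Hd] := C1_at_increment C1 (e := e / 2 / k); first by rewrite !divr_gt0.
have lin : A + B * (h^-1 * (y (h + t) - y t)) + C * (h^-1 * (u (h + t) - u t))
   @[h --> (0:R)^'] --> A + B * dy + C * du.
  apply: cvgD; first apply: cvgD; first exact: cvg_cst.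
  - by apply: cvgM; [exact: cvg_cst|exact: cvgq].
  - by apply: cvgM; [exact: cvg_cst|exact: cvgq].
have e2 : 0 < e / 2 by rewrite divr_gt0.
near=> h.
have h0 : h != 0 by near: h; exact: nbhs_dnbhs_neq.
have nh0 : 0 < `|h| by rewrite normr_gt0.
have L1 : `|A + B * dy + C * du - (A + B * (h^-1 * (y (h + t) - y t)) +
   C * (h^-1 * (u (h + t) - u t)))| <= e / 2.
  by near: h; move/cvgrPdist_le : lin; apply.
have L2 : `|dy - h^-1 * (y (h + t) - y t)| <= 1.
  by near: h; have /cvgrPdist_le := cvgq _ _ Dy; apply.
have L3 : `|du - h^-1 * (u (h + t) - u t)| <= 1.
  by near: h; have /cvgrPdist_le := cvgq _ _ Du; apply.
have L4 : `|0 - h| <= d.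
  near: h; apply: nbhs_dnbhs; have /cvgrPdist_le : id h @[h --> (0:R)] --> (0:R).
    exact: cvg_id.
  exact.
have L5 : `|y t - y (h + t)| <= d.
  by near: h; apply: nbhs_dnbhs; have /cvgrPdist_le := cvgc _ _ Dy; apply.
have L6 : `|u t - u (h + t)| <= d.
  by near: h; apply: nbhs_dnbhs; have /cvgrPdist_le := cvgc _ _ Du; apply.
have quot_bound (D dD : R) : `|dD - h^-1 * D| <= 1 -> `|D| <= `|h| * (`|dD| + 1).
  move=> H; rewrite -ler_pdivrMl// -normfV -normrM.
  rewrite -[X in `|X|](subrK dD) -opprB; apply: le_trans (ler_normD _ _) _.
  by rewrite normrN addrC lerD.
have := Hd (h + t) (y (h + t)) (u (h + t)).
rewrite -/A -/B -/C -!ler_distlC L5 L6 => /(_ _ isT isT).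
have <- : h = h + t - t by ring.
rewrite (_ : t - (h + t) = 0 - h); last ring.
move=> /(_ L4).
set dF := F _ _ _ - _; set dY := y _ - _; set dU := u _ - _ => Hr.
have {}L2 : `|dY| <= `|h| * (`|dy| + 1).
  exact: quot_bound.
have {}L3 : `|dU| <= `|h| * (`|du| + 1) by exact: quot_bound.
rewrite /q -/dF.
rewrite -/dY -/dU in L1.
have -> : A + B * dy + C * du - h^-1 * dF = (A + B * dy + C * du -
   (A + B * (h^-1 * dY) + C * (h^-1 * dU))) - h^-1 * (dF - (A * h + B * dY + C * dU)).
  by field.
apply: le_trans (ler_normB _ _) _; rewrite [leRHS]splitr lerD//.
rewrite normrM normfV ler_pdivrMl//.
apply: le_trans Hr _.
have -> : `|h| * (e / 2) = e / 2 / k * (`|h| * k) by field; rewrite gt_eqF.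
rewrite ler_pM2l ?divr_gt0//.
apply: (@le_trans _ _ (`|h| + `|h| * (`|dy| + 1) + `|h| * (`|du| + 1))).
  by rewrite !lerD.
by rewrite /k; lra.
Unshelve. all: by end_near. Qed.

End several_variables.

(** * Smoothness of the aggregator away from the boundary, and the tangent inequality *)

Section aggregator_calculus.
Context {R : realType}.
Implicit Types (a b c L M e T t y u : R) (f : R -> R -> R -> R).

(** At an interior point of [A] the restriction to [A] disappears from the limit, and the quotient
    in [z] becomes one in [h = z - x]. *)
Lemma derivable_within_is_derive (A : set R) (g : R -> R) (x : R) :
  nbhs x A -> derivable_within A g x ->
  is_derive x (1 : R) g (derive_within A g x).
Proof.
move=> Ax dg; have {}dg : quotient_within A g x --> derive_within A g x by exact: dg.
have dg' : (fun h : R => h^-1 *: (g (h *: 1 + x) - g x)) @ (0:R)^' -->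
    derive_within A g x.
  apply/cvgrPdist_le => e e0; move/cvgrPdist_le : dg => /(_ e e0).
  rewrite /within/= /dnbhs/= => H.
  have {}H : \forall z \near x, z != x ->
      `|derive_within A g x - (g z - g x) / (z - x)| <= e.
    have H' : nbhs x [set z | z != x -> A z ->
        `|derive_within A g x - (g z - g x) / (z - x)| <= e] by exact: H.
    by move: Ax; apply: filterS2 H' => z Hz Az zx; exact: Hz.
  have Hx : h + x @[h --> (0:R)] --> x.
    by rewrite -[X in _ --> X]add0r; apply: cvgD; [exact: cvg_id|exact: cvg_cst].
  have Hx' : \forall h \near (0:R)^', h + x != x ->
      `|derive_within A g x - (g (h + x) - g x) / (h + x - x)| <= e.
    exact: (@nbhs_dnbhs _ (0:R) _ (Hx _ H)).
  near=> h; have h0 : h != 0 by near: h; exact: nbhs_dnbhs_neq.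
  have : h + x != x -> `|derive_within A g x - (g (h + x) - g x) / (h + x - x)| <= e.
    by exact: (near Hx' h).
  rewrite addrK [_%:A]mulr1 mulrC; apply.
  by rewrite -subr_eq0 addrK.
apply: is_derive_derive1; rewrite derive1E.
by split; [apply/cvg_ex; eexists; exact: dg'|exact: cvg_lim dg'].
Unshelve. all: by end_near. Qed.

Lemma within_continuous_box (A : set (R * R * R)) (G : R * R * R -> R) t y u e :
  {within A, continuous G} -> nbhs (t, y, u) A -> 0 < e ->
  exists2 d, 0 < d & forall s z v,
    t - d <= s <= t + d -> y - d <= z <= y + d -> u - d <= v <= u + d ->
    A (s, z, v) /\ `|G (s, z, v) - G (t, y, u)| <= e.
Proof.
move=> cG nA e0.
have /cvgrPdist_le/(_ e e0) H : G @ (nbhs (t, y, u)) --> G (t, y, u).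
  move: cG => /subspace_continuousP /(_ _ (nbhs_singleton nA)).
  by rewrite within_interior.
have /nbhs_ballP[d /= d0 Hd] : \forall z \near (t, y, u),
    A z /\ `|G (t, y, u) - G z| <= e.
  by near=> z; split; near: z.
exists (d / 2); first by rewrite divr_gt0.
move=> s z v hs hz hv; rewrite distrC; apply: Hd.
by split; [split|]; rewrite /ball/= ltr_norml; lra.
Unshelve. all: by end_near. Qed.

Lemma nbhs_box (A : set (R * R * R)) t y u d : 0 < d ->
  (forall s z v, t - d <= s <= t + d -> y - d <= z <= y + d ->
    u - d <= v <= u + d -> A (s, z, v)) -> nbhs (t, y, u) A.
Proof.
move=> d0 H; apply/nbhs_ballP; exists d => //= -[[s z] v] [[/=]].
rewrite /ball/= => h1 h2 h3; apply: H.
all: by rewrite -ler_distlC ltW.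
Qed.

Lemma nbhs_domain T t y u : 0 < t < T -> 0 < y -> nbhs (t, y, u) (domain T).
Proof.
move=> tT y0; pose d := Num.min (Num.min t (T - t)) y.
have dt : d <= t by rewrite /d !ge_min lexx.
have dT : d <= T - t by rewrite /d !ge_min lexx orbT.
have dy : d <= y by rewrite /d ge_min lexx orbT.
have d0 : 0 < d by rewrite /d !lt_min; lra.
by apply: (@nbhs_box _ _ _ _ d) => // s z v hs hz _; split; rewrite /=; lra.
Qed.

(** Interior times and positive [y] are where the possibly one-sided derivatives [Dt] and [Dy] are
    ordinary ones. *)
Lemma C1_tyu_at T G t y u : C1_tyu T G -> 0 < t < T -> 0 < y ->
  C1_at G (Dt T G) (Dy G) (Du G) t y u.
Proof.
move=> [dG cT cY cU] tT y0 e e0.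
have nD := nbhs_domain u tT y0.
have [d1 d10 H1] := within_continuous_box cT nD e0.
have [d2 d20 H2] := within_continuous_box cY nD e0.
have [d3 d30 H3] := within_continuous_box cU nD e0.
have /andP[t0 tT0] := tT.
(* Half the distances to the boundary keep the whole closed box in the open domain. *)
have [d [d0 dd1 dd2 dd3 [m1 m2 m3]]] : exists d, [/\ 0 < d, d <= d1, d <= d2,
    d <= d3 & [/\ d <= t / 2, d <= (T - t) / 2 & d <= y / 2]].
  exists (Num.min (Num.min (Num.min d1 d2) d3)
    (Num.min (Num.min (t / 2) ((T - t) / 2)) (y / 2))).
  by rewrite !lt_min !ge_min !lexx !orbT d10 d20 d30 !divr_gt0// subr_gt0.
exists d => [|s z v hs hz hv]; first exact: d0.
have sT : 0 < s < T by lra.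
have z0 : 0 < z by lra.
have [|| dt dy du] := dG s z v; [by lra|by lra|].
split; last first.
  split.
  - by have [|||_] := H1 s z v; [lra|lra|lra|].
  - by have [|||_] := H2 s z v; [lra|lra|lra|].
  - by have [|||_] := H3 s z v; [lra|lra|lra|].
split.
- apply: derivable_within_is_derive; last exact: dt.
  apply: (@filterS _ _ _ `]0, T[); last by apply: near_in_itvoo; rewrite in_itv.
  by move=> r /=; rewrite !in_itv/=; lra.
- apply: derivable_within_is_derive; last exact: dy.
  apply: (@filterS _ _ _ `]0, z + 1[); last by apply: near_in_itvoo; rewrite in_itv/=; lra.
  by move=> r /=; rewrite !in_itv/=; lra.
- exact: is_derive_derive1.
Qed.

(** Time is frozen: [f t] is viewed as a function of three variables with zero time derivative, so
    that the three-variable estimates apply to [f], for which no time derivative is assumed. *)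
Lemma C1_yu_at f t y u : C1_yu (f t) -> 0 < y ->
  C1_at (fun _ => f t) (fun _ _ _ => 0) (fun _ => Dy f t) (fun _ => Du f t) t y u.
Proof.
move=> [dG cY cU] y0 e e0.
pose A := [set z : R * R * R | 0 <= z.1.2].
have nA : nbhs (t, y, u) A.
  by apply: (@nbhs_box _ _ _ _ y) => // s z v _ hz _; rewrite /A/=; lra.
have cA (G : R * R -> R) : {within [set z : R * R | 0 <= z.1], continuous G} ->
    {within A, continuous (fun z : R * R * R => G (z.1.2, z.2))}.
  move=> /subspace_continuousP cG; apply/subspace_continuousP => -[[s z] v] zA.
  have cphi : (fun w : R * R * R => (w.1.2, w.2)) @ (s, z, v) --> (z, v).
    apply: (@cvg_pair _ _ _ _ (nbhs z) (nbhs v)) => /=.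
      by apply: (cvg_comp _ _ (@cvg_fst _ _ (nbhs (s, z)) (nbhs v) _)); exact: cvg_snd.
    exact: cvg_snd.
  by apply: (cvg_comp _ _ _ (cG (z, v) zA)) => B /= /cphi.
have [d1 d10 H1] := within_continuous_box (cA _ cY) nA e0.
have [d2 d20 H2] := within_continuous_box (cA _ cU) nA e0.
have [d [d0 dd1 dd2 dm]] : exists d, [/\ 0 < d, d <= d1, d <= d2 & d <= y / 2].
  exists (Num.min (Num.min d1 d2) (y / 2)).
  by rewrite !lt_min !ge_min !lexx !orbT d10 d20 divr_gt0.
exists d => [|s z v hs hz hv]; first exact: d0.
have z0 : 0 < z by lra.
have [| dy du] := dG z v; first by lra.
split; last first.
  split.
  - by rewrite subrr normr0 ltW.
  - by have [|||_] := H1 s z v; [lra|lra|lra|].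
  - by have [|||_] := H2 s z v; [lra|lra|lra|].
split.
- exact: is_derive_cst.
- apply: derivable_within_is_derive; last exact: dy.
  apply: (@filterS _ _ _ `]0, z + 1[); last by apply: near_in_itvoo; rewrite in_itv/=; lra.
  by move=> r /=; rewrite !in_itv/=; lra.
- exact: is_derive_derive1.
Qed.

(** Concavity on the segment towards [(z, v)] bounds [a] times the full increment by the increment
    at parameter [a]; the latter is linear up to [a * e], and dividing by [a] leaves the tangent
    inequality up to [e]. *)
Lemma C1_at_concave_tangent (g gy gu : R -> R -> R) t y u z v :
  C1_at (fun _ => g) (fun _ _ _ => 0) (fun _ => gy) (fun _ => gu) t y u ->
  (forall a, 0 < a < 1 -> a * g z v + (1 - a) * g y u
     <= g (a * z + (1 - a) * y) (a * v + (1 - a) * u)) ->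
  g z v <= g y u + gy y u * (z - y) + gu y u * (v - u).
Proof.
move=> C1 conc; apply/ler_addgt0Pr => e e0.
pose k := 1 + `|z - y| + `|v - u|.
have k1 : 1 <= k by rewrite /k; have := normr_ge0 (z - y); have := normr_ge0 (v - u); lra.
have k0 : 0 < k by lra.
have [|d d0 Hd] := C1_at_increment C1 (e := e / k); first by rewrite divr_gt0.
(* Both coordinate differences are at most [k], so the point at parameter [a] lies in the box of
   size [d]. *)
pose a := Num.min (d / k) (1 / 2).
have a0 : 0 < a by rewrite /a lt_min !divr_gt0.
have a1 : a <= 1 / 2 by rewrite /a ge_min lexx orbT.
have ak : a * k <= d by rewrite -ler_pdivlMr// /a ge_min lexx.
have ax x : `|x| <= k -> `|a * x| <= d.
  move=> xk; rewrite normrM gtr0_norm//; apply: le_trans ak.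
  by rewrite ler_wpM2l// ltW.
have zk : `|z - y| <= k by rewrite /k; have := normr_ge0 (v - u); lra.
have vk : `|v - u| <= k by rewrite /k; have := normr_ge0 (z - y); lra.
have := Hd t (a * z + (1 - a) * y) (a * v + (1 - a) * u).
rewrite -!ler_distlC subrr normr0 ltW// mul0r !add0r.
have -> : a * z + (1 - a) * y - y = a * (z - y) by ring.
have -> : a * v + (1 - a) * u - u = a * (v - u) by ring.
have -> : y - (a * z + (1 - a) * y) = - (a * (z - y)) by ring.
have -> : u - (a * v + (1 - a) * u) = - (a * (v - u)) by ring.
rewrite !normrN !ax// => /(_ isT isT isT).
rewrite !normrM gtr0_norm// => H.
have {H} := le_trans (ler_norm _) H.
have := conc a; rewrite a0 => /(_ ltac:(lra)) => H1 H2.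
have H3 : a * (g z v - (g y u + gy y u * (z - y) + gu y u * (v - u))) <=
   a * (e / k * (`|z - y| + `|v - u|)).
  have -> : a * (e / k * (`|z - y| + `|v - u|)) = e / k * (a * `|z - y| + a * `|v - u|).
    by ring.
  by lra.
rewrite ler_pM2l// in H3.
have H4 : e / k * (`|z - y| + `|v - u|) <= e.
  rewrite -mulrA ger_pMr// mulrC ler_pdivrMr// mul1r /k; lra.
by lra.
Qed.

(** Only the base point has to avoid the boundary: [z = 0] is allowed, and is used to bound the
    slope along the path. *)
Lemma A1_tangent T f t y u z v : A1 T f -> 0 <= t <= T -> 0 < y -> 0 <= z ->
  f t z v <= f t y u + Dy f t y u * (z - y) + Du f t y u * (v - u).
Proof.
move=> /[apply] -[conc C1 _] y0 z0.
apply: (C1_at_concave_tangent (C1_yu_at u C1 y0)) => a a01.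
have [E|ne] := pselect ((z, v) = (y, u)).
  by move: E => [-> ->]; rewrite -!mulrDl subrKC !mul1r.
by apply/ltW/conc => //; exact: ltW.
Qed.

Lemma continuous_box_bounded (A : set (R * R * R)) (G : R * R * R -> R)
    (t1 t2 y1 y2 u1 u2 : R) : {within A, continuous G} ->
  (forall t y u, t1 <= t <= t2 -> y1 <= y <= y2 -> u1 <= u <= u2 -> A (t, y, u)) ->
  exists M, forall t y u, t1 <= t <= t2 -> y1 <= y <= y2 -> u1 <= u <= u2 ->
    `|G (t, y, u)| <= M.
Proof.
move=> cG sub.
pose K : set (R * R * R) := `[t1, t2]%classic `*` `[y1, y2]%classic `*` `[u1, u2]%classic.
have KA : K `<=` A.
  by move=> [[t y] u] [[/= ]]; rewrite !in_itv/=; exact: sub.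
have cK : compact K.
  by do 2 (apply: compact_setX; last exact: segment_compact); exact: segment_compact.
have /compact_bounded[M [_ HM]] : compact (G @` K).
  by apply: continuous_compact => //; exact: continuous_subspaceW KA cG.
exists (M + 1) => t y u ht hy hu; apply: HM; first by rewrite ltrDl.
by exists (t, y, u).
Qed.

End aggregator_calculus.

(** * A backward integral equation *)

Section picard.
Context {R : realType}.
Notation mu := lebesgue_measure.
Variables (T K M : R) (F : R -> R -> R).
Hypotheses (T0 : 0 < T) (K0 : 0 < K)
  (mF : forall v, measurable_fun `[0, T] v ->
    measurable_fun `[0, T] (fun s => F s (v s)))
  (FK : forall s u u', 0 <= s <= T -> `|F s u - F s u'| <= K * `|u - u'|)
  (FM : forall s, 0 <= s <= T -> `|F s 0| <= M).

Lemma backward_measurable (g : R -> R) (B : R) : measurable_fun `[0, T] g ->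
  (forall s, 0 <= s <= T -> `|g s| <= B) ->
  measurable_fun `[0, T] (fun t => \int[mu]_(s in `[t, T]) g s).
Proof.
move=> mg gB.
have H : {within `[0, T], continuous (fun t => \int[mu]_(s in `[0, T]) g s -
    \int[mu]_(s in `[0, t]) g s)}.
  move=> x; apply: cvgB; first exact: cvg_cst.
  apply: (@parameterized_integral_continuous _ 0 T g (ltW T0)).
  exact: bounded_integrable_itv gB.
apply: eq_measurable_fun (subspace_continuous_measurable_fun _ H) => //.
move=> t; rewrite inE/= in_itv/= => /andP[t0 tT].
rewrite -[LHS]/(\int[mu]_(s in `[0, T]) g s - \int[mu]_(s in `[0, t]) g s).
by rewrite (@Rintegral_itv_split _ 0 T B g mg gB 0 t T)// addrAC subrr add0r.
Qed.

(** Integrating [e^(2K(T - s))] over [[t, T]] divides it by [2 K], up to a negative term. In the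
    norm weighted by this exponential a [K]-Lipschitz right-hand side therefore contracts by one
    half, whatever the horizon. *)
Lemma le_Rintegral_exp (g : R -> R) (C t : R) : measurable_fun `[0, T] g ->
  0 <= C -> 0 <= t <= T ->
  (forall s, 0 <= s <= T -> `|g s| <= C * (2 * K * expR (2 * K * (T - s)))) ->
  `|\int[mu]_(s in `[t, T]) g s| <= C * expR (2 * K * (T - t)).
Proof.
move=> mg C0 /andP[t0 tT] gC.
have gB s : 0 <= s <= T -> `|g s| <= C * (2 * K * expR (2 * K * T)).
  move=> sT; apply: le_trans (gC s sT) _.
  rewrite ler_wpM2l// ler_wpM2l ?ler_expR ?mulr_ge0// ?(ltW K0)//.
  by rewrite ler_wpM2l ?mulr_ge0// ?(ltW K0)//; lra.
move: tT; rewrite le_eqVlt => /predU1P[->|tT].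
  by rewrite set_itv1 Rintegral_set1 normr0 mulr_ge0// expR_ge0.
have ig : mu.-integrable `[t, T] (EFin \o g) by exact: (sub_bounded_integrable mg gB).
apply: le_trans (le_normr_Rintegral _ ig) _ => //.
pose h s := C * (2 * K * expR (2 * K * (T - s))).
pose H s := - C * expR (2 * K * (T - s)).
have dH s : is_derive s (1 : R) H (h s).
  have dT x : is_derive x (1 : R) (fun s => 2 * K * (T - s)) (- (2 * K)).
    by apply: is_derive_eq; rewrite -[_ *: _]/(_ * _); ring.
  by apply: is_derive_eq; rewrite -[_ *: _]/(_ * _) /h; ring.
have ch : continuous h.
  move=> x; apply: cvgM; first exact: cvg_cst.
  apply: cvgM; first exact: cvg_cst.
  apply: continuous_comp; last exact: continuous_expR.
  apply: cvgM; first exact: cvg_cst.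
  by apply: cvgB; [exact: cvg_cst|exact: cvg_id].
have hE : (\int[mu]_(s in `[t, T]) (h s)%:E = (H T)%:E - (H t)%:E)%E.
  apply: continuous_FTC2 => //.
  - by apply: continuous_subspaceT.
  - have cH x : H y @[y --> x] --> H x.
      by have [d _] := dH x; exact/differentiable_continuous/derivable1_diffP.
    split.
    + by move=> x _; have [] := dH x.
    + by apply: cvg_at_right_filter; exact: cH.
    + by apply: cvg_at_left_filter; exact: cH.
  - by move=> x _; have [_] := dH x; rewrite derive1E.
have : \int[mu]_(s in `[t, T]) `|g s| <= \int[mu]_(s in `[t, T]) h s.
  apply: le_Rintegral => //; first exact: integrable_norm.
    apply: continuous_compact_integrable; first exact: segment_compact.
    exact: continuous_subspaceT.
  by move=> s; rewrite /= in_itv/= => sT; apply: gC; lra.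
move=> /le_trans; apply.
rewrite /Rintegral hE /=.
by rewrite /H subrr mulr0 expR0; lra.
Qed.

Lemma M_ge0 : 0 <= M.
Proof. by have := FM (s := 0); rewrite lexx (ltW T0) => /(_ isT); exact: le_trans. Qed.

Fixpoint picard n : R -> R :=
  if n is m.+1 then fun t => \int[mu]_(s in `[t, T]) F s (picard m s) else fun=> 0.

Lemma picard_bounded n : measurable_fun `[0, T] (picard n) /\
  exists B : R, forall s, 0 <= s <= T -> `|picard n s| <= B.
Proof.
elim: n => [|n [mP [B PB]]].
  by split => /=; [exact: measurable_cst|exists 0 => s _; rewrite normr0].
have FB s : 0 <= s <= T -> `|F s (picard n s)| <= M + K * B.
  move=> sT; rewrite -[F s _](subrK (F s 0)) addrC.
  apply: le_trans (ler_normD _ _) _; rewrite lerD ?FM//.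
  by apply: le_trans (FK _ _ sT) _; rewrite subr0 ler_wpM2l ?PB// ltW.
split; first exact: backward_measurable (mF mP) FB.
exists ((M + K * B) * T) => s /andP[s0 sT].
apply: le_trans (Rintegral_itv_bound (mF mP) FB _ _ _) _ => //.
rewrite ler_wpM2l//; last lra.
by apply: le_trans (FB s _); rewrite ?s0.
Qed.

Lemma picardF_bounded n : exists B : R, forall s, 0 <= s <= T -> `|F s (picard n s)| <= B.
Proof.
have [mP [B PB]] := picard_bounded n; exists (M + K * B) => s sT.
rewrite -[F s _](subrK (F s 0)) addrC.
apply: le_trans (ler_normD _ _) _; rewrite lerD ?FM//.
by apply: le_trans (FK _ _ sT) _; rewrite subr0 ler_wpM2l ?PB// ltW.
Qed.

Let w s := expR (2 * K * (T - s)).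

(** Ratio one half in the weighted norm; the first difference is at most [M * T] because the
    iteration starts at 0. *)
Lemma picard_contraction n t : 0 <= t <= T ->
  `|picard n.+1 t - picard n t| <= (M * T) * (1/2) ^+ n * w t.
Proof.
have M0 := M_ge0.
elim: n t => [|n IH] t tT.
  rewrite subr0 expr0 mulr1 /=.
  have H0 s : 0 <= s <= T -> `|F s (picard 0 s)| <= M by exact: FM.
  have := Rintegral_itv_bound (mF (picard_bounded 0).1) H0.
  move=> /(_ t T) H; apply: le_trans (H _ _ _) _; try lra.
  rewrite -mulrA ler_wpM2l//; apply: (@le_trans _ _ (T * 1)); first lra.
  rewrite ler_wpM2l// ?(ltW T0)// -expR0 ler_expR mulr_ge0//; last lra.
  by rewrite mulr_ge0// ltW.
have [mP1 _] := picard_bounded n.+1; have [mP0 _] := picard_bounded n.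
have [B1 HB1] := picardF_bounded n.+1; have [B0 HB0] := picardF_bounded n.
have /andP[t0 tT'] := tT.
rewrite [X in `|X - _|]/= [X in `|_ - X|]/= -RintegralB//; last 2 first.
- exact: (sub_bounded_integrable (mF mP1) HB1).
- exact: (sub_bounded_integrable (mF mP0) HB0).
apply: le_Rintegral_exp => //.
- by apply: measurable_funB; exact: mF.
- by rewrite mulr_ge0 ?exprn_ge0// mulr_ge0// ltW.
move=> s sT; apply: le_trans (FK _ _ sT) _.
apply: (@le_trans _ _ (K * ((M * T) * (1/2) ^+ n * w s))).
  by rewrite ler_wpM2l ?(ltW K0)//; exact: IH.
by rewrite /w exprS le_eqVlt; apply/orP; left; apply/eqP; field.
Qed.

(** The geometric series of the successive differences sums to twice its first term; the weight is
    replaced by its largest value [w 0]. *)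
Let D := 2 * (M * T) * w 0.

Lemma picard_tail n k t : 0 <= t <= T ->
  `|picard (n + k) t - picard n t| <= D * (1/2) ^+ n.
Proof.
move=> tT.
have M0 := M_ge0.
have MT : 0 <= M * T by rewrite mulr_ge0// ltW.
have wt : w t <= w 0.
  by rewrite ler_expR ler_wpM2l ?mulr_ge0 ?(ltW K0)//; lra.
have w0 : 0 <= w 0 by exact: expR_ge0.
(* The partial geometric sum, rather than its limit, is what the induction on [k] can carry. *)
suff : `|picard (n + k) t - picard n t| <= D * (1/2) ^+ n * (1 - (1/2) ^+ k).
  have D0 : 0 <= D by rewrite /D !mulr_ge0 // ltW.
  have h0 m : 0 <= (1 / 2 : R) ^+ m by rewrite exprn_ge0.
  move=> /le_trans; apply; have Dn := mulr_ge0 D0 (h0 n).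
  by rewrite ler_piMr// lerBlDr lerDl.
elim: k => [|k IH]; first by rewrite addn0 subrr normr0 expr0 subrr mulr0.
rewrite addnS -[picard (n + k).+1 t](subrK (picard (n + k) t)) -addrA.
apply: le_trans (ler_normD _ _) _.
have C := picard_contraction (n + k) tT.
have {}C : `|picard (n + k).+1 t - picard (n + k) t| <=
    (M * T) * (1/2) ^+ (n + k) * w 0.
  by apply: le_trans C _; rewrite ler_wpM2l// mulr_ge0// exprn_ge0.
apply: le_trans (lerD C IH) _; rewrite /D exprD exprS le_eqVlt.
by apply/orP; left; apply/eqP; field.
Qed.

(** The iterates converge pointwise, so the limit is measurable; the geometric rate is uniform in
    time, which lets the limit pass under the integral. *)
Lemma backward_ode : exists U : R -> R, [/\ measurable_fun `[0, T] U,
  exists B : R, forall t : R, 0 <= t <= T -> `|U t| <= B &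
  forall t : R, 0 <= t <= T -> U t = \int[mu]_(s in `[t, T]) F s (U s)].
Proof.
have M0 := M_ge0.
have D0 : 0 <= D by rewrite /D !mulr_ge0 ?expR_ge0// ltW.
have half0 : (fun n => D * (1/2) ^+ n) @ \oo --> (0 : R).
  rewrite -[X in _ --> X](mulr0 D); apply: cvgM; first exact: cvg_cst.
  by apply: cvg_expr; rewrite ger0_norm; lra.
have cvgP t : 0 <= t <= T -> cvgn (picard ^~ t).
  move=> tT; apply/cauchy_cvgP/cauchy_exP => e e0.
  have /cvgrPdist_lt/(_ e e0)[n _ /(_ n (leqnn n))/= Hn] := half0.
  exists (picard n t); exists n => // m /= nm; rewrite -(subnKC nm).
  rewrite /ball/= distrC; apply: le_lt_trans (picard_tail _ _ tT) _.
  by move: Hn; rewrite sub0r normrN; apply: le_lt_trans; exact: ler_norm.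
pose U t := limn (picard ^~ t).
have cvgU t : 0 <= t <= T -> picard n t @[n --> \oo] --> U t by exact: cvgP.
have tailU n t : 0 <= t <= T -> `|U t - picard n t| <= D * (1/2) ^+ n.
  move=> tT.
  have H : `|picard m t - picard n t| @[m --> \oo] --> `|U t - picard n t|.
    by apply: cvg_norm; apply: cvgB; [exact: cvgU|exact: cvg_cst].
  rewrite -(cvg_lim _ H)//; apply: limr_le; first by apply/cvg_ex; eexists; exact: H.
  exists n => // m /= nm; rewrite -(subnKC nm); exact: picard_tail.
have mU : measurable_fun `[0, T] U.
  apply: (@measurable_fun_cvg _ _ _ _ picard) => //.
    by move=> n; have [] := picard_bounded n.
have UD t : 0 <= t <= T -> `|U t| <= D.
  by move=> tT; have := tailU 0%N t tT; rewrite subr0 expr0 mulr1.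
have FU s : 0 <= s <= T -> `|F s (U s)| <= M + K * D.
  move=> sT; rewrite -[F s _](subrK (F s 0)) addrC.
  apply: le_trans (ler_normD _ _) _; rewrite lerD ?FM//.
  by apply: le_trans (FK _ _ sT) _; rewrite subr0 ler_wpM2l ?UD// ltW.
exists U; split; [exact: mU|by exists D|].
move=> t tT; have /andP[t0 tT'] := tT.
have H1 : picard n.+1 t @[n --> \oo] --> U t.
  by have := cvgU t tT; rewrite -(cvg_shiftS (picard ^~ t)).
have H2 : picard n.+1 t @[n --> \oo] --> \int[mu]_(s in `[t, T]) F s (U s).
  apply/cvgrPdist_le => e e0.
  have : (fun n => K * T * (D * (1/2) ^+ n)) @ \oo --> (0 : R).
    by rewrite -[X in _ --> X](mulr0 (K * T)); apply: cvgM half0; exact: cvg_cst.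
  move=> /cvgrPdist_le/(_ e e0); apply: filterS => n.
  rewrite sub0r normrN => /(le_trans (ler_norm _)); apply: le_trans.
  have [mP _] := picard_bounded n; have [B HB] := picardF_bounded n.
  rewrite /= -RintegralB//; last 2 first.
  - exact: (sub_bounded_integrable (mF mU) FU).
  - exact: (sub_bounded_integrable (mF mP) HB).
  have mFF : measurable_fun `[0, T] (fun s => F s (U s) - F s (picard n s)).
    by apply: measurable_funB; exact: mF.
  have bFF s : 0 <= s <= T ->
      `|F s (U s) - F s (picard n s)| <= K * (D * (1/2) ^+ n).
    move=> sT; apply: le_trans (FK _ _ sT) _.
    by rewrite ler_wpM2l ?(ltW K0)//; exact: tailU.
  apply: le_trans (Rintegral_itv_bound mFF bFF _ _ _) _ => //.
  rewrite (mulrAC K T) ler_wpM2l//; last lra.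
  by rewrite mulr_ge0 ?(ltW K0)// mulr_ge0// exprn_ge0.
exact: (cvg_unique _ H1 H2).
Qed.

End picard.

(** * Consumption plans as measures *)

Section plan_measures.
Context {d : measure_display} {Omega : measurableType d} {R : realType}.
Variables (T : R) (F : R -> set (set Omega)).
Implicit Types (C : plan T F) (w : Omega).

Lemma plan_measure_ocitv C w (a b : R) : a <= b ->
  plan_measure C w `]a, b]%classic = (C b w - C a w)%:E.
Proof.
move=> ab; rewrite /plan_measure /lebesgue_stieltjes_measure.
rewrite /measure_extension measurable_mu_extE/=; last exact: is_ocitv.
by rewrite wlength_itv_bnd.
Qed.

(** []-1, t]] has mass [C t w] and exceeds [[0, t]] by []-1, 0[], a countable union of half-open
    intervals on which [C] stays 0. The atom at 0 is thus counted. *)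
Lemma plan_measure_itv0 C w (t : R) : 0 <= t ->
  plan_measure C w `[0, t]%classic = (C t w)%:E.
Proof.
move=> t0.
have N0 : plan_measure C w `]-1, 0[%classic = 0%E.
  have E : `]-1, 0[%classic = \bigcup_n `]-1, - n.+1%:R^-1]%classic :> set R.
    apply/seteqP; split => x; rewrite /= in_itv/=.
      move=> /andP[x1 x0].
      have /cvgrPdist_lt/(_ (- x)) := @cvg_harmonic R.
      rewrite oppr_gt0 => /(_ x0)[n _ /(_ n (leqnn n))]/=.
      rewrite sub0r normrN ger0_norm ?invr_ge0// => nx.
      by exists n => //=; rewrite in_itv/= x1/= lerNr ltW.
    move=> [n _]; rewrite /= in_itv/= => /andP[-> xn]/=.
    by apply: le_lt_trans xn _; rewrite oppr_lt0 invr_gt0.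
  rewrite E; apply: measure_negligible; first exact: bigcup_measurable.
  apply: negligible_bigcup => n; apply/negligibleP => //.
  have n1 : -1 <= - n.+1%:R^-1 :> R by rewrite lerN2 invf_le1// ler1n.
  rewrite [LHS]plan_measure_ocitv// !plan_before ?subrr//.
have : plan_measure C w `]-1, t]%classic = (C t w)%:E.
  rewrite plan_measure_ocitv; last lra.
  by rewrite (@plan_before _ _ _ _ _ C (-1)) ?subr0//; lra.
rewrite (_ : `]-1, t]%classic = `]-1, 0[%classic `|` `[0, t]%classic).
  rewrite [LHS](measureU (lebesgue_stieltjes_measure (plan_path C w)))//; last first.
    by rewrite -subset0 => x [] /=; rewrite !in_itv/=; lra.
  by rewrite [X in (X + _)%E]N0 add0e.
by apply/seteqP; split => x; rewrite /= !in_itv/=; have [] := ltP x 0; lra.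
Qed.

Lemma plan_ge0 C w t : 0 <= C t w.
Proof.
have [t0|t0] := ltP t 0; first by rewrite plan_before.
by rewrite -lee_fin -plan_measure_itv0.
Qed.

Lemma plan_le C w t : t <= T -> C t w <= C T w.
Proof. by move=> tT; exact: plan_nondecreasing. Qed.

Section constant_plan.
Variables (C : plan T F) (w : Omega) (c : R).
Hypothesis Cc : forall t, 0 <= t <= T -> C t w = c.

(** On [[0, T]] the measure of this path is [c] times the Dirac mass at 0: []0, t]] is null and the
    mass of [[0, 0]] is [c]. *)
Lemma integral_constant_plan (g : R -> \bar R) t : 0 <= t <= T ->
  measurable_fun `[0, t] g -> (forall x, (0 <= x <= t)%R -> 0 <= g x)%E ->
  (\int[plan_measure C w]_(s in `[0%R, t]) g s = g 0%R * c%:E)%E.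
Proof.
move=> /andP[t0 tT] mg g0.
have E : `[0, t]%classic = [set 0] `|` `]0, t]%classic :> set R.
  apply/seteqP; split => x /=; rewrite !in_itv/=.
    by move=> /andP[x0 ->]; move: x0; rewrite le_eqVlt => /predU1P[->|->]; [left|right].
  by case=> [->|/andP[/ltW -> ->]//]; rewrite lexx.
have mg' : measurable_fun ([set 0] `|` `]0, t]%classic) g by rewrite -E.
have g0' x : ([set 0] `|` `]0, t]%classic) x -> (0 <= g x)%E.
  by rewrite -E /= in_itv/=; exact: g0.
have dis : [disjoint ([set 0] : set R) & `]0, t]%classic].
  by apply/disj_setPLR => x/= ->; rewrite in_itv/= ltxx.
have m0 : measurable ([set 0] : set R) by [].
have mt : measurable (`]0, t]%classic : set R) by [].
rewrite E (@ge0_integral_setU _ (measurableTypeR R) R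
  (lebesgue_stieltjes_measure (plan_path C w)) _ _ m0 mt g mg' g0' dis).
have -> : (\int[lebesgue_stieltjes_measure (plan_path C w)]_(s in `]0%R, t]) g s
    = 0)%E.
  apply: null_set_integral => //.
  - by apply: measurable_funS mg => //; exact: subset_itv_oc_cc.
  - by rewrite [LHS]plan_measure_ocitv// !Cc ?subrr ?lexx ?t0// (le_trans t0).
rewrite adde0 (eq_integral (cst (g 0%R))); last by move=> x; rewrite inE/= => ->.
rewrite [LHS]integral_cst//; congr (_ * _)%E.
by rewrite -set_itv1 [LHS]plan_measure_itv0// Cc// lexx (le_trans t0).
Qed.

End constant_plan.

End plan_measures.

(** * Exchanging the time integral and the plan measure along one path *)

Section tonelli.
Context {d : measure_display} {Omega : measurableType d} {R : realType}.
Variables (T beta : R) (F : R -> set (set Omega)) (C : plan T F) (w : Omega).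
Hypotheses (beta0 : 0 < beta).
Notation leb := (@lebesgue_measure R).
Notation muC := (lebesgue_stieltjes_measure (plan_path C w)).

(** Contribution to satisfaction at time [s] of one unit consumed at time [v]. *)
Definition decay_kernel (s v : R) : R := beta * expR (- (beta * (s - v))).

Lemma decay_kernel_ge0 s v : 0 <= decay_kernel s v.
Proof. by rewrite mulr_ge0 ?expR_ge0// ltW. Qed.

Lemma measurable_decay_kernel : measurable_fun setT
  (fun z : measurableTypeR R * measurableTypeR R => decay_kernel z.1 z.2).
Proof.
apply: measurable_funM; first exact: measurable_cst.
apply: measurableT_comp => //; apply: measurableT_comp => //.
apply: measurable_funM; first exact: measurable_cst.
by apply: measurable_funB; [exact: measurable_fst|exact: measurable_snd].
Qed.

Lemma decay_integral_le s : 0 <= s ->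
  (\int[muC]_(v in `[0%R, s]) (decay_kernel s v)%:E <= (beta * C s w)%:E)%E.
Proof.
move=> s0; apply: (@le_trans _ _ (\int[muC]_(v in `[0%R, s]) (cst beta%:E v))%E).
  apply: le_integral_ge0_nomeas => v; rewrite /= in_itv/= => /andP[v0 vs].
  rewrite !lee_fin decay_kernel_ge0 ler_piMr ?(ltW beta0)//.
  by rewrite -expR0 ler_expR oppr_le0 mulr_ge0 ?subr_ge0// ltW.
by rewrite integral_cst// [X in (_ * X)%E]plan_measure_itv0.
Qed.

Lemma decay_integral_fin_num s : 0 <= s ->
  (\int[muC]_(v in `[0%R, s]) (decay_kernel s v)%:E)%E \is a fin_num.
Proof.
move=> s0; rewrite ge0_fin_numE; last first.
  by apply: integral_ge0 => v _; rewrite lee_fin decay_kernel_ge0.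
by apply: le_lt_trans (decay_integral_le s0) _; rewrite ltry.
Qed.

Variables (k : R -> R).
Hypotheses (mk : measurable_fun `[0, T] k) (k0 : forall s, 0 <= s <= T -> 0 <= k s).

(** The integrand on the triangle [0 <= v <= s <= T], extended by 0 to the plane, with [s = z.1] and
    [v = z.2]. *)
Let G (z : measurableTypeR R * measurableTypeR R) : \bar R :=
  ((k \_ `[0, T]) z.1 * decay_kernel z.1 z.2 * ((z.2 <= z.1) && (0 <= z.2))%:R)%:E.

Let mG : measurable_fun setT G.
Proof.
apply/measurable_EFinP; apply: measurable_funM.
  apply: measurable_funM; last exact: measurable_decay_kernel.
  apply: measurableT_comp; last exact: measurable_fst.
  by apply/(measurable_restrictT _ _).1.
rewrite (_ : (fun _ => _) = \1_[set z : measurableTypeR R * measurableTypeR R |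
   (z.2 <= z.1) && (0 <= z.2)]); last first.
  apply/funext => z; rewrite indicE; congr (_%:R); apply/esym.
  by case: (boolP (_ && _)) => h; [rewrite mem_set|rewrite memNset//; apply/negP].
apply: measurable_indic.
have h1 : measurable_fun setT (fun z : measurableTypeR R * measurableTypeR R => z.2 <= z.1).
  by apply: measurable_fun_ler.
have h2 : measurable_fun setT (fun z : measurableTypeR R * measurableTypeR R => 0 <= z.2).
  by apply: measurable_fun_ler.
have := measurable_and h1 h2.
by move=> /(_ measurableT [set true]); rewrite setTI; exact.
Qed.

Let G0 z : (0 <= G z)%E.
Proof.
rewrite lee_fin mulr_ge0//; rewrite mulr_ge0 ?decay_kernel_ge0//.
by rewrite patchE; case: ifPn => //; rewrite inE/= in_itv/=; exact: k0.
Qed.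

Let GsE s : 0 <= s <= T -> (\int[muC]_v G (s, v) =
  (k s)%:E * \int[muC]_(v in `[0%R, s]) (decay_kernel s v)%:E)%E.
Proof.
move=> sT; rewrite -ge0_integralZl_EFin ?k0//; last 2 first.
- by move=> v _; rewrite lee_fin decay_kernel_ge0.
- apply/measurable_EFinP; apply: measurable_funTS.
  exact: measurableT_comp measurable_decay_kernel (measurable_pair1 _).
rewrite [RHS]integral_mkcond; apply: eq_integral => v _.
rewrite /G/= !patchE mem_set/=; last by rewrite in_itv.
have -> : (v \in `[0, s]%classic) = (v <= s) && (0 <= v).
  by rewrite andbC; apply/idP/idP; rewrite inE/= in_itv.
by case: (_ && _); rewrite ?mulr1 ?mulr0.
Qed.

Let GvE v : 0 <= v <= T -> (\int[leb]_s G (s, v) =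
  \int[leb]_(s in `[v, T]) (k s * decay_kernel s v)%:E)%E.
Proof.
move=> /andP[v0 vT]; rewrite [RHS]integral_mkcond; apply: eq_integral => s _.
rewrite /G/= !patchE v0 andbT.
case: (boolP (s \in `[v, T]%classic)); rewrite ?inE/= ?notin_setE/= in_itv/=.
  by move=> /andP[vs sT]; rewrite vs mulr1 mem_set//= in_itv/= sT (le_trans v0).
move=> /negP; have [vs|vs] := leP v s; rewrite ?mulr0//= => sT.
by rewrite memNset ?mul0r//= in_itv/= (negbTE sT) andbF.
Qed.

Lemma measurable_decay_integral : measurable_fun `[0, T]
  (fun s => k s * \int[muC]_(v in `[0, s]) decay_kernel s v).
Proof.
have := @measurable_fun_fubini_tonelli_F _ _ (measurableTypeR R) (measurableTypeR R) R
  muC G mG G0.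
move=> /(measurable_funTS (D := `[0, T]%classic)) H.
have : measurable_fun `[0, T] (fun s => fine (\int[muC]_v G (s, v))).
  by apply: measurableT_comp.
apply: eq_measurable_fun => s; rewrite inE/= in_itv/= => sT.
rewrite GsE// /Rintegral.
by rewrite fineM// decay_integral_fin_num//; case/andP: sT.
Qed.

(** For the weight [k s = G_s d_y f] the inner integral on the right is [Phi_v], the marginal value
    of a unit consumed at time [v]. *)
Lemma tonelli_plan : (\int[leb]_(s in `[0%R, T])
    ((k s)%:E * \int[muC]_(v in `[0%R, s]) (decay_kernel s v)%:E)
  = \int[muC]_(v in `[0%R, T]) \int[leb]_(s in `[v, T])
      (k s * decay_kernel s v)%:E)%E.
Proof.
transitivity (\int[leb]_s \int[muC]_v G (s, v))%E.
  rewrite integral_mkcond; apply: eq_integral => s _; rewrite patchE.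
  case: ifPn; first by rewrite inE/= in_itv/= => /GsE.
  move=> sT; apply/esym/integral0_eq => v _.
  by rewrite /G/= patchE (negbTE sT) !mul0r.
rewrite (@fubini_tonelli _ _ (measurableTypeR R) (measurableTypeR R) R leb muC G mG G0).
rewrite [RHS]integral_mkcond; apply: eq_integral => v _; rewrite patchE.
case: ifPn; first by rewrite inE/= in_itv/= => /GvE.
rewrite notin_setE/= in_itv/= => /negP vT; apply: integral0_eq => s _.
rewrite /G/= patchE; case: ifPn; last by rewrite !mul0r.
rewrite inE/= in_itv/= => /andP[s0 sT].
have -> : (v <= s) && (0 <= v) = false; last by rewrite mulr0.
by apply: contraNF vT => /andP[vs ->]/=; exact: le_trans sT.
Qed.

End tonelli.

(** * Marginal values of consumption bounded by prices *)

Section kernel_tail.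
Context {R : realType}.
Notation leb := (@lebesgue_measure R).
Variables (T beta rho : R) (k : R -> R).
Hypotheses (T0 : 0 < T) (beta0 : 0 < beta) (mk : measurable_fun `[0, T] k)
  (k0 : forall s, 0 <= s <= T -> 0 <= k s)
  (k_noninc : forall s1 s2, 0 < s1 -> s1 <= s2 -> s2 < T ->
    k s2 * expR (rho * s2) <= k s1 * expR (rho * s1)).

Let meas_kd v : measurable_fun `[0, T] (fun s => (k s * decay_kernel beta s v)%:E).
Proof.
apply/measurable_EFinP; apply: measurable_funM => //; apply: measurable_funTS.
exact: measurableT_comp (measurable_decay_kernel beta) (measurable_pair2 _).
Qed.

Let kd_ge0 v s : 0 <= s <= T -> (0 <= (k s * decay_kernel beta s v)%:E)%E.
Proof. by move=> sT; rewrite lee_fin mulr_ge0 ?k0// decay_kernel_ge0. Qed.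

(* The substitution s = v + x turns the left-hand side into the integral over
   [0, T - v] of k (v + x) * decay_kernel beta x 0, and k (v + x) <= expR (- (rho * v)) * k x. *)
Lemma kernel_tail_bound v : 0 <= v <= T ->
  (\int[leb]_(s in `[v, T]) (k s * decay_kernel beta s v)%:E <=
   (expR (- (rho * v)))%:E * \int[leb]_(s in `[0%R, T]) (k s * decay_kernel beta s 0)%:E)%E.
Proof.
move=> /andP[v0 vT].
have sub : `]v, T[ `<=` `[0, T]%classic.
  by apply: subset_itvW => //; rewrite bnd_simp.
have mv A : measurable A -> A `<=` `[0, T]%classic ->
    measurable_fun A (fun s => (k s * decay_kernel beta s v)%:E).
  by move=> mA sA; apply: measurable_funS (meas_kd v).
rewrite -(@integral_itv_obnd_cbnd _ v); last first.
  by apply: mv => //; apply: subset_itvr; rewrite bnd_simp.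
rewrite -(@integral_itv_bndo_bndc _ _ T); last by apply: mv.
rewrite -(@ge0_integral_shift _ `]v, T[ _ v)//; last 2 first.
- by apply: mv.
- by move=> x; rewrite /= in_itv/= => xv; apply: kd_ge0; lra.
rewrite -ge0_integralZl_EFin ?expR_ge0//; first last.
- exact: meas_kd.
- by move=> x; rewrite /= in_itv/=; exact: kd_ge0.
have E : [set x | `]v, T[%classic (x + v)] = `]0, T - v[%classic.
  by apply/seteqP; split => x; rewrite /= !in_itv/=; lra.
rewrite E.
apply: (@le_trans _ _ (\int[leb]_(x in `]0%R, (T - v)%R[)
    ((expR (- (rho * v)))%:E * (k x * decay_kernel beta x 0)%:E))%E).
  apply: le_integral_ge0_nomeas => x; rewrite /= in_itv/= => /andP[x0 xT].
  rewrite kd_ge0; last lra.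
  rewrite -EFinM lee_fin /decay_kernel addrK subr0 !mulrA.
  rewrite ler_wpM2r ?expR_ge0// ler_wpM2r ?(ltW beta0)//.
  have := k_noninc x0 (_ : x <= x + v) ltac:(lra); rewrite lerDl => /(_ v0).
  rewrite mulrDr expRD => H.
  rewrite expRN ler_pdivlMl ?expR_gt0// -(ler_pM2r (expR_gt0 (rho * x))).
  by apply: le_trans H; rewrite (mulrC (expR _) (k _)) -mulrA (mulrC (expR _)).
apply: ge0_subset_integral => //.
- apply: emeasurable_funM => //; exact: meas_kd.
- move=> x; rewrite /= in_itv/= => xT; apply: mule_ge0; last exact: kd_ge0.
  by rewrite lee_fin expR_ge0.
- by apply: subset_itvW => //; lra.
Qed.

Context {d : measure_display} {Omega : measurableType d}.
Variables (F : R -> set (set Omega)) (C : plan T F) (w : Omega).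
Notation muC := (lebesgue_stieltjes_measure (plan_path C w)).

(** After Tonelli the integrand is at most [Phi0 * e^(-rho t)], hence at most [Phi0 * psi t]. The
    last comparison is by monotonicity alone, [psi] being an arbitrary function of time. *)
Lemma kernel_budget_bound (psi : R -> R) :
  (forall t, 0 <= t <= T -> expR (- (rho * t)) <= psi t) ->
  (\int[leb]_(s in `[0%R, T])
    ((k s)%:E * \int[muC]_(v in `[0%R, s]) (decay_kernel beta s v)%:E) <=
   \int[leb]_(s in `[0%R, T]) (k s * decay_kernel beta s 0)%:E *
     \int[muC]_(t in `[0%R, T]) (psi t)%:E)%E.
Proof.
move=> psiP; rewrite tonelli_plan//.
set Phi0 := (\int[leb]_(s in _) (_ * decay_kernel _ _ 0)%:E)%E.
have Phi0_ge0 : (0 <= Phi0)%E.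
  by apply: integral_ge0 => x; rewrite /= in_itv/=; exact: kd_ge0.
apply: (@le_trans _ _ (\int[muC]_(t in `[0%R, T]) (Phi0 * (expR (- (rho * t)))%:E))%E).
  apply: le_integral_ge0_nomeas => v; rewrite /= in_itv/= => vT.
  rewrite integral_ge0/=; last first.
    move=> s; rewrite /= in_itv/= => sv; apply: kd_ge0; lra.
  by rewrite muleC; exact: kernel_tail_bound.
rewrite ge0_integralZl//.
- apply: lee_wpmul2l => //; apply: le_integral_ge0_nomeas => t; rewrite /= in_itv/=.
  by move=> /psiP; rewrite !lee_fin expR_ge0.
- apply/measurable_EFinP; apply: measurableT_comp => //.
  by apply: measurableT_comp => //; exact: measurable_funM.
Qed.

End kernel_tail.

(** * Processes and the filtration *)

Section processes.
Context {R : realType}.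
Notation leb := (@lebesgue_measure R).

(** Near each point [g] is bounded on the right by right-continuity and on the left by the left
    limit; compactness of [[0, T]] makes the bound uniform. *)
Lemma cadlag_bounded (T : R) (g : R -> R) : cadlag T g ->
  exists M : R, forall t, 0 <= t <= T -> `|g t| <= M.
Proof.
move=> [rc lc].
have /near_covering_withinP H :=
  iffLR (compact_near_coveringP _) (@segment_compact R 0 T).
have [|M0 [_ HM]] := H R (pinfty_nbhs R) (fun M t => `|g t| <= M) _.
  move=> x; rewrite /= in_itv/= => /andP[x0 xT].
  have [A HA] : exists A : R, \forall t \near x, x < t -> t <= T -> `|g t| <= A.
    have [xT'|Tx] := ltP x T; last first.
      by exists 0; apply: (@nearW _ (nbhs x)) => t /(le_lt_trans Tx); rewrite ltNge => /negbTE ->.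
    exists (`|g x| + 1).
    have /cvgr_norm_le/(_ (`|g x| + 1)) := rc x ltac:(by rewrite x0).
    rewrite ltrDl ltr01 => /(_ isT) Hn.
    have {}Hn : \forall t \near x, x < t -> `|g t| <= `|g x| + 1 by exact: Hn.
    exact: (@filterS _ (nbhs x) _ _ _ (fun t H xt _ => H xt) Hn).
  have [B HB] : exists B : R, \forall t \near x, t < x -> 0 <= t -> `|g t| <= B.
    have [x0'|x0'] := ltP 0 x; last first.
      exists 0; apply: (@nearW _ (nbhs x)) => t /lt_le_trans/(_ x0').
      by rewrite ltNge => /negbTE ->.
    have /cvg_ex[/= l gl] := lc x ltac:(by rewrite x0').
    exists (`|l| + 1).
    have /cvgr_norm_le/(_ (`|l| + 1)) := gl.
    rewrite ltrDl ltr01 => /(_ isT) Hn.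
    have {}Hn : \forall t \near x, t < x -> `|g t| <= `|l| + 1 by exact: Hn.
    exact: (@filterS _ (nbhs x) _ _ _ (fun t H xt _ => H xt) Hn).
  exists ([set t | (x < t -> t <= T -> `|g t| <= A) /\ (t < x -> 0 <= t -> `|g t| <= B)],
     [set M | `|g x| + `|A| + `|B| < M]) => /=.
    by split; [exact: filterI|exists (`|g x| + `|A| + `|B|); split => //; exact: num_real].
  move=> [t M] [/= [h1 h2] hM]; rewrite in_itv/= => /andP[t0 tT].
  have := ler_norm A; have := ler_norm B; have := normr_ge0 A; have := normr_ge0 B.
  have := normr_ge0 (g x).
  have [xt|tx|<-] := ltgtP x t; [move: (h1 xt tT)|move: (h2 tx t0)|]; lra.
exists (M0 + 1) => t tT; apply: (HM (M0 + 1)); first by rewrite ltrDl.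
by rewrite /= in_itv.
Qed.

Section joint_measurability.
Context {d : measure_display} {Omega : measurableType d}.

(** [Z (q n s)] does not depend on [s] within a cell of the grid of mesh [1 / (n + 1)], hence is
    jointly measurable, and it converges to [Z s] by right-continuity. *)
Lemma right_continuous_joint_measurable (Z : R -> Omega -> R) :
  (forall t, 0 <= t -> measurable_fun setT (Z t)) ->
  (forall w t, 0 <= t -> Z u w @[u --> t^'+] --> Z t w) ->
  measurable_fun ((`[0, +oo[%classic : set (measurableTypeR R)) `*` [set: Omega])
    (fun z : measurableTypeR R * Omega => Z z.1 z.2).
Proof.
move=> mZ rZ.
(* The right end of the half-open cell containing [s]: it lies strictly above [s], as convergence
   along [s^'+] requires. *)
pose q n (s : R) : R := (Num.trunc (s * n.+1%:R)).+1%:R / n.+1%:R.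
have q_gt n s : 0 <= s -> s < q n s.
  move=> s0; rewrite ltr_pdivlMr ?ltr0n//.
  by have /andP[] := trunc_itv (mulr_ge0 s0 (ler0n R n.+1)).
have q_le n s : 0 <= s -> q n s <= s + n.+1%:R^-1.
  move=> s0; rewrite /q -natr1 mulrDl mul1r lerD2r ler_pdivrMr ?ltr0n//.
  by have /andP[] := trunc_itv (mulr_ge0 s0 (ler0n R n.+1)).
apply: (@measurable_fun_cvg _ _ _ _ (fun n z => Z (q n z.1) z.2)) => [n|[s w] [/=]].
- move=> mD A mA.
  pose I m : set R := `[m%:R / n.+1%:R, m.+1%:R / n.+1%:R[%classic.
  rewrite (_ : _ `&` _ = \bigcup_m (I m `*` (Z (m.+1%:R / n.+1%:R) @^-1` A))).
    apply: bigcup_measurable => m _; apply: measurableX => //.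
    - exact: measurable_itv.
    - rewrite -[X in measurable X]setTI.
      exact: (mZ (m.+1%:R / n.+1%:R) (divr_ge0 (ler0n _ _) (ler0n _ _)) measurableT A mA).
  apply/seteqP; split => [[s w] [[/=]]|[s w] [m _ [/=]]].
    rewrite in_itv/= andbT => s0 _ As; exists (Num.trunc (s * n.+1%:R)) => //; split => //=.
    rewrite /I /= in_itv/= ler_pdivrMr ?ltr0n// ltr_pdivlMr ?ltr0n//.
    exact: trunc_itv (mulr_ge0 s0 (ler0n R n.+1)).
  rewrite /I /= in_itv/= ler_pdivrMr ?ltr0n// ltr_pdivlMr ?ltr0n// => sm As.
  have tE : Num.trunc (s * n.+1%:R) = m by exact: truncn_def.
  split; last by rewrite /= /q tE.
  split => //=; rewrite in_itv/= andbT.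
  by rewrite -(@pmulr_lge0 _ n.+1%:R) ?ltr0n//; case/andP: sm => + _; apply: le_trans.
- rewrite in_itv/= andbT => s0 _.
  have qs : q n s @[n --> \oo] --> s^'+.
    move=> A [e /= e0 He].
    have /cvgrPdist_lt/(_ e e0)[N _ HN] := @cvg_harmonic R.
    exists N => // n /= /HN; rewrite sub0r normrN ger0_norm ?invr_ge0// => ne.
    apply: He; last exact: q_gt.
    rewrite /ball_/= distrC ger0_norm ?subr_ge0 ?(ltW (q_gt _ _ s0))//.
    by have := q_le n s s0; rewrite -lerBlDl => /le_lt_trans; apply.
  exact: cvg_comp _ _ qs (rZ w s s0).
Qed.

Lemma right_continuous_joint_measurable_itv (T : R) (Z : R -> Omega -> R) : 0 < T ->
  (forall t, 0 <= t <= T -> measurable_fun setT (Z t)) ->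
  (forall w t, 0 <= t < T -> Z u w @[u --> t^'+] --> Z t w) ->
  measurable_fun ((`[0, T]%classic : set (measurableTypeR R)) `*` [set: Omega])
    (fun z : measurableTypeR R * Omega => Z z.1 z.2).
Proof.
(* Freezing the process at [T] extends it to a right-continuous process on the half-line. *)
move=> T0 mZ rZ; pose Z' t := Z (Num.min t T).
have mZ' : measurable_fun ((`[0, +oo[%classic : set (measurableTypeR R)) `*` [set: Omega])
    (fun z : measurableTypeR R * Omega => Z' z.1 z.2).
  apply: right_continuous_joint_measurable => [t t0|w t t0].
    by apply: mZ; rewrite ge_min lexx orbT le_min t0 ltW.
  have [tT|Tt] := ltP t T.
    rewrite /Z' (min_idPl (ltW tT)).
    have : \forall u \near t^'+, Z u w = Z (Num.min u T) w.
      near=> u; rewrite (min_idPl _)//; near: u; exact: nbhs_right_le.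
    by move=> /near_eq_cvg /cvg_trans; apply; apply: rZ; rewrite t0.
  rewrite /Z' (min_idPr Tt).
  have : \forall u \near t^'+, Z T w = Z (Num.min u T) w.
    near=> u; rewrite (min_idPr _)//; apply: le_trans Tt _.
    by near: u; exact: nbhs_right_ge.
  by move=> /near_eq_cvg /cvg_trans; apply; exact: cvg_cst.
have : measurable_fun ((`[0, T]%classic : set (measurableTypeR R)) `*` [set: Omega])
    (fun z : measurableTypeR R * Omega => Z' z.1 z.2).
  apply: measurable_funS mZ'.
    by apply: measurableX => //; exact: measurable_itv.
  by move=> [s w] [/=]; rewrite !in_itv/= => /andP[->].
apply: eq_measurable_fun => -[s w]; rewrite inE => -[/=]; rewrite in_itv/= => /andP[_ sT] _.
by rewrite /Z' (min_idPl sT).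
Unshelve. all: by end_near. Qed.

End joint_measurability.
End processes.

(** * Fubini for weighted time integrals of centred processes *)

Section zero_mean.
Context {d : measure_display} {Omega : measurableType d} {R : realType}.
Notation leb := (@lebesgue_measure R).
Variables (P : probability Omega R) (T : R) (c : R -> R) (Z : R -> Omega -> R) (Mc B : R).
Hypotheses (T0 : 0 < T)
  (mZ : measurable_fun ((`[0, T]%classic : set (measurableTypeR R)) `*` [set: Omega])
    (fun z : measurableTypeR R * Omega => Z z.1 z.2))
  (mc : measurable_fun `[0, T] c) (cM : forall s, 0 <= s <= T -> `|c s| <= Mc)
  (ZB : forall s, 0 <= s <= T -> (\int[P]_w `|(Z s w)%:E| <= B%:E)%E)
  (mZs : forall s, 0 <= s <= T -> measurable_fun setT (Z s))
  (mZw : forall w, measurable_fun `[0, T] (Z ^~ w))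
  (Zw : forall w, exists b : R, forall s, 0 <= s <= T -> `|Z s w| <= b)
  (Z0 : forall s, 0 <= s <= T -> (\int[P]_w (Z s w)%:E = 0)%E).

Let D := (`[0, T]%classic : set (measurableTypeR R)) `*` [set: Omega].
Let g (z : measurableTypeR R * Omega) : \bar R := (c z.1 * Z z.1 z.2)%:E.
Let G := g \_ D.

Let mD : measurable D.
Proof. by apply: measurableX => //; exact: measurable_itv. Qed.

Let mG : measurable_fun setT G.
Proof.
apply: (measurable_restrictT g mD).1.
suff mcD : measurable_fun D (fun z : measurableTypeR R * Omega => c z.1).
  by apply/measurable_EFinP; exact: measurable_funM mcD mZ.
have H : measurable_fun setT (c \_ `[0, T]) by apply/(measurable_restrictT _ _).1.
have H' : measurable_fun D (fun z : measurableTypeR R * Omega => (c \_ `[0, T]) z.1).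
  by apply: measurable_funTS; apply: measurableT_comp; [exact: H|exact: measurable_fst].
apply: eq_measurable_fun H' => -[s w]; rewrite inE => -[/= sT _].
by rewrite patchE mem_set.
Qed.

Let GE s w : G (s, w) = if s \in `[0, T]%classic then (c s * Z s w)%:E else 0%E.
Proof.
rewrite /G patchE; case: (boolP (s \in _)) => [|] h.
  by rewrite mem_set//; split => //; exact: set_mem h.
by rewrite memNset//= => -[/= h' _]; move/negP: h; apply; exact: mem_set.
Qed.

Let G' (z : Omega * measurableTypeR R) : \bar R := G (z.2, z.1).

Let mG' : measurable_fun setT G'.
Proof.
have H : measurable_fun setT (fun z : Omega * measurableTypeR R => (z.2, z.1)).
  by apply: measurable_fun_pair; [exact: measurable_snd|exact: measurable_fst].
exact: measurableT_comp mG H.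
Qed.

Let GE' s w : G' (w, s) = if s \in `[0, T]%classic then (c s * Z s w)%:E else 0%E.
Proof. exact: GE. Qed.

Let iG : (P \x leb)%E.-integrable setT G'.
Proof.
apply: (@integrable21ltyP _ _ Omega (measurableTypeR R) R P leb G' mG').2.
have Mc0 : 0 <= Mc by apply: le_trans (normr_ge0 (c 0)) (cM _); rewrite lexx ltW.
apply: (@le_lt_trans _ _ (\int[leb]_s ((cst (Mc * B)%:E \_ `[0%R, T]) s))%E).
  apply: le_integral_ge0_nomeas => s _.
  rewrite integral_ge0//= patchE; case: (boolP (s \in _)) => h; last first.
    by rewrite integral0_eq// => w _; rewrite GE' (negbTE h) abse0.
  have sT : 0 <= s <= T by move: h; rewrite inE/= in_itv.
  apply: (@le_trans _ _ (\int[P]_w (Mc%:E * `|(Z s w)%:E|))%E).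
    apply: le_integral_ge0_nomeas => w _; rewrite abse_ge0/= GE' h.
    by rewrite EFinM abseM lee_wpmul2r// lee_fin cM.
  rewrite ge0_integralZl_EFin//.
    by rewrite EFinM lee_wpmul2l//; exact: ZB.
  by apply: measurableT_comp => //; apply/measurable_EFinP; exact: mZs.
rewrite -integral_mkcond integral_cst//= lebesgue_measure_itv/=.
by case: ifP; rewrite -?EFinB -?EFinM ltry.
Qed.

Let absE w : (\int[leb]_s `|G' (w, s)| = \int[leb]_(s in `[0%R, T]) `|(c s * Z s w)%:E|)%E.
Proof.
rewrite [RHS]integral_mkcond; apply: eq_integral => s _; rewrite GE' patchE.
by case: ifP => _ //; rewrite abse0.
Qed.

Lemma integral_time_abs_lty :
  (\int[P]_w \int[leb]_(s in `[0%R, T]) `|(c s * Z s w)%:E| < +oo)%E.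
Proof.
under eq_integral do rewrite -absE.
exact: (@integrable12ltyP _ _ Omega (measurableTypeR R) R P leb G' mG').1 iG.
Qed.

Lemma measurable_time_abs :
  measurable_fun setT (fun w => \int[leb]_(s in `[0%R, T]) `|(c s * Z s w)%:E|)%E.
Proof.
have mA : measurable_fun setT (abse \o G') by exact: measurableT_comp.
have := @measurable_fun_fubini_tonelli_F _ _ Omega (measurableTypeR R) R leb
  (abse \o G') mA (fun z => abse_ge0 _).
by congr (measurable_fun _ _); apply/funext => w; exact: absE.
Qed.

Let pathE w : (\int[leb]_s G' (w, s) = (\int[leb]_(s in `[0, T]) (c s * Z s w))%:E)%E.
Proof.
have [b Hb] := Zw w.
have ig : leb.-integrable `[0, T] (EFin \o (fun s => c s * Z s w)).
  apply: (@bounded_integrable_itv _ _ _ _ (Mc * b)); first exact: measurable_funM.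
  by move=> s sT; rewrite normrM ler_pM// ?cM ?Hb.
rewrite /Rintegral fineK; last exact: integrable_fin_num.
rewrite [RHS]integral_mkcond; apply: eq_integral => s _.
by rewrite GE' patchE.
Qed.

Lemma integrable_zero_mean :
  P.-integrable setT (fun w => (\int[leb]_(s in `[0, T]) (c s * Z s w))%:E).
Proof.
have := integrable_fubini_F iG; congr (integrable _ _ _).
by apply/funext => w; rewrite /fubini_F pathE.
Qed.

(** By Fubini each time contributes [c s * E (Z s) = 0]. Applied to the gap between a future
    integral and its conditional expectation, this does the work of a martingale argument. *)
Lemma integral_zero_mean :
  (\int[P]_w (\int[leb]_(s in `[0, T]) (c s * Z s w))%:E = 0)%E.
Proof.
under eq_integral do rewrite -pathE.
rewrite (Fubini iG) integral0_eq// => s _.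
case: (boolP (s \in `[0, T]%classic)) => h; last first.
  by rewrite integral0_eq// => w _; rewrite GE' (negbTE h).
have sT : 0 <= s <= T by move: h; rewrite inE/= in_itv.
transitivity (\int[P]_w ((c s)%:E * (Z s w)%:E))%E.
  by apply: eq_integral => w _; rewrite GE' h EFinM.
rewrite integralZl//; first by rewrite Z0// mule0.
apply/integrableP; split; first by apply/measurable_EFinP; exact: mZs.
by apply: le_lt_trans (ZB sT) _; rewrite ltry.
Qed.

End zero_mean.

(** * The generated filtration and its triviality at time 0 *)

Section filtrations.
Context {d : measure_display} {Omega : measurableType d} {R : realType}.
Variables (P : probability Omega R) (T lambda : R).
Variables (B : R -> Omega -> R) (N : R -> Omega -> nat).
Hypotheses (B_brownian : brownian_motion P T B)
  (N_poisson : poisson_process P T lambda N) (T0 : 0 < T).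

Lemma sigma_process_sub d' (S : measurableType d') (X : R -> Omega -> S) (I : set R)
    (H : set (set Omega)) : sigma_algebra setT H ->
  (forall s A, I s -> measurable A -> H (X s @^-1` A)) ->
  sigma_process X I `<=` H.
Proof.
move=> sH HX; apply: smallest_sub => // A [s Is [A' mA' <-]].
by rewrite setTI; exact: HX.
Qed.

Lemma filtration_sub t (H : set (set Omega)) : sigma_algebra setT H ->
  (forall s A, 0 <= s <= t -> measurable A -> H (B s @^-1` A)) ->
  (forall s A, 0 <= s <= t -> measurable A -> H (N s @^-1` A)) ->
  (forall A, measurable A -> P A = 0%E -> H A) ->
  filtration P B N t `<=` H.
Proof.
move=> sH HB HN H0; apply: smallest_sub => // A [[]|[]]; last exact: H0.
- by apply: sigma_process_sub => // s A'; rewrite /= in_itv/=; exact: HB.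
- by apply: sigma_process_sub => // s A'; rewrite /= in_itv/=; exact: HN.
Qed.

Lemma filtration_measurable t : 0 <= t <= T -> filtration P B N t `<=` measurable.
Proof.
move=> tT; apply: filtration_sub => [|s A sT mA|s A sT mA|//].
- exact: sigma_algebra_measurable.
- rewrite -[X in measurable X]setTI; apply: (brownian_measurable B_brownian) => //; lra.
- rewrite -[X in measurable X]setTI; apply: (poisson_measurable N_poisson) => //; lra.
Qed.

(** A countable union of trivial events has probability 1 as soon as one of them does, and is
    negligible otherwise. *)
Lemma sigma_algebra_trivial :
  sigma_algebra setT [set A | d.-measurable A /\ (P A = 0%E \/ P A = 1%E)].
Proof.
split => /=.
- by split => //; left; rewrite measure0.
- move=> A [mA PA]; rewrite setTD; split; first exact: measurableC.
  by rewrite probability_setC//; case: PA => ->; [right; rewrite sube0|left; rewrite subee].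
- move=> A HA; split; first by apply: bigcup_measurable => n _; have [] := HA n.
  have [[n An]|nA] := pselect (exists n, P (A n) = 1%E).
    right; apply/eqP; rewrite eq_le probability_le1/=; last first.
      by apply: bigcup_measurable => m _; have [] := HA m.
    rewrite -An; apply: le_measure; rewrite ?inE; last exact: bigcup_sup.
      by have [] := HA n.
    by apply: bigcup_measurable => m _; have [] := HA m.
  left; apply: measure_negligible.
    by apply: bigcup_measurable => m _; have [] := HA m.
  apply: negligible_bigcup => n; apply/negligibleP; first by have [] := HA n.
  by have [_ [//|An]] := HA n; case: nA; exists n.
Qed.

(** The generators are trivial: [B 0] is almost surely 0, [N 0] is identically 0, and the other
    generators are null. *)
Lemma filtration0_trivial A : filtration P B N 0 A -> P A = 0%E \/ P A = 1%E.
Proof.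
suff : filtration P B N 0 `<=` [set A | d.-measurable A /\ (P A = 0%E \/ P A = 1%E)].
  by move=> /[apply] -[].
apply: filtration_sub; first exact: sigma_algebra_trivial.
- move=> s A'; have [->|s0 /le_anti] := eqVneq s 0; last first.
    by move=> s0'; move: s0; rewrite -s0' eqxx.
  move=> _ mA'.
  have m0 : measurable (B 0 @^-1` A').
    rewrite -[X in measurable X]setTI; apply: (brownian_measurable B_brownian) => //.
    by rewrite lexx ltW.
  split => //=.
  have [N0 [mN PN NP]] := brownian0 B_brownian.
  have [A0|A0] := pselect (A' 0).
  - right; rewrite -(setCK (B 0 @^-1` A')) probability_setC; last exact: measurableC.
    rewrite (@subset_measure0 _ _ _ P _ N0) ?sube0//; first exact: measurableC.
    by move=> w /= Aw; apply: NP => /= B0; apply: Aw; rewrite B0.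
  - left; apply: (@subset_measure0 _ _ _ P _ N0) => //.
    by move=> w /= Aw; apply: NP => /= B0; move: Aw; rewrite B0.
- move=> s A'; have [->|s0 /le_anti] := eqVneq s 0; last first.
    by move=> s0'; move: s0; rewrite -s0' eqxx.
  move=> _ mA'.
  have E : N 0 = cst 0%N by apply/funext => w; exact: poisson0 N_poisson w.
  rewrite E preimage_cst; case: ifP => _ /=.
    by split => //; right; rewrite probability_setT.
  by split => //; left; rewrite measure0.
- by move=> A' mA' PA'; split => //; left.
Qed.

Lemma filtration_cst t (x : R) : measurable_wrt (filtration P B N t) (cst x).
Proof.
move=> A _; have [s0 sC _] := smallest_sigma_algebra setT
   (sigma_process B `[0, t] `|` sigma_process N `[0, t]
      `|` [set A | measurable A /\ P A = 0%E]).
rewrite preimage_cst; case: ifP => _; last exact: s0.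
by have := sC _ s0; rewrite setD0.
Qed.

End filtrations.

(** * The path of the constant plan *)

Section aggregator.
Context {R : realType}.
Notation leb := (@lebesgue_measure R).
Variables (T alpha : R) (f : R -> R -> R -> R).
Hypotheses (T0 : 0 < T) (f_borel : borel_aggregator T f) (f_A1 : A1 T f)
  (f_A2 : A2 T f) (alpha_itv : 0 < alpha < 1 / 2) (f_A3 : A3 T alpha f).

(** [f] is measurable on [domain T] only; the curve [phi], extended by 0 in its last two
    coordinates, is measurable on the line and maps [[0, T]] into that domain. *)
Lemma aggregator_measurable (y v : R -> R) : measurable_fun `[0, T] y ->
  measurable_fun `[0, T] v -> (forall s, 0 <= s <= T -> 0 <= y s) ->
  measurable_fun `[0, T] (fun s => f s (y s) (v s)).
Proof.
move=> my mv y0.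
pose phi s : R * R * R := (s, (y \_ `[0, T]) s, (v \_ `[0, T]) s).
have mphi : measurable_fun setT phi.
  apply: measurable_fun_pair; last by apply/(measurable_restrictT _ _).1.
  by apply: measurable_fun_pair => //; apply/(measurable_restrictT _ _).1.
have phiE s : 0 <= s <= T -> phi s = (s, y s, v s).
  by move=> sT; rewrite /phi !patchE mem_set//= in_itv.
have mdom : measurable (domain T).
  have -> : domain T = (`[0, T]%classic `*` `[0, +oo[%classic) `*` (@setT R).
    apply/seteqP; split => [[[s z] u]|[[s z] u]] /=; rewrite /domain /= !in_itv/= andbT.
      by case.
    by case=> -[].
  by apply: measurableX => //; apply: measurableX; exact: measurable_itv.
have : measurable_fun `[0, T] ((fun z : R * R * R => f z.1.1 z.1.2 z.2) \o phi).
  apply: (measurable_comp mdom) => //; last exact: measurable_funTS.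
  move=> z [s /=]; rewrite in_itv/= => sT <-; rewrite phiE//.
  by split => //=; exact: y0.
by apply: eq_measurable_fun => s sT; rewrite /= !patchE sT.
Qed.

Lemma powR_le_1D (x : R) : 0 <= x -> x `^ alpha <= 1 + x.
Proof.
move=> x0; have /andP[a0 a1] := alpha_itv.
have [x1|x1] := leP x 1.
  apply: (@le_trans _ _ 1); last by rewrite lerDl.
  have -> : 1 = 1 `^ alpha :> R by rewrite powR1.
  by apply: ge0_ler_powR; rewrite ?nnegrE// ltW.
apply: (@le_trans _ _ x); last by rewrite lerDr.
by rewrite -[leRHS]powRr1//; apply: ler_powR; lra.
Qed.

(** As the exponent is below 1, the power in [A3] is at most [1 + y]; moving [u] to 0 with [A2] then
    gives linear growth, with one positive constant for both bounds. *)
Lemma aggregator_growth : exists2 K : R, 0 < K &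
  (forall t y u u', 0 <= t <= T -> 0 <= y -> `|f t y u - f t y u'| <= K * `|u - u'|) /\
  (forall t y u, 0 <= t <= T -> 0 <= y -> `|f t y u| <= K * (2 + y + `|u|)).
Proof.
have [K2 H2] := f_A2; have [K3 H3] := f_A3.
pose K := 1 + `|K2| + `|K3|.
have K2K : K2 <= K by rewrite /K; have := ler_norm K2; have := normr_ge0 K3; lra.
have K3K : K3 <= K by rewrite /K; have := ler_norm K3; have := normr_ge0 K2; lra.
have K0 : 0 < K by rewrite /K; have := normr_ge0 K2; have := normr_ge0 K3; lra.
have lip t y u u' : 0 <= t <= T -> 0 <= y -> `|f t y u - f t y u'| <= K * `|u - u'|.
  by move=> tT y0; apply: le_trans (H2 _ _ _ _ tT y0) _; rewrite ler_wpM2r.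
exists K => //; split => // t y u tT y0.
rewrite -[f t y u](subrK (f t y 0)); apply: le_trans (ler_normD _ _) _.
have h1 : `|f t y u - f t y 0| <= K * `|u| by rewrite -{2}[u]subr0; exact: lip.
have h2 : `|f t y 0| <= K * (2 + y).
  apply: le_trans (H3 _ _ tT y0) _; rewrite ger0_norm//.
  have yp : 0 <= 1 + y `^ alpha by rewrite addr_ge0// powR_ge0.
  apply: (@le_trans _ _ (K * (1 + y `^ alpha))); first by rewrite ler_wpM2r.
  by rewrite ler_wpM2l ?(ltW K0)//; have := powR_le_1D y0; lra.
by rewrite mulrDr addrC lerD.
Qed.

Lemma aggregator_Du (t y u : R) : 0 <= t <= T -> 0 <= y ->
  is_derive u (1 : R) (f t y) (Du f t y u).
Proof.
move=> /f_A1[_ [dF _ _] _] y0; have [_ du] := dF y u y0.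
exact: is_derive_derive1.
Qed.

Lemma aggregator_Dy (t y u : R) : 0 <= t <= T -> 0 < y ->
  is_derive y (1 : R) (fun z => f t z u) (Dy f t y u).
Proof.
move=> /f_A1[_ [dF _ _] _] y0; have [dy _] := dF y u (ltW y0).
apply: derivable_within_is_derive; last exact: dy.
apply: (@filterS _ _ _ `]0, y + 1[).
  by move=> r /=; rewrite !in_itv/= andbT => /andP[/ltW].
by apply: near_in_itvoo; rewrite in_itv/= y0 ltrDl/=.
Qed.

Lemma aggregator_Dy_ge0 (t y u : R) : 0 <= t <= T -> 0 < y -> 0 <= Dy f t y u.
Proof.
move=> tT y0; have H := is_derive_cvg_harmonic (aggregator_Dy u tT y0).
rewrite -(cvg_lim _ H)//; apply: limr_ge; first by apply/cvg_ex; eexists; exact: H.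
apply: nearW => n; rewrite mulr_ge0// subr_ge0 ltW//.
have [_ _ inc] := f_A1 tT; apply: inc; first exact: ltW.
by rewrite ltrDl invr_gt0.
Qed.

Lemma aggregator_Du_bound (t y u K : R) : 0 <= t <= T -> 0 <= y ->
  (forall v v', `|f t y v - f t y v'| <= K * `|v - v'|) -> `|Du f t y u| <= K.
Proof.
move=> tT y0 lip; have H := is_derive_cvg_harmonic (aggregator_Du u tT y0).
have H' : `|n.+1%:R * (f t y (u + n.+1%:R^-1) - f t y u)| @[n --> \oo] --> `|Du f t y u|.
  exact: cvg_norm.
rewrite -(cvg_lim _ H')//; apply: limr_le; first by apply/cvg_ex; eexists; exact: H'.
apply: nearW => n; rewrite normrM ger0_norm// -ler_pdivlMl ?ltr0n//.
apply: le_trans (lip _ _) _.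
by rewrite addrAC subrr add0r ger0_norm ?invr_ge0// mulrC.
Qed.

Section path.
Variables (beta y0 : R).
Hypotheses (beta0 : 0 < beta) (y0_gt0 : 0 < y0).

(** For [y0 = eta + beta * wealth], the satisfaction of the plan consuming everything at time 0; it
    solves [Y' = - beta Y]. *)
Definition decay_path (s : R) : R := y0 * expR (- (beta * s)).
Notation Y := decay_path.

Lemma decay_path_gt0 s : 0 < Y s.
Proof. by rewrite mulr_gt0// expR_gt0. Qed.

Lemma decay_path_le s : 0 <= s -> Y s <= y0.
Proof.
by move=> s0; rewrite ger_pMr// -expR0 ler_expR oppr_le0 mulr_ge0// (ltW beta0).
Qed.

Lemma decay_path_ge s : s <= T -> y0 * expR (- (beta * T)) <= Y s.
Proof. by move=> sT; rewrite ler_pM2l// ler_expR lerN2 ler_pM2l. Qed.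

Lemma is_derive_decay_path s : is_derive s (1 : R) Y (- (beta * Y s)).
Proof. by apply: is_derive_eq; rewrite /decay_path -![_ *: _]/(_ * _); ring. Qed.

Lemma measurable_decay_path D : measurable D -> measurable_fun D Y.
Proof.
move=> mD; apply: measurable_funTS; apply: measurable_funM => //.
apply: measurableT_comp => //; apply: measurableT_comp => //.
Qed.

Lemma deterministic_utility : exists U : R -> R, [/\ measurable_fun `[0, T] U,
  exists B : R, forall t : R, 0 <= t <= T -> `|U t| <= B &
  forall t : R, 0 <= t <= T -> U t = \int[leb]_(s in `[t, T]) f s (Y s) (U s)].
Proof.
have [K K0 [lip gr]] := aggregator_growth.
apply: (@backward_ode _ T K (K * (2 + y0)) (fun s u => f s (Y s) u)) => //.
- move=> v mv; apply: aggregator_measurable => //; first exact: measurable_decay_path.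
  by move=> s _; rewrite ltW// decay_path_gt0.
- by move=> s u u' sT; apply: lip => //; rewrite ltW// decay_path_gt0.
- move=> s sT; apply: le_trans (gr _ _ _ sT _) _; first by rewrite ltW// decay_path_gt0.
  rewrite normr0 addr0 ler_pM2l// lerD2l decay_path_le//; by case/andP: sT.
Qed.

Variable U : R -> R.
Hypotheses (mU : measurable_fun `[0, T] U)
  (Ubd : exists B : R, forall t : R, 0 <= t <= T -> `|U t| <= B)
  (UE : forall t : R, 0 <= t <= T -> U t = \int[leb]_(s in `[t, T]) f s (Y s) (U s)).

(** Of these three functions, [path_a] is the rate that builds the discount factor, and [path_b] the
    marginal utility of satisfaction that prices a change of plan. *)
Definition path_f s := f s (Y s) (U s).
Definition path_a s := Du f s (Y s) (U s).
Definition path_b s := Dy f s (Y s) (U s).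

Let Y0 s : 0 <= Y s. Proof. exact/ltW/decay_path_gt0. Qed.
Let mY D : measurable D -> measurable_fun D Y. Proof. exact: measurable_decay_path. Qed.

Lemma measurable_path_f : measurable_fun `[0, T] path_f.
Proof. by apply: aggregator_measurable => //; exact: mY. Qed.

Lemma path_f_bound : exists M : R, forall s, 0 <= s <= T -> `|path_f s| <= M.
Proof.
have [B UB] := Ubd; have [K K0 [_ gr]] := aggregator_growth.
exists (K * (2 + y0 + B)) => s sT; apply: le_trans (gr _ _ _ sT (Y0 s)) _.
rewrite ler_pM2l// lerD ?UB// lerD2l decay_path_le//; by case/andP: sT.
Qed.

(** Smoothness of [f] at fixed times says nothing about measurability in time; the derivative is
    instead a limit of difference quotients of the Borel function [f]. *)
Lemma measurable_path_a : measurable_fun `[0, T] path_a.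
Proof.
apply: (@measurable_fun_cvg _ _ _ _ (fun n s => n.+1%:R *
    (f s (Y s) (U s + n.+1%:R^-1) - f s (Y s) (U s)))) => [n|s].
  apply: measurable_funM => //; apply: measurable_funB; last exact: measurable_path_f.
  by apply: aggregator_measurable => //; [exact: mY|exact: measurable_funD].
rewrite /= in_itv/= => sT; apply: is_derive_cvg_harmonic; exact: aggregator_Du.
Qed.

Lemma path_a_bound : exists M : R, forall s, 0 <= s <= T -> `|path_a s| <= M.
Proof.
have [K K0 [lip _]] := aggregator_growth; exists K => s sT.
by apply: aggregator_Du_bound => // v v'; exact: lip.
Qed.

Lemma measurable_path_b : measurable_fun `[0, T] path_b.
Proof.
apply: (@measurable_fun_cvg _ _ _ _ (fun n s => n.+1%:R *
    (f s (Y s + n.+1%:R^-1) (U s) - f s (Y s) (U s)))) => [n|s].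
  apply: measurable_funM => //; apply: measurable_funB; last exact: measurable_path_f.
  apply: aggregator_measurable => //; first by apply: measurable_funD => //; exact: mY.
  by move=> s _; rewrite addr_ge0.
rewrite /= in_itv/= => sT.
exact: (is_derive_cvg_harmonic (aggregator_Dy (U s) sT (decay_path_gt0 s))).
Qed.

Lemma path_b_ge0 s : 0 <= s <= T -> 0 <= path_b s.
Proof. by move=> sT; apply: aggregator_Dy_ge0 => //; exact: decay_path_gt0. Qed.

(* Concavity bounds the slope at Y by the slope of the chord from 0 to Y. *)
Lemma path_b_bound : exists M : R, forall s, 0 <= s <= T -> path_b s <= M.
Proof.
have [M HM] := path_f_bound; have [B UB] := Ubd.
have [K K0 [_ gr]] := aggregator_growth.
exists ((M + K * (2 + 0 + B)) / (y0 * expR (- (beta * T)))) => s sT.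
have m0 : 0 < y0 * expR (- (beta * T)) by rewrite mulr_gt0// expR_gt0.
rewrite ler_pdivlMr//; have /andP[s0 sT'] := sT.
apply: (@le_trans _ _ (path_b s * Y s)).
  by rewrite ler_wpM2l ?path_b_ge0// decay_path_ge.
have := A1_tangent (U s) (U s) f_A1 sT (decay_path_gt0 s) (lexx 0).
rewrite subrr mulr0 addr0 sub0r mulrN -/(path_b s) -/(path_f s) => H.
have h1 := le_trans (ler_norm _) (HM s sT).
have h2 : - f s 0 (U s) <= K * (2 + 0 + B).
  apply: le_trans (ler_norm _) _; rewrite normrN.
  apply: le_trans (gr _ _ _ sT (lexx 0)) _.
  by rewrite ler_pM2l// lerD2l UB.
by lra.
Qed.

End path.
End aggregator.

(** * Monotonicity of the discounted marginal utility along the path *)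

Section weight.
Context {R : realType}.
Notation leb := (@lebesgue_measure R).

Lemma expR_lipschitz (M x y : R) : x <= M -> y <= M ->
  `|expR x - expR y| <= expR M * `|x - y|.
Proof.
move=> xM yM.
have H z : Num.min x y <= z <= M ->
    is_derive z (1 : R) expR (expR z) /\ `|expR z - 0| <= expR M.
  move=> /andP[_ zM]; split; first exact: is_derive_expR.
  by rewrite subr0 ger0_norm ?expR_ge0// ler_expR.
have := mvt_increment_bound (x := y) (y := x) H.
by rewrite !ge_min !lexx orbT xM yM mul0r subr0; apply.
Qed.

Lemma lipschitz_mul (g h : R -> R) (a b Lg Lh Mg Mh : R) :
  (forall x, a <= x <= b -> `|g x| <= Mg) ->
  (forall x, a <= x <= b -> `|h x| <= Mh) ->
  (forall x y, a <= x <= b -> a <= y <= b -> `|g x - g y| <= Lg * `|x - y|) ->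
  (forall x y, a <= x <= b -> a <= y <= b -> `|h x - h y| <= Lh * `|x - y|) ->
  forall x y, a <= x <= b -> a <= y <= b ->
    `|g x * h x - g y * h y| <= (Mg * Lh + Mh * Lg) * `|x - y|.
Proof.
move=> gM hM gL hL x y xab yab.
have -> : g x * h x - g y * h y = g x * (h x - h y) + h y * (g x - g y) by ring.
rewrite mulrDl; apply: le_trans (ler_normD _ _) _.
by rewrite !normrM -!mulrA lerD// ler_pM// ?gM ?hM ?gL ?hL.
Qed.

Variables (T alpha : R) (f : R -> R -> R -> R).
Hypotheses (T0 : 0 < T) (f_borel : borel_aggregator T f) (f_A1 : A1 T f)
  (f_A2 : A2 T f) (alpha_itv : 0 < alpha < 1 / 2) (f_A3 : A3 T alpha f).
Variables (beta y0 : R).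
Hypotheses (beta0 : 0 < beta) (y0_gt0 : 0 < y0).
Notation Y := (decay_path beta y0).
Variable U : R -> R.
Hypotheses (mU : measurable_fun `[0, T] U)
  (Ubd : exists B : R, forall t : R, 0 <= t <= T -> `|U t| <= B)
  (UE : forall t : R, 0 <= t <= T -> U t = \int[leb]_(s in `[t, T]) f s (Y s) (U s)).
Notation F := (path_f f beta y0 U).
Notation a := (path_a f beta y0 U).
Notation b := (path_b f beta y0 U).

Let mF : measurable_fun `[0, T] F. Proof. by apply: measurable_path_f. Qed.
Let ma : measurable_fun `[0, T] a. Proof. by apply: measurable_path_a. Qed.

Let FB : exists M : R, forall s, 0 <= s <= T -> `|F s| <= M.
Proof. by apply: path_f_bound; try eassumption. Qed.
Let aB : exists M : R, forall s, 0 <= s <= T -> `|a s| <= M.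
Proof. by apply: path_a_bound; try eassumption. Qed.
Let bB : exists M : R, forall s, 0 <= s <= T -> b s <= M.
Proof. by apply: path_b_bound; try eassumption. Qed.

Let A (s : R) : R := \int[leb]_(v in `[0, s]) a v.

Lemma utility_primitive t : 0 <= t <= T -> U t = U 0 - \int[leb]_(s in `[0, t]) F s.
Proof.
move=> /andP[t0 tT]; have [M FM] := FB.
rewrite UE ?t0// (UE (t := 0)) ?lexx ?(ltW T0)//.
by rewrite (@Rintegral_itv_split _ 0 T M F mF FM 0 t T)// addrAC subrr add0r.
Qed.

Variables (r lambda theta rho : R).
Hypotheses (Dyf_C1 : C1_tyu T (Dy f))
  (Lf_le0 : forall t y u : R, 0 <= t <= T -> 0 <= y ->
     Lop T r lambda theta beta f t y u <= 0).
Hypothesis rhoE : rho = r + lambda * (expR theta - 1).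

(** The partial derivatives of [Dy f] are bounded on the compact box of times in [[s1, s2]],
    satisfactions in [[y0 e^(-beta T), y0]] and utilities in [[-MU, MU]], which contains the path,
    and the path itself is Lipschitz. *)
Lemma path_b_lipschitz s1 s2 : 0 < s1 -> s2 < T -> exists L : R, forall x y,
  s1 <= x <= s2 -> s1 <= y <= s2 -> `|b x - b y| <= L * `|x - y|.
Proof.
move=> s10 s2T; have [MF FM] := FB.
have [MU UM] := Ubd.
have m0 : 0 < y0 * expR (- (beta * T)) by rewrite mulr_gt0// expR_gt0.
have [dG cT cY cU] := Dyf_C1.
have sub (t y u : R) : s1 <= t <= s2 -> y0 * expR (- (beta * T)) <= y <= y0 ->
    - MU <= u <= MU -> domain T (t, y, u).
  by move=> ht hy _; split => /=; [lra|lra].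
have [M1 H1] := continuous_box_bounded cT sub.
have [M2 H2] := continuous_box_bounded cY sub.
have [M3 H3] := continuous_box_bounded cU sub.
pose M := `|M1| + `|M2| + `|M3|.
have MM1 : M1 <= M by rewrite /M -addrA ler_wpDr ?ler_norm// addr_ge0.
have MM2 : M2 <= M by rewrite /M addrAC ler_wpDl ?ler_norm// addr_ge0.
have MM3 : M3 <= M by rewrite /M ler_wpDl ?ler_norm// addr_ge0.
have box s z v : s1 <= s <= s2 -> y0 * expR (- (beta * T)) <= z <= y0 -> - MU <= v <= MU ->
    has_partials (Dy f) (Dt T (Dy f)) (Dy (Dy f)) (Du (Dy f)) s z v /\
    [/\ `|Dt T (Dy f) s z v - 0| <= M, `|Dy (Dy f) s z v - 0| <= M &
        `|Du (Dy f) s z v - 0| <= M].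
  move=> hs hz hv; split.
    have [||e e0 H] := C1_tyu_at (t := s) (y := z) v Dyf_C1 _ _ ltr01.
    - by lra.
    - by lra.
    - have [] // := H s z v.
      + by lra.
      + by lra.
      + by lra.
  split; rewrite subr0.
  - exact: le_trans (H1 _ _ _ hs hz hv) MM1.
  - exact: le_trans (H2 _ _ _ hs hz hv) MM2.
  - exact: le_trans (H3 _ _ _ hs hz hv) MM3.
(* Lipschitz constants of the three coordinates of the path: 1 for time, [beta * y0] for [Y], [MF]
   for [U]. *)
exists (M * (1 + beta * y0 + MF)) => x y hx hy.
have xT : 0 <= x <= T by lra.
have yT : 0 <= y <= T by lra.
have inY s : 0 <= s <= T -> y0 * expR (- (beta * T)) <= Y s <= y0.
  by move=> /andP[s0 sT]; rewrite decay_path_ge// decay_path_le.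
have inU s : 0 <= s <= T -> - MU <= U s <= MU by move=> sT; rewrite -ler_norml UM.
have := box_increment_bound box hy (inY _ yT) (inU _ yT) hx (inY _ xT) (inU _ xT).
rewrite !mul0r !addr0 subr0 => /le_trans; apply.
have M0 : 0 <= M by rewrite /M !addr_ge0.
rewrite -mulrA ler_wpM2l// !mulrDl mul1r !lerD//.
- have H s : 0 <= s <= T -> is_derive s (1 : R) Y (- (beta * Y s)) /\
      `|- (beta * Y s) - 0| <= beta * y0.
    move=> sT; split; first exact: is_derive_decay_path.
    rewrite subr0 normrN ger0_norm; last by rewrite mulr_ge0 ?ltW// decay_path_gt0.
    by rewrite ler_wpM2l ?(ltW beta0)//; have /andP[] := inY _ sT.
  by have := mvt_increment_bound H yT xT; rewrite mul0r subr0.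
- rewrite (utility_primitive xT) (utility_primitive yT).
  have E (p q s : R) : p - q - (p - s) = s - q by ring.
  by rewrite E distrC; exact: (primitive_lipschitz mF FM).
Qed.

(** Merging the two exponentials gives a product of Lipschitz functions on [[s1, s2]]. At almost
    every time the primitives of [a] and [F] are both differentiable, and there the chain rule
    identifies the derivative. *)
Lemma weight_nonincreasing s1 s2 : 0 < s1 -> s1 <= s2 -> s2 < T ->
  expR (A s2) * b s2 * expR (rho * s2) <= expR (A s1) * b s1 * expR (rho * s1).
Proof.
move=> s10; rewrite le_eqVlt => /predU1P[->//|s12] s2T.
have hE s : expR (A s) * b s * expR (rho * s) = expR (A s + rho * s) * b s.
  by rewrite expRD; ring.
rewrite !hE.
have [MF FM] := FB.
have [Ma aM] := aB.
have [Mb bM] := bB.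
have [Lb bL] := path_b_lipschitz s10 s2T.
have sT x : s1 <= x <= s2 -> 0 <= x <= T by move=> hx; lra.
have Ma0 : 0 <= Ma.
  by apply: le_trans (normr_ge0 _) (aM 0 _); rewrite lexx ltW.
pose g s := A s + rho * s.
have gL x y : s1 <= x <= s2 -> s1 <= y <= s2 -> `|g x - g y| <= (Ma + `|rho|) * `|x - y|.
  move=> hx hy; have -> : g x - g y = (A x - A y) + rho * (x - y) by rewrite /g; ring.
  rewrite mulrDl; apply: le_trans (ler_normD _ _) _; rewrite normrM lerD//.
  by apply: (primitive_lipschitz ma aM); exact: sT.
pose Mg := `|g s1| + (Ma + `|rho|) * (s2 - s1).
have gM x : s1 <= x <= s2 -> g x <= Mg.
  move=> hx; rewrite -(subrK (g s1) (g x)) addrC lerD ?ler_norm//.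
  apply: le_trans (ler_norm _) _; apply: le_trans (gL _ _ hx _) _.
    by rewrite lexx ltW.
  by rewrite ler_wpM2l ?addr_ge0// ger0_norm; lra.
have eL x y : s1 <= x <= s2 -> s1 <= y <= s2 ->
    `|expR (g x) - expR (g y)| <= expR Mg * (Ma + `|rho|) * `|x - y|.
  move=> hx hy; apply: le_trans (expR_lipschitz (gM _ hx) (gM _ hy)) _.
  by rewrite -mulrA ler_wpM2l ?expR_ge0//; exact: gL.
apply: (lipschitz_ae_nonincreasing (h := fun s => expR (g s) * b s) s12).
  apply: (lipschitz_mul (Mg := expR Mg) (Mh := Mb) _ _ eL bL) => x hx.
    by rewrite ger0_norm ?expR_ge0// ler_expR gM.
  rewrite ger0_norm ?bM// ?sT//.
  by apply: path_b_ge0; [exact: f_A1|exact: y0_gt0|exact: sT].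
have aeA := ae_derive_primitive ma aM.
have aeF := ae_derive_primitive mF FM.
have Fae : Filter (nbhs (almost_everywhere leb)) by exact: (ae_filter_ringOfSetsType leb).
move: aeF; apply: filterS2 aeA => x dA dF /andP[x1 x2].
have xT : 0 < x < T by lra.
have {}dA : is_derive x (1 : R) A (a x) := dA xT.
have {}dF := dF xT.
have dU : is_derive x (1 : R) U (- F x).
  have : is_derive x (1 : R) (fun t => U 0 - \int[leb]_(s in `[0, t]) F s) (- F x).
    by rewrite -[X in is_derive _ _ _ X]add0r; apply: is_deriveB.
  apply: near_eq_is_derive.
  have : \forall t \near x, t \in `]0, T[ by apply: near_in_itvoo; rewrite in_itv.
  apply: filterS => t; rewrite in_itv/= => /andP[t0 tT].
  by rewrite -utility_primitive// !ltW.
have dY := is_derive_decay_path beta y0 x.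
have db := C1_at_chain (C1_tyu_at (U x) Dyf_C1 xT (decay_path_gt0 beta y0_gt0 x)) dY dU.
have dg : is_derive x (1 : R) g (a x + rho).
  have dr : is_derive x (1 : R) (fun s => rho * s) rho.
    by apply: is_derive_eq; rewrite -[_ *: _]/(_ * _) mulr1.
  exact: is_deriveD dA dr.
have de : is_derive x (1 : R) (fun s => expR (g s)) (expR (g x) * (a x + rho)).
  exact: is_derive1_comp.
have [dh dhE] := is_deriveM de db.
split; first exact: dh.
rewrite derive1E.
(* The exponential contributes [(a + rho) b] and the chain rule the other three terms of [Lop], with
   [Y' = - beta Y] and [U' = - F]. *)
have -> : 'D_1 (fun s => expR (g s) * b s) x =
    expR (g x) * Lop T r lambda theta beta f x (Y x) (U x).
  apply: eq_trans dhE _; rewrite -![_ *: _]/(_ * _) /Lop rhoE /a /F.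
  ring.
apply: mulr_ge0_le0; first exact: expR_ge0.
by apply: Lf_le0; [apply: sT; rewrite !ltW|rewrite ltW// decay_path_gt0].
Qed.

End weight.

(** * Discounting a backward integral *)

Section discounting.
Context {R : realType}.
Notation leb := (@lebesgue_measure R).

Lemma lipschitz_ae_constant (a b L : R) (h : R -> R) : a < b ->
  (forall x y, a <= x <= b -> a <= y <= b -> `|h x - h y| <= L * `|x - y|) ->
  {ae leb, forall x, a < x < b -> is_derive x (1 : R) h 0} ->
  h b = h a.
Proof.
move=> ab hL h0; apply/eqP; rewrite eq_le; apply/andP; split.
  apply: (lipschitz_ae_nonincreasing ab hL); move: h0.
  apply: filterS; first exact: (ae_filter_ringOfSetsType leb).
  by move=> x /[apply] -[dh]; rewrite derive1E => ->.
rewrite -lerN2; apply: (@lipschitz_ae_nonincreasing _ a b L (fun x => - h x) ab).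
  by move=> x y xab yab; rewrite -opprD normrN; exact: hL.
move: h0; apply: filterS; first exact: (ae_filter_ringOfSetsType leb).
move=> x /[apply] dh; have [] := is_deriveN dh.
move=> d E; split; first exact: d.
by rewrite derive1E (_ : 'D_1 _ x = 0)// -[RHS]oppr0; exact: E.
Qed.

Lemma measurable_primitive (a b M : R) (g : R -> R) : a < b ->
  measurable_fun `[a, b] g -> (forall x, a <= x <= b -> `|g x| <= M) ->
  measurable_fun `[a, b] (fun t => \int[leb]_(s in `[a, t]) g s).
Proof.
move=> ab mg gM; apply: (subspace_continuous_measurable_fun (measurable_itv _)).
apply: (@parameterized_integral_continuous _ a b g (ltW ab)).
exact: bounded_integrable_itv gM.
Qed.

Variables (T Ma Mp : R) (a p : R -> R).
Hypotheses (T0 : 0 < T) (ma : measurable_fun `[0, T] a) (mp : measurable_fun `[0, T] p)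
  (aM : forall s, 0 <= s <= T -> `|a s| <= Ma)
  (pM : forall s, 0 <= s <= T -> `|p s| <= Mp).

(** The rate [a] will be the one of the candidate path throughout, while [p] will be the aggregator
    along the candidate path and also along each path of a competing plan. *)
Definition discount (s : R) : R := expR (\int[leb]_(v in `[0, s]) a v).
Definition tail_integral (s : R) : R := \int[leb]_(v in `[s, T]) p v.

Lemma measurable_discount : measurable_fun `[0, T] discount.
Proof.
by apply: measurableT_comp => //; exact: measurable_primitive T0 ma aM.
Qed.

Lemma discount_bound s : 0 <= s <= T -> `|discount s| <= expR (Ma * T).
Proof.
move=> /andP[s0 sT]; rewrite ger0_norm ?expR_ge0// ler_expR.
apply: le_trans (ler_norm _) _.
apply: le_trans (Rintegral_itv_bound ma aM _ _ _) _ => //.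
rewrite subr0 ler_wpM2l//.
by apply: le_trans (normr_ge0 _) (aM (s := 0) _); rewrite lexx ltW.
Qed.

Lemma discount_lipschitz x y : 0 <= x <= T -> 0 <= y <= T ->
  `|discount x - discount y| <= expR (Ma * T) * Ma * `|x - y|.
Proof.
have H z : 0 <= z <= T -> \int[leb]_(v in `[0, z]) a v <= Ma * T.
  by move=> zT; have := discount_bound zT; rewrite ger0_norm ?expR_ge0// ler_expR.
move=> xT yT; apply: le_trans (expR_lipschitz (H x xT) (H y yT)) _.
by rewrite -mulrA ler_wpM2l ?expR_ge0//; exact: (primitive_lipschitz ma aM).
Qed.

Lemma tail_integralE t : 0 <= t <= T ->
  tail_integral t = tail_integral 0 - \int[leb]_(s in `[0, t]) p s.
Proof.
move=> /andP[t0 tT]; rewrite /tail_integral.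
by rewrite (@Rintegral_itv_split _ 0 T Mp p mp pM 0 t T)// addrAC subrr add0r.
Qed.

Lemma tail_integral_lipschitz x y : 0 <= x <= T -> 0 <= y <= T ->
  `|tail_integral x - tail_integral y| <= Mp * `|x - y|.
Proof.
move=> xT yT; rewrite (tail_integralE xT) (tail_integralE yT).
have E (u v s : R) : u - v - (u - s) = s - v by ring.
by rewrite E distrC; exact: (primitive_lipschitz mp pM).
Qed.

Lemma tail_integral_bound s : 0 <= s <= T -> `|tail_integral s| <= Mp * T.
Proof.
move=> /andP[s0 sT]; apply: le_trans (Rintegral_itv_bound mp pM _ _ _) _ => //.
rewrite ler_wpM2l//; last lra.
by apply: le_trans (normr_ge0 _) (pM (s := 0) _); rewrite lexx ltW.
Qed.

Lemma measurable_tail_integral : measurable_fun `[0, T] tail_integral.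
Proof. by apply: backward_measurable; eassumption. Qed.

(* Integration by parts: both sides agree because t |-> discount t * tail_integral t
   + \int_0^t (discount * p - discount * a * tail_integral) has derivative 0 a.e. *)
Lemma discounted_tail_integral :
  \int[leb]_(s in `[0, T]) (discount s * p s) =
  tail_integral 0 + \int[leb]_(s in `[0, T]) (discount s * a s * tail_integral s).
Proof.
have Mp0 : 0 <= Mp by apply: le_trans (normr_ge0 _) (pM (s := 0) _); rewrite lexx ltW.
have Ma0 : 0 <= Ma by apply: le_trans (normr_ge0 _) (aM (s := 0) _); rewrite lexx ltW.
have e0 : 0 <= expR (Ma * T) by exact: expR_ge0.
have m1 : measurable_fun `[0, T] (fun s => discount s * p s).
  by apply: measurable_funM => //; exact: measurable_discount.
have m2 : measurable_fun `[0, T] (fun s => discount s * a s * tail_integral s).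
  apply: measurable_funM; last exact: measurable_tail_integral.
  by apply: measurable_funM => //; exact: measurable_discount.
have b1 s : 0 <= s <= T -> `|discount s * p s| <= expR (Ma * T) * Mp.
  by move=> sT; rewrite normrM ler_pM ?discount_bound ?pM.
have b2 s : 0 <= s <= T -> `|discount s * a s * tail_integral s| <=
    expR (Ma * T) * Ma * (Mp * T).
  move=> sT; rewrite normrM ler_pM ?tail_integral_bound//.
  by rewrite normrM ler_pM ?discount_bound ?aM.
pose P1 t := \int[leb]_(s in `[0, t]) (discount s * p s).
pose P2 t := \int[leb]_(s in `[0, t]) (discount s * a s * tail_integral s).
pose q t := discount t * tail_integral t + (P1 t - P2 t).
have qTT : q T = q 0.
  apply: (lipschitz_ae_constant (L := (expR (Ma * T) * Mp + Mp * T * (expR (Ma * T) * Ma))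
      + (expR (Ma * T) * Mp + expR (Ma * T) * Ma * (Mp * T))) T0).
    move=> x y xT yT.
    have E (x1 x2 x3 y1 y2 y3 : R) : x1 + (x2 - x3) - (y1 + (y2 - y3)) =
      (x1 - y1) + ((x2 - y2) - (x3 - y3)) by ring.
    rewrite /q E.
    rewrite mulrDl; apply: le_trans (ler_normD _ _) _; rewrite lerD//.
      exact: (lipschitz_mul discount_bound tail_integral_bound discount_lipschitz
        tail_integral_lipschitz).
    rewrite mulrDl; apply: le_trans (ler_normB _ _) _; rewrite lerD//.
      exact: (primitive_lipschitz m1 b1).
    exact: (primitive_lipschitz m2 b2).
  have ae_a := ae_derive_primitive ma aM.
  have ae_p := ae_derive_primitive mp pM.
  have ae_1 := ae_derive_primitive m1 b1.
  have ae_2 := ae_derive_primitive m2 b2.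
  have Fae : Filter (nbhs (almost_everywhere leb)) by exact: (ae_filter_ringOfSetsType leb).
  apply: (@filterS _ (nbhs (almost_everywhere leb)) Fae _ _ _
    (filterI (filterI ae_a ae_p) (filterI ae_1 ae_2))) => x [[da dp] [d1 d2]] xT.
  have {}da := da xT; have {}dp := dp xT; have {}d1 := d1 xT; have {}d2 := d2 xT.
  have dT : is_derive x (1 : R) tail_integral (- p x).
    have : is_derive x (1 : R)
        (fun t => tail_integral 0 - \int[leb]_(s in `[0, t]) p s) (- p x).
      by rewrite -[X in is_derive _ _ _ X]add0r; apply: is_deriveB.
    apply: near_eq_is_derive.
    have : \forall t \near x, t \in `]0, T[ by apply: near_in_itvoo; rewrite in_itv.
    apply: filterS => t; rewrite in_itv/= => /andP[t0 tT].
    by rewrite -tail_integralE// !ltW.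
  have dD : is_derive x (1 : R) discount (discount x * a x) by exact: is_derive1_comp.
  have H := is_deriveD (is_deriveM dD dT) (is_deriveB d1 d2).
  apply: (is_derive_eq H); rewrite -![_ *: _]/(_ * _); ring.
have tT : tail_integral T = 0 by rewrite /tail_integral set_itv1 Rintegral_set1.
have d0 : discount 0 = 1 by rewrite /discount set_itv1 Rintegral_set1 expR0.
have P10 : P1 0 = 0 by rewrite /P1 set_itv1 Rintegral_set1.
have P20 : P2 0 = 0 by rewrite /P2 set_itv1 Rintegral_set1.
move: qTT; rewrite /q tT d0 P10 P20 mulr0 add0r mul1r subrr addr0 => /eqP.
by rewrite subr_eq => /eqP.
Qed.

End discounting.

(** * From pathwise bounds to expectations and back *)

Section expectation.
Context {d : measure_display} {Omega : measurableType d} {R : realType}.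
Variables (P : probability Omega R).

(** [X] is not known to be measurable, so the factor [c] is not pulled out of its integral. The
    measurable positive part of [M], divided by [c], is compared with [X] instead. *)
Lemma expectation_budget (M : Omega -> R) (X : Omega -> \bar R) (c w : R) :
  P.-integrable setT (EFin \o M) -> 0 <= c -> (forall x, 0 <= X x)%E ->
  (forall x, (M x)%:E <= c%:E * X x)%E -> (\int[P]_x X x <= w%:E)%E ->
  (\int[P]_x (M x)%:E <= (c * w)%:E)%E.
Proof.
move=> iM c0 X0 MX Xw.
have mM : measurable_fun setT M by apply/measurable_EFinP; exact: measurable_int iM.
have mMp : measurable_fun setT (fun x => (Num.max (M x) 0)%:E).
  by apply/measurable_EFinP; exact: measurable_maxr.
have Mle : (\int[P]_x (M x)%:E <= \int[P]_x (Num.max (M x) 0)%:E)%E.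
  apply: le_integral => //; last by move=> x _; rewrite lee_fin le_max lexx.
  apply: le_integrable iM => // x _ /=; rewrite lee_fin.
  by rewrite /Num.max; case: ifP; rewrite ?normr0.
(* For [c = 0] one cannot divide, but then [M <= 0], even where [X] is infinite. *)
apply: le_trans Mle _; move: c0; rewrite le_eqVlt => /predU1P[c0|c0].
  rewrite -c0 mul0r integral0_eq// => x _; rewrite (max_idPr _)//.
  by rewrite -lee_fin (le_trans (MX x))// -c0 mul0e.
rewrite EFinM -lee_pdivrMl//.
rewrite -ge0_integralZl_EFin ?invr_ge0 ?(ltW c0)//; last first.
  by move=> x _; rewrite lee_fin le_max lexx orbT.
apply: le_trans Xw; apply: le_integral_ge0_nomeas => x _.
rewrite -EFinM lee_fin mulr_ge0 ?invr_ge0 ?(ltW c0)//= ?le_max ?lexx ?orbT//.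
rewrite EFinM lee_pdivrMl// /Num.max; case: ifP => _; last exact: MX.
by rewrite mule_ge0 ?X0// lee_fin ltW.
Qed.

(* The event X > c has probability 0 or 1, and probability 1 would give E X > c. *)
Lemma trivial_ae_le (G : set (set Omega)) (X : Omega -> R) (c : R) :
  (forall A, G A -> P A = 0%E \/ P A = 1%E) -> G `<=` measurable ->
  measurable_wrt G X -> P.-integrable setT (EFin \o X) ->
  (\int[P]_x (X x)%:E <= c%:E)%E -> {ae P, forall x, X x <= c}.
Proof.
move=> triv Gm GX iX Xc.
pose A := X @^-1` `]c, +oo[%classic.
have GA : G A by apply: GX; exact: measurable_itv.
have mA : measurable A by exact: Gm.
have [A0|A1] := triv A GA.
  exists A; split => // x /= /negP; rewrite -ltNge => cX.
  by rewrite /A /= in_itv/= cX.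
exfalso.
have iD : P.-integrable setT (EFin \o (fun x => X x - c)).
  apply: (eq_integrable _ (EFin \o X \- (EFin \o cst c))%E) => //.
  by apply: integrableB => //; exact: finite_measure_integrable_cst.
have AC0 : P (~` A) = 0%E by rewrite probability_setC// A1 subee.
have XcA x : A x -> 0 < X x - c by rewrite /A /= in_itv/= andbT subr_gt0.
have mXc : measurable_fun A (EFin \o (fun x => X x - c)).
  by apply: measurable_funS (measurable_int _ iD).
have E0 : (\int[P]_(x in A) `|(EFin \o (fun x => (X x - c)%R)) x| = 0)%E.
  under eq_integral => x xA.
    rewrite /= ger0_norm; last by apply/ltW/XcA; rewrite -inE.
    over.
  apply/eqP; rewrite eq_le; apply/andP; split; last first.
    by apply: integral_ge0 => x /XcA/ltW; rewrite lee_fin.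
  have : (\int[P]_x ((EFin \o (fun x => (X x - c)%R)) x) <= 0)%E.
    rewrite (eq_integral (EFin \o X \- (EFin \o cst c))%E)//.
    rewrite integralB//; last exact: finite_measure_integrable_cst.
    have -> : (\int[P]_x (EFin \o cst c) x = c%:E)%E.
      have H := @integral_cst _ _ _ P setT measurableT c%:E.
      by apply: (eq_trans H); rewrite [X in (_ * X)%E]probability_setT mule1.
    by rewrite leeBlDl// adde0.
  rewrite (@negligible_integral _ _ _ P setT (~` A))//; last exact: measurableC.
  by rewrite setTD setCK.
have [N [mN N0 NA]] := (ae_eq_integral_abs P mA mXc).1 E0.
have : P A = 0%E.
  apply: (@subset_measure0 _ _ _ P _ N) => // x Ax; apply: NA => /= /(_ Ax) [] H.
  by have := XcA x Ax; rewrite H ltxx.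
by rewrite A1 => /eqP; rewrite onee_eq0.
Qed.

End expectation.

(** * Verification *)

Section constant_plan.
Context {d : measure_display} {Omega : measurableType d} {R : realType}.
Notation leb := (@lebesgue_measure R).

Lemma constant_plan_exists (T c : R) (F : R -> set (set Omega)) : 0 < T -> 0 <= c ->
  (forall t (x : R), measurable_wrt (F t) (cst x : Omega -> R)) ->
  exists C : plan T F, forall t w, C t w = if 0 <= t then c else 0.
Proof.
move=> T0 c0 Fcst; pose p (t : R) (w : Omega) : R := if 0 <= t then c else 0.
have nd w : nondecreasing (fun t => p t w).
  move=> s t st; rewrite /p; case: ifPn => s0; last by case: ifP.
  by rewrite (le_trans s0 st).
have rc w : right_continuous (fun t => p t w).
  move=> x; have [x0|x0] := leP 0 x.
    have : \forall u \near x^'+, c = p u w.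
      near=> u; rewrite /p ifT//; apply: le_trans x0 _.
      by near: u; exact: nbhs_right_ge.
    rewrite [X in _ --> X](_ : _ = c); last by rewrite /p x0.
    by move=> /near_eq_cvg /cvg_trans; apply; exact: cvg_cst.
  have : \forall u \near x^'+, 0 = p u w.
    near=> u; rewrite /p ifF//; apply/negbTE; rewrite -ltNge.
    by near: u; exact: nbhs_right_lt.
  rewrite [X in _ --> X](_ : _ = 0); last by rewrite /p leNgt x0.
  by move=> /near_eq_cvg /cvg_trans; apply; exact: cvg_cst.
have before (t : R) w : t < 0 -> p t w = 0 by rewrite /p leNgt => ->.
have after (t : R) w : T < t -> p t w = p T w.
  by move=> Tt; rewrite /p (ltW T0) (ltW (lt_trans T0 Tt)).
have adapted (t : R) : 0 <= t <= T -> measurable_wrt (F t) (p t).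
  by move=> /andP[t0 _]; rewrite /p t0; exact: Fcst.
by exists (Plan nd rc before after adapted).
Unshelve. all: by end_near. Qed.

Lemma satisfaction_constant (T c eta beta t : R) (F : R -> set (set Omega))
    (C : plan T F) w : (forall t, 0 <= t <= T -> C t w = c) -> 0 < beta -> 0 <= t <= T ->
  satisfaction eta beta C t w = decay_path beta (eta + beta * c) t.
Proof.
move=> Cc beta0 tT; rewrite /satisfaction /Rintegral.
rewrite (integral_constant_plan Cc tT (g := fun s => (decay_kernel beta t s)%:E)).
- by rewrite /= /decay_kernel subr0 /decay_path; ring.
- apply/measurable_EFinP; apply: measurable_funTS.
  exact: measurableT_comp (measurable_decay_kernel beta) (measurable_pair1 _).
- by move=> x _; rewrite lee_fin decay_kernel_ge0.
Qed.

(** The plan charges time 0 only, where the state price is 1. *)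
Lemma admissible_constant (T c r lambda theta : R) (F : R -> set (set Omega))
    (P : probability Omega R) (N : R -> Omega -> nat) (C : plan T F) :
  0 < T -> 0 <= c -> 0 <= theta -> (forall t w, 0 <= t <= T -> C t w = c) ->
  (forall w, N 0 w = 0%N) ->
  (forall w (s t : R), 0 <= s -> s <= t -> t <= T -> (N s w <= N t w)%N) ->
  admissible P (state_price r lambda theta N) c C.
Proof.
move=> T0 c0 theta0 Cc N0 Nnd; rewrite /admissible.
apply: (@le_trans _ _ (\int[P]_w (cst c%:E w))%E); last first.
  by rewrite integral_cst// [X in (_ * X)%E]probability_setT mule1.
apply: le_integral_ge0_nomeas => w _; rewrite integral_ge0/=; last first.
  by move=> t _; rewrite lee_fin expR_ge0.
set rho := r + lambda * (expR theta - 1).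
pose B := expR (theta * (N T w)%:R + `|rho| * T).
(* [g] dominates the state price on [[0, T]], agrees with it at 0 and is evidently measurable, so
   the atom at 0 is evaluated without studying the paths of the price. *)
pose g (t : R) : \bar R := (if t == 0 then 1 else B)%:E.
have TT : 0 <= T <= T by rewrite lexx ltW.
have -> : c%:E = (g 0%R * c%:E)%E by rewrite /g eqxx mul1e.
rewrite -(integral_constant_plan (fun t => Cc t w) TT (g := g)).
- apply: le_integral_ge0_nomeas => t; rewrite /= in_itv/= => /andP[t0 tT].
  rewrite !lee_fin expR_ge0/= /g; case: eqP => [->|_].
    by rewrite /state_price N0 !mulr0 subrr expR0.
  rewrite ler_expR -/rho lerD//.
    by rewrite ler_wpM2l// ler_nat Nnd.
  apply: le_trans (ler_norm _) _; rewrite normrN normrM (ger0_norm t0).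
  by rewrite ler_wpM2l.
- apply/measurable_EFinP; apply: measurable_funTS.
  rewrite (_ : (fun t => _) = (fun t => B + (1 - B) * \1_[set 0] t)).
    by apply: measurable_funD => //; apply: measurable_funM.
  apply/funext => t; rewrite indicE; case: eqP => [->|t0].
    by rewrite mem_set// mulr1 subrKC.
  by rewrite memNset// mulr0 addr0.
- by move=> x _; rewrite lee_fin; case: ifP => // _; exact: expR_ge0.
Qed.

End constant_plan.

(** * Deterministic solutions of the recursion *)

Section deterministic_recursion.
Context {d : measure_display} {Omega : measurableType d} {R : realType}.
Notation leb := (@lebesgue_measure R).
Variables (P : probability Omega R) (T : R) (F : R -> set (set Omega)).
Hypotheses (T0 : 0 < T)
  (Fcst : forall t (x : R), measurable_wrt (F t) (cst x : Omega -> R)).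

Lemma cond_expectation_cst (t x : R) : F t `<=` measurable ->
  cond_expectation P (F t) (cst x) (cst x).
Proof.
by move=> Fm; split => //; exact: finite_measure_integrable_cst.
Qed.

(** A constant is its own conditional expectation, so a solution of the deterministic integral
    equation already solves the recursion. *)
Lemma recursive_utility_deterministic (f : R -> R -> R -> R) (Y : R -> Omega -> R)
    (y u : R -> R) (L : R) : (forall t, 0 <= t <= T -> F t `<=` measurable) ->
  (forall t w, 0 <= t <= T -> Y t w = y t) ->
  (forall s t, 0 <= s <= T -> 0 <= t <= T -> `|u s - u t| <= L * `|s - t|) ->
  (forall t, 0 <= t <= T -> u t = \int[leb]_(s in `[t, T]) f s (y s) (u s)) ->
  exists2 U : R -> Omega -> R, recursive_utility T F P f Y U &
    forall t w, 0 <= t <= T -> U t w = u t.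
Proof.
(* Clamping time to [[0, T]] makes [v] Lipschitz on the whole line, which yields the one-sided
   limits. *)
move=> Fm Yy uL uE; pose v (t : R) := u (Num.min T (Num.max 0 t)).
have cl t : 0 <= Num.min T (Num.max 0 t) <= T.
  by rewrite ge_min lexx le_min le_max lexx (ltW T0).
have vE t : 0 <= t <= T -> v t = u t.
  by move=> /andP[t0 tT]; rewrite /v (max_idPr t0) (min_idPr tT).
have clL x z : `|Num.min T (Num.max 0 x) - Num.min T (Num.max 0 z)| <= `|x - z|.
  have := ler_norm (x - z); have := ler_norm (z - x).
  rewrite (distrC z) ler_norml /Order.min /Order.max.
  by move: T0 => ?; do !case: ifPn; rewrite -?leNgt; lra.
have L0 : 0 <= L.
  have := uL 0 T; rewrite !lexx (ltW T0) => /(_ erefl erefl) /(le_trans (normr_ge0 _)).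
  by rewrite pmulr_lge0// normr_gt0 subr_eq0 lt_eqF.
have vL x y' : `|v x - v y'| <= L * `|x - y'|.
  by apply: le_trans (uL _ _ (cl x) (cl y')) _; rewrite ler_wpM2l.
have cv := lipschitz_continuous vL.
exists (fun t _ => v t); last by move=> t w; exact: vE.
split.
- by move=> t _; exact: Fcst.
- move=> w; split => t tT.
    exact: cvg_at_right_filter (cv t).
  by apply/cvg_ex; exists (v t); exact: cvg_at_left_filter (cv t).
- set S := ereal_sup _.
  have SB : (S <= (`|v 0| + L * T)%:E)%E.
    apply: ge_ereal_sup => _ [t /=] + <-; rewrite in_itv/= => /andP[t0 tT].
    rewrite lee_fin -[v t](subrK (v 0)) addrC; apply: le_trans (ler_normD _ _) _.
    rewrite lerD//; apply: le_trans (vL _ _) _.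
    by rewrite subr0 ger0_norm// ler_wpM2l.
  have S0 : (0 <= S)%E.
    apply: ereal_sup_ge; exists `|v 0|%:E; last by rewrite lee_fin.
    by exists 0 => //; rewrite /= in_itv/= lexx ltW.
  have Sf : S \is a fin_num by rewrite ge0_fin_numE// (le_lt_trans SB)// ltry.
  rewrite integral_cst// [X in (_ * X)%E]probability_setT mule1.
  have [x ->] : exists x, S = x%:E by exists (fine S); rewrite fineK.
  by rewrite -EFinM ltry.
- move=> t tT; rewrite (_ : (fun w => _) = cst (v t)).
    exact: cond_expectation_cst (Fm t tT).
  apply/funext => w; rewrite vE// uE//; apply: eq_Rintegral => s.
  rewrite inE/= in_itv/= => /andP[ts sT].
  have sT' : 0 <= s <= T by rewrite sT (le_trans _ ts)//; case/andP: tT.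
  by rewrite Yy// vE.
Qed.

End deterministic_recursion.

(** * Moments and measurability of utility and satisfaction *)

Section utility.
Context {d : measure_display} {Omega : measurableType d} {R : realType}.
Notation leb := (@lebesgue_measure R).

Lemma joint_measurable_section (T : R) (Z : R -> Omega -> R) w :
  measurable_fun ((`[0, T]%classic : set (measurableTypeR R)) `*` [set: Omega])
    (fun z : measurableTypeR R * Omega => Z z.1 z.2) ->
  measurable_fun `[0, T] (Z ^~ w).
Proof.
move=> mZ; have mD : measurable
    ((`[0, T]%classic : set (measurableTypeR R)) `*` [set: Omega]).
  by apply: measurableX => //; exact: measurable_itv.
have sub : (fun s : measurableTypeR R => (s, w)) @` `[0, T]%classic `<=`
    (`[0, T]%classic : set (measurableTypeR R)) `*` [set: Omega].
  by move=> _ [s sT <-].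
exact: (measurable_comp mD sub mZ (measurable_funTS (measurable_pair2 w))).
Qed.

Variables (P : probability Omega R) (T : R) (F : R -> set (set Omega)).
Hypotheses (T0 : 0 < T) (Fm : forall t, 0 <= t <= T -> F t `<=` measurable).

Let measurable_wrt_fun t (X : Omega -> R) : 0 <= t <= T -> measurable_wrt (F t) X ->
  measurable_fun setT X.
Proof. by move=> tT FX _ A mA; rewrite setTI; apply: (Fm tT); exact: FX. Qed.

Section utility_process.
Variables (f : R -> R -> R -> R) (Yp U : R -> Omega -> R).
Hypothesis HU : recursive_utility T F P f Yp U.

(** From [|x| <= 1 + x^2] and the integrability of the squared supremum, hence uniformly in [s]. *)
Lemma utility_first_moment : exists B : R, forall s, 0 <= s <= T ->
  (\int[P]_w `|(U s w)%:E| <= B%:E)%E.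
Proof.
have [UF _ US _] := HU.
set S := (fun w => ereal_sup _ ^+ 2)%E in US.
have S0 w : (0 <= S w)%E by rewrite /S sqre_ge0.
have IS : (\int[P]_w S w)%E \is a fin_num.
  by rewrite ge0_fin_numE// integral_ge0.
exists (1 + fine (\int[P]_w S w)%E) => s sT.
have mU := measurable_wrt_fun sT (UF s sT).
have mU2 : measurable_fun setT (fun w => (U s w ^+ 2)%:E).
  by apply/measurable_EFinP; exact: measurable_funX.
apply: (@le_trans _ _ (\int[P]_w ((cst 1%:E w) + (U s w ^+ 2)%:E))%E).
  apply: le_integral_ge0_nomeas => w _; rewrite abse_ge0/= -EFinD lee_fin.
  have [u1|u1] := leP `|U s w| 1; first by have := sqr_ge0 (U s w); lra.
  rewrite -real_normK ?num_real// expr2.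
  have : `|U s w| <= `|U s w| * `|U s w| by rewrite ler_peMl// ltW.
  by lra.
rewrite ge0_integralD//; last by move=> w _; rewrite lee_fin sqr_ge0.
rewrite [X in (X + _)%E]integral_cst// [X in (_ * X + _)%E]probability_setT mule1.
rewrite EFinD fineK// leeD2l//; apply: le_integral_ge0_nomeas => w _.
rewrite lee_fin sqr_ge0/= /S -real_normK ?num_real// EFin_expe.
have h : (`|U s w|%:E <= ereal_sup [set `|U t w|%:E | t in `[0%R, T]])%E.
  by apply: ereal_sup_ubound; exists s => //; rewrite /= in_itv.
by rewrite [leLHS]expe2 [leRHS]expe2 lee_pmul.
Qed.

Lemma utility_joint_measurable :
  measurable_fun ((`[0, T]%classic : set (measurableTypeR R)) `*` [set: Omega])
    (fun z : measurableTypeR R * Omega => U z.1 z.2).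
Proof.
have [UF Uc _ _] := HU; apply: right_continuous_joint_measurable_itv => // [t tT|w t tT].
  exact: measurable_wrt_fun tT (UF t tT).
by have [+ _] := Uc w; apply.
Qed.

Lemma utility_path_bounded w : exists b : R, forall s, 0 <= s <= T -> `|U s w| <= b.
Proof. by have [_ Uc _ _] := HU; exact: cadlag_bounded (Uc w). Qed.

End utility_process.

Section satisfaction_process.
Variables (eta beta : R) (C : plan T F).
Hypotheses (eta0 : 0 <= eta) (beta0 : 0 < beta).
Notation Ys := (satisfaction eta beta C).
Notation V s w := (\int[plan_measure C w]_(v in `[0, s]) decay_kernel beta s v).

Lemma measurable_satisfaction w : measurable_fun `[0, T] (Ys ^~ w).
Proof.
apply: measurable_funD.
  apply: measurable_funTS; apply: measurable_funM => //.
  apply: measurableT_comp => //; apply: measurableT_comp => //.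
have m1 : measurable_fun `[0, T] (fun=> 1 : R) by exact: measurable_cst.
have := measurable_decay_integral C w beta0 m1 (fun _ _ => ler01).
by apply: eq_measurable_fun => s _; rewrite mul1r.
Qed.

Lemma decay_integral_ge0 s w : 0 <= V s w.
Proof. by apply: Rintegral_ge0 => v _; exact: decay_kernel_ge0. Qed.

Lemma satisfaction_ge0 s w : 0 <= Ys s w.
Proof. by rewrite addr_ge0 ?decay_integral_ge0// mulr_ge0 ?expR_ge0. Qed.

Lemma satisfaction_le s w : 0 <= s <= T -> Ys s w <= eta + beta * C T w.
Proof.
move=> /andP[s0 sT]; rewrite lerD//.
  by rewrite ler_piMr// -expR0 ler_expR oppr_le0 mulr_ge0// (ltW beta0).
apply: (@le_trans _ _ (beta * C s w)).
  rewrite -lee_fin /Rintegral fineK; last exact: decay_integral_fin_num.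
  exact: decay_integral_le.
by rewrite ler_pM2l// plan_le.
Qed.

End satisfaction_process.

End utility.

(** * Comparison with an arbitrary admissible plan *)

Section verification.
Context {d : measure_display} {Omega : measurableType d} {R : realType}.
Notation leb := (@lebesgue_measure R).
Variables (P : probability Omega R) (T : R) (F : R -> set (set Omega)).
Hypotheses (T0 : 0 < T)
  (Fcst : forall t (x : R), measurable_wrt (F t) (cst x : Omega -> R))
  (Fm : forall t, 0 <= t <= T -> F t `<=` measurable).
Variables (alpha : R) (f : R -> R -> R -> R).
Hypotheses (f_borel : borel_aggregator T f) (f_A1 : A1 T f)
  (f_A2 : A2 T f) (alpha_itv : 0 < alpha < 1 / 2) (f_A3 : A3 T alpha f).
Variables (eta beta wealth rho : R) (C : plan T F) (U psi : R -> Omega -> R).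
Hypotheses (eta0 : 0 <= eta) (beta0 : 0 < beta) (wealth0 : 0 < wealth).
Notation Ys := (satisfaction eta beta C).
Hypothesis (HU : recursive_utility T F P f Ys U).
Hypothesis (psi_ge : forall t w, 0 <= t <= T -> expR (- (rho * t)) <= psi t w).
Hypothesis (adm : admissible P psi wealth C).

Let phi w s := f s (Ys s w) (U s w).
(** [U s] is a version of the conditional expectation of [X s] given [F s]. *)
Let X s w := tail_integral T (phi w) s.

Let measurable_wrt_fun t (W : Omega -> R) : 0 <= t <= T -> measurable_wrt (F t) W ->
  measurable_fun setT W.
Proof. by move=> tT FX _ A mA; rewrite setTI; apply: (Fm tT); exact: FX. Qed.

Let mU s : 0 <= s <= T -> measurable_fun setT (U s).
Proof. by move=> sT; have [UF _ _ _] := HU; exact: measurable_wrt_fun (UF s sT). Qed.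

Let mC : measurable_fun setT (C T).
Proof.
have TT : 0 <= T <= T by rewrite lexx ltW.
exact: measurable_wrt_fun TT (plan_adapted C TT).
Qed.

Let mUw w : measurable_fun `[0, T] (U ^~ w).
Proof. exact: joint_measurable_section (utility_joint_measurable T0 Fm HU). Qed.

Let mphi w : measurable_fun `[0, T] (phi w).
Proof.
apply: aggregator_measurable => //; first exact: measurable_satisfaction.
by move=> s _; exact: satisfaction_ge0.
Qed.

Let phi_bound w : exists M : R, forall s, 0 <= s <= T -> `|phi w s| <= M.
Proof.
have [b Ub] := utility_path_bounded HU w.
have [K K0 [_ gr]] := aggregator_growth f_A2 alpha_itv f_A3.
exists (K * (2 + (eta + beta * C T w) + b)) => s sT.
apply: le_trans (gr _ _ _ sT (satisfaction_ge0 C eta0 beta0 s w)) _.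
by rewrite ler_pM2l// lerD ?Ub// lerD2l satisfaction_le.
Qed.

(** The state price is at least [c0] on [[0, T]], so the budget constraint bounds [c0] times the
    mean of [C T]. *)
Lemma plan_first_moment : exists m : R, (\int[P]_w (C T w)%:E <= m%:E)%E.
Proof.
pose c0 := expR (- (`|rho| * T)).
have c00 : 0 < c0 by exact: expR_gt0.
exists (c0^-1 * wealth).
rewrite EFinM -lee_pdivrMl ?invr_gt0// invrK.
rewrite -ge0_integralZl_EFin ?(ltW c00)//; last 2 first.
- by move=> w _; rewrite lee_fin plan_ge0.
- by apply/measurable_EFinP.
apply: le_trans adm; apply: le_integral_ge0_nomeas => w _.
rewrite mule_ge0 ?lee_fin ?(ltW c00) ?plan_ge0//=.
have <- : (\int[plan_measure C w]_(t in `[0%R, T]) (cst c0%:E t) =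
    c0%:E * (C T w)%:E)%E.
  by rewrite [LHS]integral_cst// [X in (_ * X)%E]plan_measure_itv0// ltW.
apply: le_integral_ge0_nomeas => t; rewrite /= in_itv/= => tT.
rewrite !lee_fin (ltW c00)/=; apply: le_trans (psi_ge w tT).
have /andP[t0 tT'] := tT.
rewrite ler_expR lerN2; apply: le_trans (ler_norm _) _.
by rewrite normrM (ger0_norm t0) ler_wpM2l.
Qed.

(** The factor 1 matches the weighted time integrals treated above, with constant weight. *)
Let J w := (\int[leb]_(s in `[0%R, T]) `|(1 * U s w)%:E|)%E.

Let J_lty : (\int[P]_w J w < +oo)%E /\ measurable_fun setT J.
Proof.
have [B UB] := utility_first_moment Fm HU.
have m1 : measurable_fun `[0, T] (fun=> 1 : R) by exact: measurable_cst.
have b1 (s : R) : 0 <= s <= T -> `|1 : R| <= 1 by rewrite normr1.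
have mJ := utility_joint_measurable T0 Fm HU.
split.
- exact: (integral_time_abs_lty T0 mJ m1 b1 UB mU).
- exact: (measurable_time_abs mJ m1).
Qed.

(** Linear growth of [f] and [satisfaction_le]. The constant [K * T + K] serves both the term that
    is constant in time, integrated over [[0, T]], and [J]. *)
Let X_bound : exists2 K : R, 0 <= K & forall s w, 0 <= s <= T ->
  (`|(X s w)%:E| <= (K * (2 + (eta + beta * C T w)))%:E + K%:E * J w)%E.
Proof.
have [K K0 [_ gr]] := aggregator_growth f_A2 alpha_itv f_A3.
exists (K * T + K); first by rewrite addr_ge0 ?mulr_ge0 ?ltW.
move=> s w sT; have /andP[s0 sT'] := sT.
have [M phiM] := phi_bound w.
have iphi := sub_bounded_integrable (mphi w) phiM s0 (lexx T).
rewrite /X /tail_integral abse_EFin EFin_normr_Rintegral//.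
apply: le_trans (le_abse_integral _ _ (measurable_int _ iphi)) _ => //.
have mJw : measurable_fun `[0, T] (fun v => `|(1 * U v w)%:E|%E).
  have H : measurable_fun `[0, T] (fun v => 1 * U v w).
    rewrite (_ : (fun v => _) = U ^~ w); first exact: mUw.
    by apply/funext => v; rewrite mul1r.
  by apply: measurableT_comp => //; apply/measurable_EFinP.
set a := 2 + (eta + beta * C T w).
have a0 : 0 <= a.
  by rewrite /a !addr_ge0// mulr_ge0 ?plan_ge0// ltW.
apply: (@le_trans _ _ (\int[leb]_(v in `[0%R, T])
    ((cst (K * a)%:E v) + K%:E * `|(1 * U v w)%:E|))%E).
  apply: (@le_trans _ _ (\int[leb]_(v in `[0%R, T]) `|(phi w v)%:E|)%E).
    apply: ge0_subset_integral => //.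
      by apply: measurableT_comp => //; apply/measurable_EFinP; exact: mphi.
    by apply: subset_itvr; rewrite bnd_simp.
  apply: le_integral_ge0_nomeas => v; rewrite /= in_itv/= => vT.
  rewrite lee_fin normr_ge0/= mul1r -EFinM -EFinD lee_fin -mulrDr.
  apply: le_trans (gr _ _ _ vT (satisfaction_ge0 C eta0 beta0 v w)) _.
  by rewrite ler_pM2l// lerD2r /a lerD2l satisfaction_le.
rewrite ge0_integralD//=; last 3 first.
- by move=> v _; rewrite lee_fin mulr_ge0// ltW.
- by move=> v _; rewrite mule_ge0// lee_fin ltW.
- exact: measurable_funeM.
rewrite integral_cst//= lebesgue_measure_itv/= lte_fin T0 sube0.
rewrite ge0_integralZl_EFin ?(ltW K0)//.
apply: leeD.
  by rewrite -EFinM lee_fin mulrDl; have := mulr_ge0 (ltW K0) a0; lra.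
apply: lee_wpmul2r; first by apply: integral_ge0.
by rewrite lee_fin lerDr mulr_ge0// ltW.
Qed.

(** The conditional expectation is tested on the whole space only, which lies in [F s] as a preimage
    under a constant. *)
Let X_cond s : 0 <= s <= T -> [/\ P.-integrable setT (EFin \o X s),
  P.-integrable setT (EFin \o U s) &
  (\int[P]_w (U s w)%:E = \int[P]_w (X s w)%:E)%E].
Proof.
move=> sT; have [_ _ _ /(_ s sT)[iX iU _ XU]] := HU.
by split => //; apply: XU; rewrite -(@preimage_setT _ R (cst 0)); exact: Fcst.
Qed.

Let Z s w := X s w - U s w.

Let mX s : 0 <= s <= T -> measurable_fun setT (X s).
Proof.
by move=> /X_cond[iX _ _]; apply/measurable_EFinP; exact: measurable_int iX.
Qed.

(** Fubini wants a bound uniform in [s]: the one on [X] involves only [C T] and [J], whose finite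
    means do not depend on [s]. *)
Let Z_first_moment : exists B : R, forall s, 0 <= s <= T ->
  (\int[P]_w `|(Z s w)%:E| <= B%:E)%E.
Proof.
have [B UB] := utility_first_moment Fm HU.
have [m Cm] := plan_first_moment.
have [K K0 XB] := X_bound.
have [Joo mJ] := J_lty.
have J0 w : (0 <= J w)%E by apply: integral_ge0.
have Jfin : (\int[P]_w J w)%E \is a fin_num by rewrite ge0_fin_numE// integral_ge0.
have b0 := ltW beta0.
exists (K * (2 + eta) + K * beta * m + K * fine (\int[P]_w J w)%E + B) => s sT.
apply: (@le_trans _ _ (\int[P]_w (`|(X s w)%:E| + `|(U s w)%:E|))%E).
  by apply: le_integral_ge0_nomeas => w _; rewrite abse_ge0/= lee_fin ler_normB.
rewrite ge0_integralD//; last 2 first.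
- by apply: measurableT_comp => //; apply/measurable_EFinP; exact: mX.
- by apply: measurableT_comp => //; apply/measurable_EFinP; exact: mU.
rewrite EFinD; apply: leeD; last exact: UB.
apply: (@le_trans _ _ (\int[P]_w ((cst (K * (2 + eta))%:E w +
    (K * beta)%:E * (C T w)%:E) + K%:E * J w))%E).
  apply: le_integral_ge0_nomeas => w _; rewrite abse_ge0/=.
  apply: le_trans (XB s w sT) _; apply: leeD => //.
  by rewrite -EFinM -EFinD lee_fin; lra.
have Kb : 0 <= K * beta by rewrite mulr_ge0.
have mC' : measurable_fun setT (fun w => ((K * beta)%:E * (C T w)%:E)%E).
  by apply: measurable_funeM; apply/measurable_EFinP.
have C0 w : (0 <= (K * beta)%:E * (C T w)%:E)%E.
  by rewrite mule_ge0// lee_fin// plan_ge0.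
have k20 : 0 <= K * (2 + eta) by rewrite mulr_ge0// addr_ge0.
rewrite ge0_integralD//=; last 4 first.
- by move=> w _; rewrite adde_ge0// lee_fin.
- by apply: emeasurable_funD.
- by move=> w _; rewrite mule_ge0// lee_fin.
- exact: measurable_funeM.
rewrite EFinD [X in (_ <= _ + X)%E]EFinM fineK//.
rewrite ge0_integralZl_EFin//; apply: leeD => //.
rewrite ge0_integralD//=.
rewrite integral_cst// [X in (_ * X + _)%E]probability_setT mule1.
rewrite EFinD; apply: leeD => //.
rewrite ge0_integralZl_EFin//; last 2 first.
- by move=> w _; rewrite lee_fin plan_ge0.
- by apply/measurable_EFinP.
by rewrite [X in (_ <= X)%E]EFinM lee_wpmul2l ?lee_fin.
Qed.

(** [X] is Lipschitz in time along each path and [U] is right-continuous, so [Z] is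
    right-continuous. *)
Let Z_joint_measurable :
  measurable_fun ((`[0, T]%classic : set (measurableTypeR R)) `*` [set: Omega])
    (fun z : measurableTypeR R * Omega => Z z.1 z.2).
Proof.
apply: right_continuous_joint_measurable_itv => // [t tT|w t tT].
  by apply: measurable_funB; [exact: mX|exact: mU].
have [_ Uc _ _] := HU; have [Urc _] := Uc w.
apply: cvgB; last exact: Urc.
have [M phiM] := phi_bound w.
apply/cvgrPdist_le => e e0.
have M0 : 0 <= M.
  by apply: le_trans (normr_ge0 _) (phiM 0 _); rewrite lexx ltW.
have M1 : 0 < M + 1 by lra.
have [t0 tT'] := andP tT.
near=> u.
have tu : t < u by near: u; exact: nbhs_right_gt.
have uT : u < T by near: u; exact: nbhs_right_lt.
have ut : u < t + e / (M + 1).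
  by near: u; apply: nbhs_right_lt; rewrite ltrDl divr_gt0.
apply: le_trans (tail_integral_lipschitz (mphi w) phiM _ _) _.
- by rewrite t0 ltW.
- by rewrite (ltW uT) (le_trans t0 (ltW tu)).
rewrite distrC gtr0_norm ?subr_gt0//.
apply: (@le_trans _ _ ((M + 1) * (u - t))); first by rewrite ler_wpM2r ?subr_ge0 ?ltW//; lra.
by rewrite mulrC -ler_pdivlMr//; lra.
Unshelve. all: by end_near. Qed.

Let Z_mean s : 0 <= s <= T -> (\int[P]_w (Z s w)%:E = 0)%E.
Proof.
move=> /X_cond[iX iU XU].
transitivity (\int[P]_w (((EFin \o X s) \- (EFin \o U s)) w))%E; first by [].
by rewrite integralB//= XU subee// (integrable_fin_num _ iX).
Qed.

Let Z_path_bounded w : exists b : R, forall s, 0 <= s <= T -> `|Z s w| <= b.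
Proof.
have [b Ub] := utility_path_bounded HU w; have [M phiM] := phi_bound w.
exists (M * T + b) => s sT; apply: le_trans (ler_normB _ _) _.
by rewrite lerD ?Ub//; exact: (tail_integral_bound T0 (mphi w) phiM).
Qed.
Variables (y0 : R) (u : R -> R).
Hypotheses (y0E : y0 = eta + beta * wealth) (mu_ : measurable_fun `[0, T] u)
  (ubd : exists B : R, forall t : R, 0 <= t <= T -> `|u t| <= B)
  (uE : forall t : R, 0 <= t <= T ->
     u t = \int[leb]_(s in `[t, T]) f s (decay_path beta y0 s) (u s)).
Notation Y := (decay_path beta y0).
Notation a := (path_a f beta y0 u).
Notation b := (path_b f beta y0 u).
Notation Fp := (path_f f beta y0 u).
Notation Gam := (discount a).
Hypothesis weight_noninc : forall s1 s2, 0 < s1 -> s1 <= s2 -> s2 < T ->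
  Gam s2 * b s2 * expR (rho * s2) <= Gam s1 * b s1 * expR (rho * s1).

Let y0_gt0 : 0 < y0.
Proof. by rewrite y0E ltr_wpDl// mulr_gt0. Qed.

Let ma : measurable_fun `[0, T] a. Proof. by apply: measurable_path_a. Qed.
Let mb : measurable_fun `[0, T] b. Proof. by apply: measurable_path_b. Qed.
Let mFp : measurable_fun `[0, T] Fp. Proof. by apply: measurable_path_f. Qed.
Let aB : exists M : R, forall s, 0 <= s <= T -> `|a s| <= M.
Proof. by apply: path_a_bound; try eassumption. Qed.
Let bB : exists M : R, forall s, 0 <= s <= T -> b s <= M.
Proof. by apply: path_b_bound; try eassumption. Qed.
Let FB : exists M : R, forall s, 0 <= s <= T -> `|Fp s| <= M.
Proof. by apply: path_f_bound; try eassumption. Qed.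
Let b_ge0 s : 0 <= s <= T -> 0 <= b s.
Proof. by move=> sT; apply: path_b_ge0; try eassumption. Qed.
Let mGam : measurable_fun `[0, T] Gam.
Proof. by have [M aM] := aB; exact: measurable_discount T0 ma aM. Qed.
Let Gam_bound : exists G : R, forall s, 0 <= s <= T -> `|Gam s| <= G.
Proof. by have [M aM] := aB; exists (expR (M * T)); exact: (discount_bound T0 ma aM). Qed.
Let Gam_ge0 s : 0 <= Gam s. Proof. exact: expR_ge0. Qed.

Let bounded_mul (g h : R -> R) :
  (exists M : R, forall s, 0 <= s <= T -> `|g s| <= M) ->
  (exists M : R, forall s, 0 <= s <= T -> `|h s| <= M) ->
  exists M : R, forall s, 0 <= s <= T -> `|g s * h s| <= M.
Proof.
by move=> [M gM] [M' hM]; exists (M * M') => s sT; rewrite normrM ler_pM ?gM ?hM.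
Qed.

Let mI : @measurable _ (measurableTypeR R) `[0, T]%classic.
Proof. exact: measurable_itv. Qed.

Let integrable_bounded (g : R -> R) : measurable_fun `[0, T] g ->
  (exists M : R, forall s, 0 <= s <= T -> `|g s| <= M) ->
  leb.-integrable `[0, T] (EFin \o g).
Proof. by move=> mg [M gM]; exact: bounded_integrable_itv gM. Qed.

Let k s := Gam s * b s.
Let mk : measurable_fun `[0, T] k. Proof. exact: measurable_funM. Qed.
Let k_bound : exists M : R, forall s, 0 <= s <= T -> `|k s| <= M.
Proof.
apply: bounded_mul => //; have [M bM] := bB; exists M => s sT.
by rewrite ger0_norm ?b_ge0 ?bM.
Qed.
Let k_ge0 s : 0 <= s <= T -> 0 <= k s.
Proof. by move=> sT; rewrite mulr_ge0 ?b_ge0. Qed.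

Let dk s := decay_kernel beta s 0.
Let mdk : measurable_fun `[0, T] dk.
Proof.
apply: measurable_funTS.
exact: measurableT_comp (measurable_decay_kernel beta) (measurable_pair2 _).
Qed.
Let dk_bound : exists M : R, forall s, 0 <= s <= T -> `|dk s| <= M.
Proof.
exists beta => s /andP[s0 _]; rewrite ger0_norm ?decay_kernel_ge0// /dk /decay_kernel.
by rewrite ler_piMr ?(ltW beta0)// -expR0 ler_expR oppr_le0 subr0 mulr_ge0// ltW.
Qed.

Let Phi0 := \int[leb]_(s in `[0, T]) (k s * dk s).

(** Integration by parts for the candidate path, where the tail integral of [Fp] is [u] itself. *)
Let utility_path_identity :
  u 0 = \int[leb]_(s in `[0, T]) (Gam s * Fp s - Gam s * a s * u s).
Proof.
have [Ma aM] := aB; have [MF FM] := FB.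
have uT s : 0 <= s <= T -> tail_integral T Fp s = u s by move=> sT; rewrite uE.
have := discounted_tail_integral T0 ma mFp aM FM.
have -> : \int[leb]_(s in `[0, T]) (Gam s * a s * tail_integral T Fp s) =
    \int[leb]_(s in `[0, T]) (Gam s * a s * u s).
  by apply: eq_Rintegral => s; rewrite inE/= in_itv/= => sT; rewrite uT.
rewrite uT ?lexx ?(ltW T0)// => H.
rewrite RintegralB//; first by rewrite H addrK.
- apply: integrable_bounded; first exact: measurable_funM.
  by apply: bounded_mul => //; exists MF.
- apply: integrable_bounded; first by apply: measurable_funM => //; exact: measurable_funM.
  by apply: bounded_mul => //; apply: bounded_mul => //; exists Ma.
Qed.

Let Iz w := \int[leb]_(s in `[0, T]) (Gam s * a s * Z s w).

(** Integration by parts for a competing path, where the tail integral is [X]. Writing [X = U + Z]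
    puts [U] into the integrand, as the tangent inequality requires, at the price of the centred
    term [Iz]. *)
Let tail_path_identity w : X 0 w + Iz w =
  \int[leb]_(s in `[0, T]) (Gam s * phi w s - Gam s * a s * U s w).
Proof.
have [Ma aM] := aB; have [MF FM] := phi_bound w.
have H := discounted_tail_integral T0 ma (mphi w) aM FM.
have Ga : exists M : R, forall s, 0 <= s <= T -> `|Gam s * a s| <= M.
  by apply: bounded_mul => //; exists Ma.
have mGa : measurable_fun `[0, T] (fun s => Gam s * a s) by exact: measurable_funM.
have iU : leb.-integrable `[0, T] (EFin \o (fun s => Gam s * a s * U s w)).
  apply: integrable_bounded; first by apply: measurable_funM => //; exact: mUw.
  by apply: bounded_mul => //; exact: utility_path_bounded HU w.
have iX : leb.-integrable `[0, T] (EFin \o (fun s => Gam s * a s * X s w)).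
  apply: integrable_bounded.
    by apply: measurable_funM => //; exact: measurable_tail_integral T0 (mphi w) FM.
  apply: bounded_mul => //; exists (MF * T) => s sT.
  exact: (tail_integral_bound T0 (mphi w) FM).
have iG : leb.-integrable `[0, T] (EFin \o (fun s => Gam s * phi w s)).
  apply: integrable_bounded; first exact: measurable_funM.
  by apply: bounded_mul => //; exists MF.
rewrite RintegralB// H -addrA; congr (_ + _).
rewrite -RintegralB//; apply: eq_Rintegral => s _.
by rewrite /Z mulrBr.
Qed.

(** The whole comparison for a single path, before expectations: concavity bounds the left-hand side
    by a weighted kernel integral, which [kernel_budget_bound] prices. *)
Let path_budget w : ((X 0 w + Iz w - u 0 + wealth * Phi0)%R%:E <=
  Phi0%:E * \int[plan_measure C w]_(t in `[0%R, T]) (psi t w)%:E)%E.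
Proof.
have [Ma aM] := aB.
have Ga : exists M : R, forall s, 0 <= s <= T -> `|Gam s * a s| <= M.
  by apply: bounded_mul => //; exists Ma.
have mGa : measurable_fun `[0, T] (fun s => Gam s * a s) by exact: measurable_funM.
have Y0 s : 0 < Y s by exact: decay_path_gt0.
have mdY : measurable_fun `[0, T] (fun s => Ys s w - Y s).
  by apply: measurable_funB; [exact: measurable_satisfaction|exact: measurable_decay_path].
(* The [eta] terms cancel: what remains is the effect of the plan minus that of [wealth] units
   consumed at time 0. *)
have dYE s : Ys s w - Y s =
    \int[plan_measure C w]_(v in `[0, s]) decay_kernel beta s v - wealth * dk s.
  by rewrite /satisfaction /decay_path y0E /dk /decay_kernel subr0; ring.
have dYB : exists M : R, forall s, 0 <= s <= T -> `|Ys s w - Y s| <= M.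
  exists (eta + beta * C T w + y0) => s sT; apply: le_trans (ler_normB _ _) _.
  rewrite (ger0_norm (satisfaction_ge0 C eta0 beta0 s w)) (ger0_norm (ltW (Y0 s))).
  by rewrite lerD ?satisfaction_le// decay_path_le//; case/andP: sT.
have ikY : leb.-integrable `[0, T] (EFin \o (fun s => k s * (Ys s w - Y s))).
  by apply: integrable_bounded; [exact: measurable_funM|exact: bounded_mul].
have ikd : leb.-integrable `[0, T] (EFin \o (fun s => k s * dk s)).
  by apply: integrable_bounded; [exact: measurable_funM|exact: bounded_mul].
have ikwd : leb.-integrable `[0, T] (EFin \o (fun s => wealth * (k s * dk s))).
  apply: integrable_bounded; first by apply: measurable_funM => //; exact: measurable_funM.
  by apply: bounded_mul; [exists `|wealth| |exact: bounded_mul].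
(* The tangent inequality at [(Y, u)], multiplied by the discount factor; its term in [U - u] is
   absorbed by the [Gam s * a s] terms of the two identities. *)
have step1 : X 0 w + Iz w - u 0 <= \int[leb]_(s in `[0, T]) (k s * (Ys s w - Y s)).
  have gB (g v : R -> R) : measurable_fun `[0, T] g -> measurable_fun `[0, T] v ->
      (exists M : R, forall s, 0 <= s <= T -> `|g s| <= M) ->
      (exists M : R, forall s, 0 <= s <= T -> `|v s| <= M) ->
      leb.-integrable `[0, T] (EFin \o (fun s => Gam s * g s - Gam s * a s * v s)).
    move=> mg mv gM vM.
    have i1 : leb.-integrable `[0, T] (EFin \o (fun s => Gam s * g s)).
      by apply: integrable_bounded; [exact: measurable_funM|exact: bounded_mul].
    have i2 : leb.-integrable `[0, T] (EFin \o (fun s => Gam s * a s * v s)).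
      by apply: integrable_bounded; [exact: measurable_funM|exact: bounded_mul].
    by apply: eq_integrable (integrableB mI i1 i2) => // s _; rewrite /= EFinB.
  have i1 := gB _ _ (mphi w) (mUw w) (phi_bound w) (utility_path_bounded HU w).
  have i2 := gB _ _ mFp mu_ FB ubd.
  rewrite tail_path_identity utility_path_identity -RintegralB//.
  apply: le_Rintegral => //.
    by apply: eq_integrable (integrableB mI i1 i2) => // s _; rewrite /= EFinB.
  move=> s; rewrite /= in_itv/= => sT.
  have := A1_tangent (u s) (U s w) f_A1 sT (Y0 s) (satisfaction_ge0 C eta0 beta0 s w).
  rewrite /phi /k /path_a /path_b /path_f => H.
  have E (g p q m n y v : R) :
      g * (q + n * y + m * (v)) - g * q = g * n * y + g * m * v by ring.
  have := ler_wpM2l (Gam_ge0 s) H.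
  by rewrite !mulrDr !mulrA !mulrN; lra.
have step2 : \int[leb]_(s in `[0, T]) (k s * (Ys s w - Y s)) + wealth * Phi0 =
  \int[leb]_(s in `[0, T])
    (k s * \int[plan_measure C w]_(v in `[0, s]) decay_kernel beta s v).
  rewrite -RintegralZl// -RintegralD//; apply: eq_Rintegral => s _.
  by rewrite dYE; ring.
have ikV : leb.-integrable `[0, T] (EFin \o
    (fun s => k s * \int[plan_measure C w]_(v in `[0, s]) decay_kernel beta s v)).
  have := integrableD mI ikY ikwd.
  apply: eq_integrable => // s _ /=; rewrite -EFinD dYE; congr EFin; ring.
have Phi0E : (\int[leb]_(s in `[0%R, T]) (k s * decay_kernel beta s 0)%:E = Phi0%:E)%E.
  by rewrite /Phi0 /Rintegral fineK//; exact: integrable_fin_num ikd.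
rewrite -Phi0E.
apply: le_trans (kernel_budget_bound beta0 mk k_ge0 weight_noninc C w
  (psi := psi ^~ w) (fun t tT => psi_ge w tT)).
apply: (@le_trans _ _ (\int[leb]_(s in `[0%R, T])
    (k s * \int[plan_measure C w]_(v in `[0, s]) decay_kernel beta s v)%:E)%E).
  have := integrable_fin_num mI ikV => fV.
  rewrite -(fineK fV) lee_fin -[fine _]/(\int[leb]_(s in `[0, T]) _) -step2.
  by rewrite lerD2r.
rewrite le_eqVlt; apply/orP; left; apply/eqP; apply: eq_integral => s.
rewrite inE/= in_itv/= => /andP[s0 sT].
by rewrite EFinM /Rintegral fineK//; exact: decay_integral_fin_num.
Qed.

(** The mean of the left-hand side of [path_budget] is at most [Phi0 * wealth]. Since [Iz] has mean
    0 and [X 0] the mean of [U 0], the term [wealth * Phi0] cancels. *)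
Lemma verification : (\int[P]_w (U 0 w)%:E <= (u 0)%:E)%E.
Proof.
have TT : 0 <= (0 : R) <= T by rewrite lexx ltW.
have [iX iU XU] := X_cond TT.
have [B ZB] := Z_first_moment.
have [Ma aM] := aB; have [G GM] := Gam_bound.
have mGa : measurable_fun `[0, T] (fun s => Gam s * a s) by exact: measurable_funM.
have Ga s : 0 <= s <= T -> `|Gam s * a s| <= G * Ma.
  by move=> sT; rewrite normrM ler_pM ?GM ?aM.
have mZs s : 0 <= s <= T -> measurable_fun setT (Z s).
  by move=> sT; apply: measurable_funB; [exact: mX|exact: mU].
have mZw w : measurable_fun `[0, T] (Z ^~ w).
  exact: joint_measurable_section Z_joint_measurable.
have iI := integrable_zero_mean T0 Z_joint_measurable mGa Ga ZB mZs mZw Z_path_bounded.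
have I0 := integral_zero_mean T0 Z_joint_measurable mGa Ga ZB mZs mZw Z_path_bounded Z_mean.
have ic x : P.-integrable setT (EFin \o cst x) by exact: finite_measure_integrable_cst.
pose K := wealth * Phi0 - u 0.
have iM : P.-integrable setT (EFin \o (fun w => X 0 w + Iz w - u 0 + wealth * Phi0)).
  have -> : (fun w => X 0 w + Iz w - u 0 + wealth * Phi0) =
      (fun w => X 0 w + Iz w + K) by apply/funext => w; rewrite -addrA [- _ + _]addrC.
  have := integrableD measurableT (integrableD measurableT iX iI) (ic K).
  by apply: eq_integrable => // w _; rewrite /= -!EFinD.
have Phi0_ge0 : 0 <= Phi0.
  apply: Rintegral_ge0 => s; rewrite /= in_itv/= => sT.
  by rewrite mulr_ge0 ?k_ge0// decay_kernel_ge0.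
have psi0 w : (0 <= \int[plan_measure C w]_(t in `[0%R, T]) (psi t w)%:E)%E.
  apply: integral_ge0 => t; rewrite /= in_itv/= => tT.
  by rewrite lee_fin; apply: le_trans (psi_ge w tT); exact: expR_ge0.
have := expectation_budget iM Phi0_ge0 psi0 path_budget adm.
have -> : (\int[P]_w (X 0 w + Iz w - u 0 + wealth * Phi0)%:E =
    \int[P]_w (((EFin \o X 0%R) \+ (EFin \o Iz)) w + (EFin \o cst K) w))%E.
  by apply: eq_integral => w _; rewrite /= -!EFinD; congr EFin; rewrite /K; ring.
rewrite integralD//; last exact: integrableD iX iI.
have cK : (\int[P]_w (EFin \o cst K) w = K%:E)%E.
  transitivity (\int[P]_w (cst K%:E w))%E; first by [].
  by rewrite integral_cst// [X in (_ * X)%E]probability_setT mule1.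
rewrite integralD// I0 adde0 -XU [X in (_ + X <= _)%E]cK.
have fU : (\int[P]_w (U 0 w)%:E)%E \is a fin_num by exact: integrable_fin_num iU.
by rewrite -(fineK fU) -EFinD !lee_fin /K; lra.
Qed.
End verification.

Theorem proposition5p2 (d : measure_display) (Omega : measurableType d)
    (R : realType) (P0 Pstar : probability Omega R)
    (T r lambda theta eta beta alpha wealth : R)
    (B : R -> Omega -> R) (N : R -> Omega -> nat)
    (f : R -> R -> R -> R)
    (T_gt0 : 0 < T) (lambda_gt0 : 0 < lambda) (theta_gt0 : 0 < theta)
    (beta_gt0 : 0 < beta) (eta_ge0 : 0 <= eta) (wealth_gt0 : 0 < wealth)
    (B_brownian : brownian_motion P0 T B)
    (N_poisson : poisson_process P0 T lambda N)
    (BN_indep : independent P0 (sigma_process B `[0, T])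
                               (sigma_process N `[0, T]))
    (Pstar_density : density_on (filtration P0 B N T) Pstar P0
                       (pricing_density T lambda theta N))
    (f_borel : borel_aggregator T f)
    (f_A1 : A1 T f) (f_A2 : A2 T f)
    (alpha_itv : 0 < alpha < 1 / 2) (f_A3 : A3 T alpha f)
    (f_A4 : A4 (filtration P0 B N T) P0 Pstar alpha)
    (Dyf_C1 : C1_tyu T (Dy f))
    (Lf_le0 : forall t y u : R, 0 <= t <= T -> 0 <= y ->
       Lop T r lambda theta beta f t y u <= 0) :
  exists C : plan T (filtration P0 B N),
    (forall (t : R) w, 0 <= t <= T -> C t w = wealth) /\
    optimal P0 (state_price r lambda theta N) eta beta f wealth C.
Proof.
pose F := filtration P0 B N; pose y0 := eta + beta * wealth.
pose rho := r + lambda * (expR theta - 1).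
have y0_gt0 : 0 < y0 by rewrite /y0 ltr_wpDl// mulr_gt0.
have Fcst t (x : R) : measurable_wrt (F t) (cst x : Omega -> R) by exact: filtration_cst.
have Fm t : 0 <= t <= T -> F t `<=` measurable.
  by move=> tT; exact: (filtration_measurable B_brownian N_poisson tT).
have [C CE] := constant_plan_exists T_gt0 (ltW wealth_gt0) Fcst.
have Cw t w : 0 <= t <= T -> C t w = wealth by move=> /andP[t0 _]; rewrite CE t0.
exists C; split=> //.
have [u [mu ubd uE]] :=
  deterministic_utility T_gt0 f_borel f_A2 alpha_itv f_A3 beta_gt0 y0_gt0.
have [M FM] := path_f_bound f_A2 alpha_itv f_A3 beta_gt0 y0_gt0 ubd.
have mF := measurable_path_f f_borel beta y0_gt0 mu.
have uL s t : 0 <= s <= T -> 0 <= t <= T -> `|u s - u t| <= M * `|s - t|.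
  by move=> sT tT; rewrite (uE s)// (uE t)//; exact: tail_integral_lipschitz mF FM _ _ sT tT.
have YE t w : 0 <= t <= T -> satisfaction eta beta C t w = decay_path beta y0 t.
  by move=> tT; apply: satisfaction_constant => // s sT; exact: Cw.
have [U HU Uu] := recursive_utility_deterministic P0 T_gt0 Fcst Fm YE uL uE.
have N0 := poisson0 N_poisson.
have Nnd := poisson_nondecreasing N_poisson.
split; first exact: admissible_constant T_gt0 (ltW wealth_gt0) (ltW theta_gt0) Cw N0 Nnd.
exists U => // C' U' adm HU'.
have TT : 0 <= (0 : R) <= T by rewrite lexx ltW.
(* As [theta > 0] and [N >= 0], dropping the jumps can only lower the state price. *)
have psi_ge t w : 0 <= t <= T -> expR (- (rho * t)) <= state_price r lambda theta N t w.
  by move=> _; rewrite ler_expR lerBrDl subrr mulr_ge0// ltW.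
have weight_noninc s1 s2 (s10 : 0 < s1) (s12 : s1 <= s2) (s2T : s2 < T) :=
  weight_nonincreasing T_gt0 f_borel f_A1 f_A2 alpha_itv f_A3 beta_gt0 y0_gt0
    mu ubd uE Dyf_C1 Lf_le0 (erefl rho) s10 s12 s2T.
have U'0 : (\int[P0]_w (U' 0 w)%:E <= (u 0)%:E)%E.
  exact: (verification T_gt0 Fcst Fm f_borel f_A1 f_A2 alpha_itv f_A3 eta_ge0 beta_gt0
    wealth_gt0 HU' psi_ge adm (erefl y0) mu ubd uE weight_noninc).
have [U'F _ _ /(_ 0 TT)[_ iU' _ _]] := HU'.
have := trivial_ae_le (filtration0_trivial B_brownian N_poisson T_gt0) (Fm 0 TT)
  (U'F 0 TT) iU' U'0.
by apply: filterS => w; rewrite Uu.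
Qed.
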